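(* Let $G$ be a complete graph on $n \ge 7$ vertices, and let $\phi : E(G) \to [0,1]$ be such that $\sum_{e \in E(G)} \phi(e) \ge \binom{n}{2} - (n-4)$. Then there is a fractional triangle packing $\omega$ in $G$ such that $\omega(e) = \phi(e)$ for every $e \in E(G)$.
   Context: Graphs are finite and simple. A fractional triangle packing in a graph $G$ is an assignment $\omega$ of weights in $[0,1]$ to the triangles of $G$ such that $\sum_{w \in V(G)} \omega(uvw) \le 1$ for every edge $uv$ of $G$, where $\omega(uvw) = 0$ if $uvw$ is not a triangle in $G$. For an edge $e = uv$ of $G$ write $\omega(e) = \sum_{w \in V(G)} \omega(uvw)$. *)

(* Defs.v *)
From HB Require Import structures.
From mathcomp Require Import all_boot all_order all_algebra.
From mathcomp Require Import reals.

Set Implicit Arguments.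
Unset Strict Implicit.
Unset Printing Implicit Defensive.

Import Order.TTheory GRing.Theory Num.Theory.
Local Open Scope ring_scope.

Record sgraph := SGraph {
  vertex :> finType;
  adj : rel vertex;
  adj_sym : symmetric adj;
  adj_irrefl : irreflexive adj }.

Definition complete (G : sgraph) : Prop :=
  forall x y : G, x != y -> adj x y.

Definition edges (G : sgraph) : {set {set G}} :=
  [set [set p.1; p.2] | p : G * G & adj p.1 p.2].

Definition triangles (G : sgraph) : {set {set G}} :=
  [set t : {set G} |
    (#|t| == 3%N) &&
    [forall x in t, forall y in t, (x != y) ==> adj x y]].

(* For e = {u, v}, the set w |: e is {u, v, w}. When w is u or v it has only
   two elements, so a fractional triangle packing gives it weight 0. *)
Definition edge_weight (R : realType) (G : sgraph) (omega : {set G} -> R)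
    (e : {set G}) : R :=
  \sum_(w : G) omega (w |: e).

Definition fractional_triangle_packing (R : realType) (G : sgraph)
    (omega : {set G} -> R) : Prop :=
  [/\ forall t, t \in triangles G -> 0 <= omega t <= 1,
      forall t, t \notin triangles G -> omega t = 0
    & forall e, e \in edges G -> edge_weight omega e <= 1].

(* Main.v *)
Require Import Defs.
From HB Require Import structures.
From mathcomp Require Import all_boot all_order all_algebra.
From mathcomp Require Import reals.
From mathcomp Require Import zify ring lra.

Set Implicit Arguments.
Unset Strict Implicit.
Unset Printing Implicit Defensive.

Import Order.TTheory GRing.Theory Num.Theory.
Local Open Scope ring_scope.

(** Linear programming duality (the lemma [farkas], with the edges as rows and
    the triangles as columns) produces the packing unless some weight [y] on the
    edges has nonnegative sum on every triangle while [sum phi(e) y(e) < 0].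
    For a fixed [y], the sum can only decrease when [phi] becomes [0] on a set
    [F] of [n - 4] edges where [y] is largest and [1] on all other edges
    ([top_set], [dual_nonneg]).  So everything reduces to a statement about
    graphs, [tot_nonneg n]: if [F] is a set of at most [n - 4] pairs among [n]
    vertices and [y] is nonnegative on the triangles of the complement [G] of
    [F], then [y] has nonnegative total on [G].  In dual terms: [G] has a
    fractional triangle decomposition.

    This is proved by induction on [n >= 7] ([tot_nonneg_ge7]).  Let [D] be a
    set of vertices meeting at least [|D|] pairs of [F].  If at least seven
    vertices remain, the induction hypothesis applies to them, and if [D] meets
    [|D| + s] pairs of [F], then [s] spare edges can be thrown into [F] as well:
    the total of [G - D] is at least the total of any [s] of its edges
    ([tot_ge_extra]).
    - If [F] has fewer than [n - 4] pairs, or every vertex meets [F], averaging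
      over all deletions of one vertex suffices ([tot_avg]).
    - If a vertex [u] has [F]-degree at least [(n + 1) / 3], delete it, and take
      as spare edges a matching of the [G]-neighbours of [u] (two adjacent edges
      are needed if their number is odd).  The triangles of [u] over the spare
      edges make these edges pay for the edges at [u] ([matching_cover],
      [hub_nonneg]).
    - Otherwise average [y] over the set [I] of vertices that [F] does not meet
      ([symmetrise]).  On pairs meeting [I] the weight is then described by one
      number [eta u] for each other vertex [u], and one number [z].  Deleting a
      vertex [u] that meets [F] together with [j] vertices of [I], and spending
      what is left on edges between [I] and the other vertices, gives a system of
      linear inequalities ([deletion_bound]).  Suitable combinations of them
      prove the claim when [|I| >= 3] and [n >= 9] ([many_isolated_nonneg]), when
      [|I| = 2] and [n >= 10] ([two_isolated_nonneg]), and when [|I| = 1] and two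
      vertices have [F]-degree at least [2] ([one_isolated_nonneg]).  If [I] is
      large compared with its complement, the triangles that meet [I] suffice
      ([small_support_nonneg]).
    - Eleven graphs [F] on at most nine vertices are left.  For each of them an
      explicit fractional triangle decomposition of the complement is checked
      by computation ([decomposition_nonneg]), and a count of degrees shows that
      the list is complete ([one_isolated_exceptions_nonneg],
      [two_isolated_exceptions_nonneg]). *)

(** * Weights on the pairs of a vertex set *)

(** Sums run over ordered pairs: every unordered pair counts twice, here and in
    [miss]. *)
Definition tot (T : finType) (V : nmodType) (f : T -> T -> V) (U : {set T}) : V :=
  \sum_(a in U) \sum_(b in U) f a b.

Definition miss (T : finType) (F : rel T) (U : {set T}) : nat :=
  (\sum_(a in U) \sum_(b in U) F a b)%N.

Definition deg (T : finType) (F : rel T) (U : {set T}) (u : T) : nat :=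
  (\sum_(b in U) F u b)%N.

Definition ydeg (T : finType) (R : realFieldType) (y : T -> T -> R) (U : {set T}) (u : T) : R :=
  \sum_(b in U) y u b.

Lemma big_setU_disjoint (S : Type) (idx : S) (op : Monoid.com_law idx) (T : finType)
    (A B : {set T}) (g : T -> S) : [disjoint A & B] ->
  \big[op/idx]_(a in A :|: B) g a =
    op (\big[op/idx]_(a in A) g a) (\big[op/idx]_(a in B) g a).
Proof. by move=> dAB; rewrite -bigU //; apply: eq_bigl => a; rewrite !inE. Qed.

Lemma totD1 (T : finType) (V : nmodType) (f : T -> T -> V) (U : {set T}) u :
  (forall a b, f a b = f b a) -> f u u = 0 -> u \in U ->
  tot f U = tot f (U :\ u) + (\sum_(b in U) f u b) *+ 2.
Proof.
move=> fC fuu uU; rewrite /tot.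
have e (g : T -> V) : \sum_(a in U) g a = g u + \sum_(a in U :\ u) g a.
  by rewrite (big_setD1 u).
have eD : \sum_(b in U) f u b = \sum_(b in U :\ u) f u b by rewrite e fuu add0r.
under eq_bigr => a _ do rewrite e.
rewrite big_split /= [X in _ + X]e.
under eq_bigr => a _ do rewrite fC.
by rewrite -eD mulr2n addrA addrC.
Qed.

Lemma tot_setU (T : finType) (V : nmodType) (f : T -> T -> V) (A B : {set T}) :
  (forall a b, f a b = f b a) -> [disjoint A & B] ->
  tot f (A :|: B) = tot f A + tot f B + (\sum_(a in A) \sum_(b in B) f a b) *+ 2.
Proof.
move=> fC dAB; rewrite /tot.
have e (g : T -> V) : \sum_(a in A :|: B) g a = \sum_(a in A) g a + \sum_(a in B) g a.
  exact: big_setU_disjoint.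
rewrite e; under eq_bigr => a _ do rewrite e.
under [X in _ + X]eq_bigr => a _ do rewrite e.
rewrite !big_split /= [X in _ + (X + _)]exchange_big /=.
under [X in _ + (X + _)]eq_bigr => a _ do under eq_bigr => b _ do rewrite fC.
by rewrite mulr2n -!addrA; congr (_ + _); rewrite [RHS]addrC -!addrA.
Qed.

(** The weights that the dual problem produces, for the graph on [U] whose
    edges are the pairs outside [F]; the pairs in [F] carry weight [0], so that
    [tot y U] is twice the total weight of that graph. *)
Definition tri_weight (T : finType) (R : realFieldType) (U : {set T}) (F : rel T)
    (y : T -> T -> R) : Prop :=
  [/\ symmetric F, irreflexive F, (forall a b, y a b = y b a),
      (forall a b, a \in U -> b \in U -> (a == b) || F a b -> y a b = 0) &
      (forall a b c, a \in U -> b \in U -> c \in U -> a != b -> a != c -> b != c ->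
         ~~ F a b -> ~~ F a c -> ~~ F b c -> 0 <= y a b + y a c + y b c)].

(** The claim of the induction.  As [miss F U] is twice the number of pairs,
    the bound says that at most [n - 4] pairs are missing. *)
Definition tot_nonneg (n : nat) : Prop :=
  forall (R : realFieldType) (T : finType) (U : {set T}) (F : rel T) (y : T -> T -> R),
  #|U| = n -> tri_weight U F y -> (miss F U + 8 <= 2 * n)%N -> 0 <= tot y U.

Lemma tri_weightS (T : finType) (R : realFieldType) (U V : {set T}) (F : rel T)
    (y : T -> T -> R) :
  V \subset U -> tri_weight U F y -> tri_weight V F y.
Proof.
move=> /subsetP VU [Fs Fi ys y0 yt]; split=> // [a b aV bV|a b c aV bV cV].
  by apply: y0; apply: VU.
by apply: yt; apply: VU.
Qed.

(** Pairs that may still be added to [F] can be used to bound the total from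
    below: their weights are set to [0], and the claim is applied to the rest. *)
Lemma tot_ge_extra n (R : realFieldType) (T : finType) (V : {set T}) (F M : rel T)
    (y : T -> T -> R) :
  tot_nonneg n -> #|V| = n -> tri_weight V F y -> symmetric M -> irreflexive M ->
  (miss F V + miss M V + 8 <= 2 * n)%N ->
  \sum_(a in V) \sum_(b in V | M a b) y a b <= tot y V.
Proof.
move=> P cV [Fs Fi ys y0 yt] Ms Mi le.
pose y' a b := if M a b then 0 else y a b.
pose F' := [rel a b | F a b || M a b].
have : 0 <= tot y' V.
  apply: (P R T V F') => //.
    split=> /=.
    - by move=> a b /=; rewrite Fs Ms.
    - by move=> a /=; rewrite Fi Mi.
    - by move=> a b; rewrite /y' Ms ys.
    - move=> a b aV bV; rewrite /y'; case: ifP => // Mab.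
      by rewrite orbF; apply: y0.
    - move=> a b c aV bV cV' ab ac bc; rewrite /y' !negb_or.
      move=> /andP[Fab /negPf ->] /andP[Fac /negPf ->] /andP[Fbc /negPf ->].
      exact: yt.
  apply: leq_trans le; rewrite leq_add2r /miss -big_split /= leq_sum // => a _.
  rewrite -big_split /= leq_sum // => b _.
  by case: (F a b); case: (M a b).
suff -> : tot y' V = tot y V - \sum_(a in V) \sum_(b in V | M a b) y a b.
  by rewrite subr_ge0.
apply/eqP; rewrite eq_sym subr_eq /tot -big_split /=; apply/eqP.
apply: eq_bigr => a _; rewrite [in LHS](bigID (M a)) /= addrC; congr (_ + _).
rewrite big_mkcond [RHS]big_mkcond; apply: eq_bigr => b _; rewrite /y'.
by case: (b \in V); case: (M a b).
Qed.

Lemma missD1 (T : finType) (F : rel T) (U : {set T}) u :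
  symmetric F -> irreflexive F -> u \in U ->
  miss F U = (miss F (U :\ u) + 2 * deg F U u)%N.
Proof.
move=> Fs Fi uU.
pose f a b := nat_of_bool (F a b).
have -> : miss F U = tot f U by [].
rewrite (totD1 (u := u)) //; first by rewrite mulr2n mul2n -addnn.
  by move=> a b; rewrite /f Fs.
by rewrite /f Fi.
Qed.

Lemma totyD1 (T : finType) (R : realFieldType) (U : {set T}) (F : rel T)
    (y : T -> T -> R) u :
  tri_weight U F y -> u \in U -> tot y U = tot y (U :\ u) + 2 * ydeg y U u.
Proof.
move=> [_ _ ys y0 _] uU; rewrite (totD1 (u := u)) //; first by rewrite mulr_natl.
by apply: y0 => //; rewrite eqxx.
Qed.

(** Each pair survives in all but two of the deletions of one vertex. *)
Lemma tot_avg (T : finType) (R : realFieldType) (U : {set T}) (F : rel T)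
    (y : T -> T -> R) :
  tri_weight U F y -> (3 <= #|U|)%N ->
  (forall u, u \in U -> 0 <= tot y (U :\ u)) -> 0 <= tot y U.
Proof.
move=> tw U3 h.
have : 0 <= \sum_(u in U) tot y (U :\ u) by apply: sumr_ge0.
have e u : u \in U -> tot y (U :\ u) = tot y U - 2 * ydeg y U u.
  by move=> uU; rewrite (totyD1 tw uU) addrK.
rewrite (eq_bigr _ e) sumrB sumr_const -mulr_sumr.
rewrite -[X in 2 * X]/(tot y U) -[X in X - _]mulr_natl -mulrBl.
by rewrite pmulr_rge0 // subr_gt0 ltr_nat.
Qed.

(** * A vertex of large degree *)

Lemma miss_deg (T : finType) (F : rel T) (N : {set T}) :
  miss F N = (\sum_(x in N) deg F N x)%N.
Proof. by []. Qed.

(** A vertex [x] of largest degree and a non-neighbour [x'] of [x] of largest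
    degree: matching them removes enough pairs of [F] for the hypothesis of
    [matching_cover] to survive on the other vertices.  Either their degrees add
    up to at least [2], or all pairs of [F] meet [x]. *)
Lemma deletable_pair (T : finType) (F : rel T) (N : {set T}) m :
  symmetric F -> irreflexive F -> #|N| = m.+4 -> (miss F N <= 2 * m.+1)%N ->
  exists x x', [/\ x \in N, x' \in N, x != x', ~~ F x x' &
    (miss F N <= 2 * (deg F N x + deg F N x') + 2 * (m.-1))%N].
Proof.
move=> Fs Fi cN hm.
have /card_gt0P[x0 x0N] : (0 < #|N|)%N by rewrite cN.
case: (@arg_maxnP T x0 (fun x => x \in N) (deg F N) x0N) => x xN xmax.
have dx : (deg F N x <= m.+1)%N.
  have := hm; rewrite (missD1 Fs Fi xN); clear; lia.
pose B := [set b in N | (b != x) && ~~ F x b].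
have /card_gt0P[b0 b0B] : (0 < #|B|)%N.
  rewrite lt0n; apply/eqP => B0.
  have : (#|N| <= deg F N x + 1)%N.
    rewrite -sum1_card (big_setD1 x) //= addnC leq_add2r.
    rewrite /deg [X in (_ <= X)%N](big_setD1 x) //= Fi add0n; apply: leq_sum => b.
    rewrite !inE => /andP[bx bN]; move/cards0_eq/setP/(_ b): B0.
    by rewrite !inE bN bx /=; case: (F x b).
  by rewrite cN; move: dx; clear; lia.
case: (@arg_maxnP T b0 (fun b => b \in B) (deg F N) b0B) => x' x'B x'max.
move: (x'B); rewrite !inE => /and3P[x'N x'x Fxx'].
exists x, x'; split=> //; first by rewrite eq_sym.
have : [|| 1 < deg F N x, 0 < deg F N x' | miss F N <= 2 * deg F N x]%N.
  rewrite -[X in [|| X, _ | _]]negbK -[X in [|| _, X | _]]negbK -!leqNgt.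
  case: (leqP (deg F N x) 1) => //= d1; case: (leqP (deg F N x') 0) => //= d0.
  have dB b : b \in B -> deg F N b = 0%N.
    by move=> /x'max h; apply/eqP; rewrite -leqn0 (leq_trans h).
  rewrite miss_deg (big_setD1 x) //= mul2n -addnn leq_add2l.
  have -> : (\sum_(b in N :\ x) deg F N b = \sum_(b in N :\ x) F x b * deg F N b)%N.
    apply: eq_bigr => b; rewrite !inE => /andP[bx bN].
    case: (boolP (F x b)) => [_|Fxb]; first by rewrite mul1n.
    by rewrite dB // !inE bN bx.
  apply: (@leq_trans (\sum_(b in N :\ x) F x b)%N); last first.
    by rewrite /deg [X in (_ <= X)%N](big_setD1 x) //= leq_addl.
  apply: leq_sum => b; rewrite !inE => /andP[_ bN]; case: (F x b) => //.
  by rewrite mul1n (leq_trans (xmax _ bN)).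
by have := hm; have := xmax _ x'N; clear; case: m => [|m] /=; lia.
Qed.

(** Like [tot], this counts every pair of [M] twice. *)
Definition mtot (T : finType) (R : realFieldType) (M : rel T) (y : T -> T -> R)
   (N : {set T}) : R := tot (fun a b => (M a b)%:R * y a b) N.

Lemma mtotD1 (T : finType) (R : realFieldType) (N : {set T}) (M : rel T)
    (y : T -> T -> R) u :
  symmetric M -> irreflexive M -> (forall a b, y a b = y b a) -> u \in N ->
  mtot M y N = mtot M y (N :\ u) + 2 * \sum_(b in N) (M u b)%:R * y u b.
Proof.
move=> Ms Mi ys uN; rewrite /mtot (totD1 (u := u)) //; first by rewrite mulr_natl.
  by move=> a b; rewrite Ms ys.
by rewrite Mi mul0r.
Qed.

Lemma least3 (R : realFieldType) (p q r : R) :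
  [\/ r <= p /\ r <= q, q <= p /\ q <= r | p <= q /\ p <= r].
Proof.
case: (leP p q) => pq.
  by case: (leP p r) => pr; [apply: Or33 | apply: Or31]; split=> //; lra.
by case: (leP q r) => qr; [apply: Or32 | apply: Or31]; split=> //; lra.
Qed.

(** Greedy construction of an edge cover of the graph outside [F], by induction
    along [deletable_pair]: each matched edge [x x'] pays for [a x + a x'].  In
    [hub_nonneg], [a x] is minus the weight of the edge from the hub to [x], and
    the first hypothesis on [a] is the triangle condition at the hub. *)
Lemma matching_cover (T : finType) (R : realFieldType) (F : rel T)
    (y : T -> T -> R) (a : T -> R) (k : nat) (N : {set T}) :
  tri_weight N F y ->
  (forall x x', x \in N -> x' \in N -> x != x' -> ~~ F x x' -> a x + a x' <= y x x') ->
  (#|N| <= k)%N -> (2 <= #|N|)%N -> (miss F N <= 2 * (#|N| - 3))%N ->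
  exists M : rel T, [/\ symmetric M, irreflexive M,
    (forall x x', M x x' -> x \in N /\ x' \in N),
    (miss M N <= 2 * uphalf #|N|)%N &
    2 * \sum_(x in N) a x <= mtot M y N].
Proof.
elim: k N => [|k IHk] N tw ha Nk N2 hm; first by move: Nk N2; clear; lia.
have [Fs Fi ys y0 yt] := tw.
(* a matched pair may be joined to the edges chosen on the other vertices *)
have step x x' : x \in N -> x' \in N -> x != x' -> ~~ F x x' ->
  (exists M : rel T, [/\ symmetric M, irreflexive M,
    (forall b b', M b b' -> b \in (N :\ x) :\ x' /\ b' \in (N :\ x) :\ x'),
    (miss M ((N :\ x) :\ x') <= 2 * uphalf #|(N :\ x) :\ x'|)%N &
    2 * \sum_(b in (N :\ x) :\ x') a b <= mtot M y ((N :\ x) :\ x')]) ->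
  exists M : rel T, [/\ symmetric M, irreflexive M,
    (forall b b', M b b' -> b \in N /\ b' \in N),
    (miss M N <= 2 * uphalf #|N|)%N &
    2 * \sum_(b in N) a b <= mtot M y N].
  move=> xN x'N xx' Fxx' [M [Ms Mi MN Mm My]].
  pose e b b' := (b == x) && (b' == x') || (b == x') && (b' == x).
  pose M' b b' := M b b' || e b b'.
  have es b b' : e b b' = e b' b.
    by rewrite /e orbC; congr (_ || _); rewrite andbC.
  have ei b : e b b = false.
    rewrite /e; have [-> | _] /= := eqVneq b x; first by rewrite (negPf xx').
    by rewrite andbF.
  have Ms' : symmetric M' by move=> b b'; rewrite /M' Ms es.
  have Mi' : irreflexive M' by move=> b; rewrite /M' Mi ei.
  have x'N1 : x' \in N :\ x by rewrite !inE eq_sym xx'.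
  have NMx b : M x b = false by apply/negP => /MN[]; rewrite !inE eqxx andbF.
  have NMx' b : M x' b = false by apply/negP => /MN[]; rewrite !inE eqxx.
  have rowx b : M' x b = (b == x').
    by rewrite /M' NMx /e eqxx (negPf xx') /= orbF.
  have rowx' b : M' x' b = (b == x).
    by rewrite /M' NMx' /e eqxx eq_sym (negPf xx') /=.
  have rest b b' : b \in (N :\ x) :\ x' -> M' b b' = M b b'.
    by rewrite !inE => /and3P[/negPf h1 /negPf h2 _]; rewrite /M' /e h1 h2 orbF.
  have pick (V : nmodType) (g : T -> V) (B : {set T}) c : c \in B ->
      \sum_(b in B) g b = g c + \sum_(b in B :\ c) g b.
    by move=> cB; rewrite (big_setD1 c).
  exists M'; split=> //.
  - move=> b b' /orP[/MN|].
      by rewrite !inE => -[/and3P[_ _ ->] /and3P[_ _ ->]].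
    by move=> /orP[] /andP[/eqP-> /eqP->].
  - rewrite (missD1 Ms' Mi' xN) (missD1 Ms' Mi' x'N1).
    have -> : deg M' N x = 1%N.
      rewrite /deg (big_setD1 x') //= rowx eqxx big1 ?addn0 // => b.
      by rewrite rowx !inE => /andP[/negPf -> _].
    have -> : deg M' (N :\ x) x' = 0%N.
      by rewrite /deg big1 // => b; rewrite rowx' !inE => /andP[/negPf -> _].
    have -> : miss M' ((N :\ x) :\ x') = miss M ((N :\ x) :\ x').
      by apply: eq_bigr => b bN; apply: eq_bigr => b' _; rewrite rest.
    have -> : #|N| = #|(N :\ x) :\ x'|.+2.
      by rewrite (cardsD1 x N) xN (cardsD1 x' (N :\ x)) x'N1.
    by move: Mm => /=; clear; lia.
  - rewrite (mtotD1 Ms' Mi' ys xN) (mtotD1 Ms' Mi' ys x'N1).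
    rewrite (pick _ a _ _ xN) (pick _ a _ _ x'N1).
    have -> : \sum_(b in N) (M' x b)%:R * y x b = y x x'.
      rewrite (pick _ _ _ _ x'N) rowx eqxx mul1r big1 ?addr0 // => b.
      by rewrite rowx !inE => /andP[/negPf -> _]; rewrite mul0r.
    have -> : \sum_(b in N :\ x) (M' x' b)%:R * y x' b = 0.
      by rewrite big1 // => b; rewrite rowx' !inE => /andP[/negPf -> _]; rewrite mul0r.
    have -> : mtot M' y ((N :\ x) :\ x') = mtot M y ((N :\ x) :\ x').
      by apply: eq_bigr => b bN; apply: eq_bigr => b' _; rewrite rest.
    have := ha x x' xN x'N xx' Fxx'; lra.
have nomiss x x' : miss F N = 0%N -> x \in N -> x' \in N -> ~~ F x x'.
  move=> m0 xN x'N; apply/negP => Fxx'.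
  move: m0; rewrite /miss (big_setD1 x) //= (big_setD1 x') //= Fxx'; lia.
(* an odd number of vertices cannot be matched; the last three of them are
   covered by the two heaviest edges of a triangle, whose sum is at least half
   of the sum of the three edges because that sum is nonnegative *)
have star c p q : miss F N = 0%N -> N = [set c; p; q] -> c != p -> c != q -> p != q ->
  y p q <= y c p /\ y p q <= y c q ->
  exists M : rel T, [/\ symmetric M, irreflexive M,
    (forall b b', M b b' -> b \in N /\ b' \in N),
    (miss M N <= 2 * uphalf #|N|)%N &
    2 * \sum_(b in N) a b <= mtot M y N].
  move=> m0 eN cp cq pq [hp hq].
  have cN : c \in N by rewrite eN !inE eqxx.
  have pN : p \in N by rewrite eN !inE eqxx orbT.
  have qN : q \in N by rewrite eN !inE eqxx orbT.
  have eNc : N :\ c = [set p; q].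
    by apply/setP => b; rewrite eN !inE; have [->|] := eqVneq b c; rewrite ?(negPf cp) ?(negPf cq).
  pose M b b' := (b == c) && (b' \in [set p; q]) || (b' == c) && (b \in [set p; q]).
  have Ms : symmetric M by move=> b b'; rewrite /M orbC.
  have Mi : irreflexive M.
    move=> b; rewrite /M orbb; have [->|] //= := eqVneq b c.
    by rewrite !inE (negPf cp) (negPf cq).
  have Mc b : M c b = (b \in [set p; q]).
    by rewrite /M eqxx !inE (negPf cp) (negPf cq) andbF orbF.
  have M0 b b' : b \in N :\ c -> b' \in N :\ c -> M b b' = false.
    by rewrite /M !in_setD1 => /andP[/negPf-> _] /andP[/negPf-> _].
  have sum2 (V : nmodType) (g : T -> V) : \sum_(b in [set p; q]) g b = g p + g q.
    by rewrite big_setU1 ?inE //= big_set1.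
  have [p2 q2] : p \in [set p; q] /\ q \in [set p; q] by rewrite !inE !eqxx orbT.
  exists M; split=> //.
  - by move=> b b'; rewrite /M eN !inE => /orP[] /andP[/eqP-> /orP[] /eqP->];
      rewrite !eqxx ?orbT.
  - rewrite (missD1 Ms Mi cN) {1}/miss big1 ?add0n; last first.
      by move=> b bN; rewrite big1 // => b' b'N; rewrite M0.
    rewrite /deg (big_setD1 c) //= Mi add0n eNc big_setU1 ?inE //= big_set1 !Mc p2 q2.
    by rewrite eN (cardsD1 c) -eN eNc cN cards2 pq.
  - have m1 : mtot M y (N :\ c) = 0.
      by rewrite /mtot /tot big1 // => b bN; rewrite big1 // => b' b'N; rewrite M0 // mul0r.
    rewrite (mtotD1 Ms Mi ys cN) m1 add0r.
    rewrite !(big_setD1 c cN) /= Mi mul0r !add0r eNc !sum2 !Mc p2 q2 !mul1r.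
    have := ha _ _ cN pN cp (nomiss _ _ m0 cN pN).
    have := ha _ _ cN qN cq (nomiss _ _ m0 cN qN).
    have := ha _ _ pN qN pq (nomiss _ _ m0 pN qN).
    have := yt _ _ _ cN pN qN cp cq pq.
    move=> /(_ (nomiss _ _ m0 cN pN) (nomiss _ _ m0 cN qN) (nomiss _ _ m0 pN qN)).
    by case: (leP 0 (y p q)) => *; lra.
have [cN|[cN|[m cN]]] : #|N| = 2%N \/ #|N| = 3%N \/ exists m, #|N| = m.+4.
  case: #|N| N2 => [|[|[|[|m]]]] // _; [by left | by right; left |].
  by right; right; exists m.
- have miss0 : miss F N = 0%N by move: hm; rewrite cN; clear; lia.
  have /cards2P[x [x' [xx' eN]]] : #|N| == 2%N by rewrite cN.
  have xN : x \in N by rewrite eN !inE eqxx.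
  have x'N : x' \in N by rewrite eN !inE eqxx orbT.
  apply: (step x x' xN x'N xx' (nomiss _ _ miss0 xN x'N)).
  have -> : (N :\ x) :\ x' = set0.
    by apply/setP => b; rewrite eN !inE; case: eqP => //; case: eqP.
  by exists (fun _ _ => false); rewrite /mtot /tot /miss !big_set0 mulr0.
- have miss0 : miss F N = 0%N by move: hm; rewrite cN; clear; lia.
  have /card_gt2P[x [x' [x'' [[xN x'N x''N] [h1 h2 h3]]]]] : (2 < #|N|)%N by rewrite cN.
  have eN : N = [set x; x'; x''].
    apply/eqP; rewrite eq_sym eqEcard cN setUC cardsU1 cards2 !inE (negPf h3).
    rewrite (eq_sym x'' x') (negPf h2) h1 andbT.
    by apply/subsetP => b; rewrite !inE => /or3P[] /eqP->.
  have [h|h|h] := least3 (y x x') (y x x'') (y x' x'').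
  + by apply: (star x x' x''); rewrite // eq_sym.
  + apply: (star x' x x''); rewrite // 1?(ys x' x) //; last 2 first.
    * by rewrite eq_sym.
    * by rewrite eq_sym.
    by rewrite eN; apply/setP => b; rewrite !inE -!orbA orbCA.
  + apply: (star x'' x x'); rewrite // 1?eq_sym // ?(ys x'') //.
    by rewrite eN; apply/setP => b; rewrite !inE -!orbA orbC -orbA orbC -orbA.
rewrite cN in hm; have [x [x' [xN x'N xx' Fxx' hp]]] := deletable_pair Fs Fi cN hm.
have x'N1 : x' \in N :\ x by rewrite !inE eq_sym xx'.
have cN' : #|(N :\ x) :\ x'| = m.+2.
  move: cN; rewrite (cardsD1 x N) xN (cardsD1 x' (N :\ x)) x'N1; clear; lia.
have sub : (N :\ x) :\ x' \subset N by apply: subset_trans (subsetDl _ _); apply: subsetDl.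
apply: (step x x' xN x'N xx' Fxx'); apply: IHk.
- exact: tri_weightS tw.
- by move=> b b' bN b'N; apply: ha; apply: (subsetP sub).
- by rewrite cN'; move: Nk; rewrite cN; clear; lia.
- by rewrite cN'.
- rewrite cN'; move: hp; rewrite (missD1 Fs Fi xN) (missD1 Fs Fi x'N1).
  have -> : deg F N x' = deg F (N :\ x) x'.
    by rewrite /deg (big_setD1 x) //= Fs (negPf Fxx').
  by clear; lia.
Qed.

(** The deletion of [u] frees [deg F U u - 1] spare edges.  The [G]-neighbours
    [N] of [u] number [n - deg F U u], and [n.+2 <= 3 * deg F U u] says precisely
    that [uphalf #|N|] edges are affordable. *)
Lemma hub_nonneg n (R : realFieldType) (T : finType) (U : {set T}) (F : rel T)
    (y : T -> T -> R) u :
  tot_nonneg n -> #|U| = n.+1 -> (7 <= n)%N -> tri_weight U F y ->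
  (miss F U + 8 <= 2 * n.+1)%N -> u \in U -> (n.+2 <= 3 * deg F U u)%N -> 0 <= tot y U.
Proof.
move=> P cU n7 tw hm uU hub; have [Fs Fi ys y0 yt] := tw.
pose N := [set x in U | (x != u) && ~~ F u x].
have NU x : x \in N -> [/\ x \in U, u != x & ~~ F u x].
  by rewrite inE eq_sym => /and3P.
have NV : N \subset U :\ u.
  by apply/subsetP => x; rewrite !inE => /and3P[-> -> _].
have cV : #|U :\ u| = n by move: cU; rewrite (cardsD1 u U) uU; clear; lia.
have cN : (#|N| + deg F U u = n)%N.
  rewrite -cV /deg (big_setD1 u) //= Fi add0n -!sum1_card.
  rewrite [X in (X + _)%N](eq_bigl (fun x => (x \in U :\ u) && ~~ F u x)); last first.
    by move=> x; rewrite !inE; case: (x != u); case: (x \in U).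
  rewrite big_mkcondr -big_split /=; apply: eq_bigr => x _.
  by case: (F u x).
have mN : (miss F N <= miss F (U :\ u))%N.
  rewrite /miss [X in (_ <= X)%N](big_setID N) /= (setIidPr NV).
  apply: leq_trans (leq_addr _ _); apply: leq_sum => a _.
  rewrite [X in (_ <= X)%N](big_setID N) /= (setIidPr NV); exact: leq_addr.
have mU := missD1 Fs Fi uU.
pose a x := - y u x.
have ha x x' : x \in N -> x' \in N -> x != x' -> ~~ F x x' -> a x + a x' <= y x x'.
  move=> /NU[xU ux Fux] /NU[x'U ux' Fux'] xx' Fxx'.
  by have := yt u x x' uU xU x'U ux ux' xx' Fux Fux' Fxx'; rewrite /a; lra.
have N3 : (3 <= #|N|)%N by move: hm mU cN; clear -n7; lia.
have [|//|M [Ms Mi MN Mm My]] := matching_cover (tri_weightS _ tw) ha (leqnn #|N|) (ltnW N3).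
- exact: subset_trans NV (subsetDl _ _).
- by move: hm mU cN mN hub n7 N3; clear; lia.
have supp (V : nmodType) (g : T -> T -> V) : (forall b b', ~~ M b b' -> g b b' = 0) ->
    \sum_(b in U :\ u) \sum_(b' in U :\ u) g b b' = tot g N.
  move=> g0; rewrite /tot (big_setID N) /= (setIidPr NV).
  rewrite [X in _ + X]big1 ?addr0; last first.
    move=> b; rewrite !inE => /andP[bN _]; rewrite big1 // => b' _; apply: g0.
    by apply/negP => /MN[]; rewrite !inE (negPf bN).
  apply: eq_bigr => b _; rewrite (big_setID N) /= (setIidPr NV).
  rewrite [X in _ + X]big1 ?addr0 // => b'; rewrite !inE => /andP[b'N _]; apply: g0.
  by apply/negP => /MN[_]; rewrite !inE (negPf b'N).
have mM : miss M (U :\ u) = miss M N.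
  by apply: (supp nat (fun b b' => nat_of_bool (M b b'))) => b b' /negPf->.
have sM : \sum_(b in U :\ u) \sum_(b' in U :\ u | M b b') y b b' = mtot M y N.
  rewrite /mtot -supp; last by move=> b b' /negPf->; rewrite mul0r.
  apply: eq_bigr => b _; rewrite big_mkcondr; apply: eq_bigr => b' _.
  by case: (M b b'); rewrite ?mul1r ?mul0r.
have := tot_ge_extra P cV (tri_weightS (subsetDl _ _) tw) Ms Mi.
rewrite sM mM (totyD1 tw uU) => h.
have {h} : mtot M y N <= tot y (U :\ u).
  apply: h; move: Mm hm mU cN hub; rewrite uphalf_half; clear.
  have := odd_double_half #|N|; rewrite -mul2n; lia.
have -> : ydeg y U u = - \sum_(x in N) a x.
  rewrite /ydeg (big_setD1 u) //= y0 ?eqxx // add0r (big_setID N) /= (setIidPr NV).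
  rewrite [X in _ + X]big1 ?addr0; last first.
    move=> x; rewrite !inE => /and3P[h xu xU]; apply: y0 => //.
    by move: h; rewrite xU xu /= negbK => ->; rewrite orbT.
  by rewrite -sumrN; apply: eq_bigr => x _; rewrite /a opprK.
lra.
Qed.

(** * Weights symmetric on the isolated vertices *)

Definition first (T : finType) (k : nat) (B : {set T}) : {set T} :=
  [set x in take k (enum B)].

Lemma first_subset (T : finType) k (B : {set T}) : first k B \subset B.
Proof. by apply/subsetP => x; rewrite inE => /mem_take; rewrite mem_enum. Qed.

Lemma card_first (T : finType) k (B : {set T}) : (k <= #|B|)%N -> #|first k B| = k.
Proof.
move=> kB; rewrite cardsE; have /card_uniqP -> := take_uniq k (enum_uniq (mem B)).
by rewrite size_takel // -cardE.
Qed.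

(** The set [I] consists of vertices that [F] does not meet.  The sign of [eta]
    is chosen such that a triangle with two vertices [u], [v] in [W] and one
    vertex in [I] reads [eta u + eta v <= y u v]. *)
Definition sym_config (R : realFieldType) (T : finType) (U W I : {set T}) (F : rel T)
    (y : T -> T -> R) (eta : T -> R) (z : R) : Prop :=
  [/\ U = W :|: I, [disjoint W & I], tri_weight U F y,
      (forall x b, x \in I -> b \in U -> F x b = false) &
      (forall x b, x \in I -> b \in W -> y x b = - eta b) /\
      (forall x x', x \in I -> x' \in I -> x != x' -> y x x' = z)].

Section SymmetricSums.
Variables (R : realFieldType) (T : finType) (U W I : {set T}) (F : rel T).
Variables (y : T -> T -> R) (eta : T -> R) (z : R).
Hypothesis cfg : sym_config U W I F y eta z.
Local Notation H := (\sum_(v in W) eta v).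
Local Notation i := #|I|.

Lemma tot_I (B : {set T}) : B \subset I -> tot y B = #|B|%:R * (#|B|%:R - 1) * z.
Proof.
case: cfg => [eU dWI [_ _ _ y0 _] _ [_ yI]] /subsetP BI.
rewrite /tot (eq_bigr (fun _ => (#|B|%:R - 1) * z)); last first.
  move=> a aB; rewrite (big_setD1 a) //= y0 ?eqxx ?eU ?inE ?BI ?orbT // add0r.
  rewrite (eq_bigr (fun _ => z)); last first.
    by move=> b; rewrite !inE => /andP[ba bB]; apply: yI; rewrite ?BI // eq_sym.
  rewrite sumr_const -[z *+ _]mulr_natl; congr (_ * _).
  by rewrite (cardsD1 a B) aB addnC natrD addrK.
by rewrite sumr_const -[_ *+ _]mulr_natl mulrA.
Qed.

Lemma tot_WI (A B : {set T}) : A \subset W -> B \subset I ->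
  tot y (A :|: B) = tot y A - 2 * #|B|%:R * (\sum_(v in A) eta v)
     + #|B|%:R * (#|B|%:R - 1) * z.
Proof.
move=> AW BI; have := cfg; case=> [eU dWI [_ _ ys y0 _] _ [yW _]].
have dAB : [disjoint A & B].
  by apply: disjointWl AW _; apply: disjointWr BI _.
rewrite tot_setU // (tot_I BI).
rewrite (eq_bigr (fun a => - (#|B|%:R * eta a))); last first.
  move=> a aA; rewrite (eq_bigr (fun _ => - eta a)).
    by rewrite sumr_const -[(- _) *+ _]mulr_natl mulrN.
  by move=> x xB; rewrite ys yW ?(subsetP BI) ?(subsetP AW).
by rewrite sumrN -mulr_sumr mulr2n; ring.
Qed.

Lemma totU : tot y U = tot y W - 2 * i%:R * H + i%:R * (i%:R - 1) * z.
Proof. by have [-> _ _ _ _] := cfg; apply: tot_WI. Qed.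

Lemma ydeg_W u : u \in W -> ydeg y U u = ydeg y W u - i%:R * eta u.
Proof.
have := cfg; case=> [eU dWI [_ _ ys y0 _] _ [yW _]] uW.
rewrite /ydeg eU big_setU_disjoint //=; congr (_ + _).
rewrite (eq_bigr (fun _ => - eta u)); last by move=> x xI; rewrite ys yW.
by rewrite sumr_const -[(- _) *+ _]mulr_natl mulrN.
Qed.

Lemma deg_W u : u \in W -> deg F U u = deg F W u.
Proof.
have := cfg; case=> [eU dWI [Fs _ _ _ _] FI _] uW.
rewrite /deg eU big_setU_disjoint //= [X in (_ + X)%N]big1 ?addn0 //.
by move=> x xI; rewrite Fs FI // eU inE uW.
Qed.

Lemma miss_sub (A B : {set T}) : A \subset W -> B \subset I ->
  miss F (A :|: B) = miss F A.
Proof.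
move=> AW BI; have := cfg; case=> [eU dWI [Fs _ _ _ _] FI _].
have dAB : [disjoint A & B].
  by apply: disjointWl AW _; apply: disjointWr BI _.
have AU a : a \in A -> a \in U by move=> /(subsetP AW); rewrite eU inE => ->.
have BU a : a \in B -> a \in U by move=> /(subsetP BI); rewrite eU inE orbC => ->.
have BI' := subsetP BI.
rewrite /miss big_setU_disjoint //= [X in (_ + X)%N]big1 ?addn0.
  apply: eq_bigr => a aA; rewrite big_setU_disjoint //= [X in (_ + X)%N]big1 ?addn0 //.
  by move=> b bB; rewrite Fs FI ?BI' ?AU.
move=> a aB; rewrite big1 // => b; rewrite inE => /orP[] hb.
  by rewrite FI ?BI' ?AU.
by rewrite FI ?BI' ?BU.
Qed.

(** Delete [u] and [j] vertices of [I].  The deleted vertices meet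
    [deg F W u] pairs of [F], so [deg F W u - (j + 1)] spare edges remain;
    [r v] of them join [v] to vertices of [I] that were kept.  The second and
    third terms count the weight of the deleted vertices of [I]:
    [(i - 1) z - H] is the total weight at a vertex of [I]; the edges to [u]
    and the edges inside the deleted set would otherwise be counted twice. *)
Lemma deletion_bound n u j (r : T -> nat) :
  #|U| = (n + j + 1)%N -> tot_nonneg n ->
  (miss F U + 8 <= 2 * #|U|)%N -> u \in W -> (j <= i)%N ->
  (forall v, v \in W :\ u -> (r v + j <= i)%N) ->
  (\sum_(v in W :\ u) r v + j + 1 <= deg F W u)%N ->
  ydeg y U u + j%:R * ((i%:R - 1) * z - H + eta u) - j%:R * (j%:R - 1) / 2 * z
    + \sum_(v in W :\ u) (r v)%:R * - eta v <= tot y U / 2.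
Proof.
move=> cU P hm uW ji hr hd; have := cfg; case=> [eU dWI tw FI [yW yI]].
have [Fs Fi ys y0 yt] := tw.
have uU : u \in U by rewrite eU inE uW.
pose B := I :\: first j I.
have cB : #|B| = (i - j)%N.
  by rewrite cardsD (setIidPr (first_subset _ _)) card_first.
have BI : B \subset I by apply: subsetDl.
have AW : W :\ u \subset W by apply: subsetDl.
pose V := (W :\ u) :|: B.
have dAB : [disjoint W :\ u & B].
  by apply: disjointWl AW _; apply: disjointWr BI _.
have VU : V \subset U by rewrite eU; apply: setUSS.
have cWI : #|U| = (#|W| + i)%N by rewrite eU cardsU (disjoint_setI0 dWI) cards0 subn0.
have cW1 : #|W| = #|W :\ u|.+1 by rewrite (cardsD1 u W) uW.
have cV : #|V| = n.
  rewrite cardsU (disjoint_setI0 dAB) cards0 subn0 cB.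
  by move: ji cU cWI cW1; clear; lia.
pose N v x := (v \in W :\ u) && (x \in first (r v) B).
have NB v x : N v x -> v \in W :\ u /\ x \in B.
  by case/andP=> vW /(subsetP (first_subset _ _)).
have NN v x : N v x -> N x v = false.
  move=> /NB[vW xB]; apply/negP => /NB[xW _].
  by rewrite (disjointFr dAB xW) in xB.
pose M := [rel a b | N a b || N b a].
have sumM (V' : nmodType) (g : T -> T -> V') : (forall a b, g a b = g b a) ->
   \sum_(a in V) \sum_(b in V | M a b) g a b =
   (\sum_(v in W :\ u) \sum_(x in first (r v) B) g v x) *+ 2.
  move=> gC; rewrite [LHS]big_setU_disjoint //= mulr2n; congr (_ + _).
    apply: eq_bigr => v vW; apply: eq_bigl => x; rewrite /N vW /= inE.
    have [xB|] := boolP (x \in first (r v) B) => /=.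
      by rewrite (subsetP (first_subset _ _) _ xB) orbT.
    move=> _; apply/negP => /andP[_ /andP[xW /(subsetP (first_subset _ _)) vB]].
    by rewrite (disjointFr dAB vW) in vB.
  rewrite (exchange_big_dep (fun v => v \in W :\ u)) /=; last first.
    move=> a b aB /andP[_ /orP[] /NB[] // h _].
    by rewrite (disjointFr dAB h) in aB.
  apply: eq_bigr => v vW; rewrite big_mkcond [RHS]big_mkcond; apply: eq_bigr => x _.
  rewrite in_setU vW /= /N vW /=.
  have [xB|xB] := boolP (x \in first (r v) B) => /=.
    by rewrite (subsetP (first_subset _ _) _ xB) orbT gC.
  case: ifP => // /andP[xB' ]; rewrite orbF => /andP[xW _].
  by rewrite (disjointFr dAB xW) in xB'.
have crB v : v \in W :\ u -> #|first (r v) B| = r v.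
  by move=> vW; apply: card_first; rewrite cB; have := hr _ vW; lia.
have missM : miss M V = (2 * \sum_(v in W :\ u) r v)%N.
  have -> : miss M V = (\sum_(a in V) \sum_(b in V | M a b) 1)%N.
    apply: eq_bigr => a _; rewrite [RHS]big_mkcondr /=.
    by apply: eq_bigr => b _; case: (M a b).
  apply: (etrans (@sumM nat (fun _ _ => 1%N) (fun _ _ => erefl))).
  rewrite mulr2n mul2n -addnn.
  have e : (\sum_(v in W :\ u) \sum_(x in first (r v) B) 1 = \sum_(v in W :\ u) r v)%N.
    by apply: eq_bigr => v vW; rewrite sum1_card crB.
  exact: (congr2 addn e e).
have Ms : symmetric M by move=> a b /=; rewrite orbC.
have Mi : irreflexive M.
  by move=> a /=; rewrite orbb; apply/negP => h; have := NN _ _ h; rewrite h.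
have missV : miss F V = miss F (W :\ u) by apply: miss_sub.
have missU : miss F U = (miss F (W :\ u) + 2 * deg F W u)%N.
  by rewrite eU miss_sub // (missD1 Fs Fi uW).
have := tot_ge_extra P cV (tri_weightS VU tw) Ms Mi.
rewrite sumM //.
have -> : (\sum_(v in W :\ u) \sum_(x in first (r v) B) y v x) =
    \sum_(v in W :\ u) (r v)%:R * - eta v.
  apply: eq_bigr => v vW; rewrite (eq_bigr (fun _ => - eta v)); last first.
    move=> x /(subsetP (first_subset _ _)) xB; rewrite ys yW ?(subsetP BI) //.
    exact: (subsetP AW).
  by rewrite sumr_const crB // -[(- _) *+ _]mulr_natl.
move=> hle; have {hle} : (\sum_(v in W :\ u) (r v)%:R * - eta v) *+ 2 <= tot y V.
  apply: hle; rewrite missM missV.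
  move: hd hm; rewrite missU cU; clear; lia.
rewrite (tot_WI AW BI) cB totU ydeg_W //.
rewrite (totyD1 (tri_weightS _ tw) uW); last by rewrite eU subsetUl.
rewrite [X in _ -> _ <= (_ + _ - 2 * _ * X + _) / _](big_setD1 u) //=.
rewrite natrB // -[_ *+ 2]mulr_natl.
set E := \sum_(v in W :\ u) _ * _; set HD := \sum_(v in W :\ u) _.
rewrite (big_setD1 u) //= -/HD; move=> h.
rewrite ler_pdivlMr //; lra.
Qed.
End SymmetricSums.

(** A complete graph on at least three vertices: averages of triangles. *)
Lemma tot_complete (R : realFieldType) (T : finType) (U : {set T}) (F : rel T)
    (y : T -> T -> R) :
  tri_weight U F y -> (forall a b, a \in U -> b \in U -> ~~ F a b) -> (3 <= #|U|)%N ->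
  0 <= tot y U.
Proof.
have [k] := ubnP #|U|; elim: k U => // k IHk U ltk tw noF U3.
have [cU | U4] : #|U| = 3%N \/ (4 <= #|U|)%N by move: U3; clear; lia.
  have [Fs Fi ys y0 yt] := tw.
  have /card_gt0P[u uU] : (0 < #|U|)%N by rewrite cU.
  have cU2 : #|U :\ u| == 2%N by have := cardsD1 u U; rewrite uU cU; clear; lia.
  have /cards2P[v [w [vw eU]]] := cU2.
  have vUu : v \in U :\ u by rewrite eU !inE eqxx.
  have wUu : w \in U :\ u by rewrite eU !inE eqxx orbT.
  have /setD1P[vu vU] := vUu; have /setD1P[wu wU] := wUu.
  have eW : (U :\ u) :\ v = [set w].
    apply/setP => b; rewrite eU !inE; have [->|//] := eqVneq b v.
    by rewrite (negPf vw).
  have tw' := tri_weightS (subsetDl U [set u]) tw.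
  rewrite (totyD1 tw uU) (totyD1 tw' vUu) eW /tot big_set1 big_set1 y0 ?eqxx // add0r.
  rewrite /ydeg !(big_setD1 u uU) /= y0 ?eqxx // add0r.
  rewrite !(big_setD1 v vUu) /= eW !big_set1 (y0 v) ?eqxx // add0r.
  have := yt u v w uU vU wU; rewrite eq_sym vu eq_sym wu vw !noF // => /(_ isT isT isT isT isT isT).
  lra.
apply: (tot_avg tw) => // u uU.
have cu : #|U| = #|U :\ u|.+1 by rewrite (cardsD1 u) uU.
apply: IHk.
- by move: ltk; rewrite cu.
- exact: tri_weightS (subsetDl _ _) tw.
- by move=> a b /setD1P[_ aU] /setD1P[_ bU]; apply: noF.
- by move: U4; rewrite cu.
Qed.

(** Replace each weight by its average over the permutations of [I].  The
    triangle conditions are averages of the given ones; for three vertices in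
    [I] the average is a multiple of the total inside [I], hence [tot_complete]. *)
Lemma symmetrise (R : realFieldType) (T : finType) (U I : {set T}) (F : rel T)
    (y : T -> T -> R) :
  tri_weight U F y -> I \subset U -> (0 < #|I|)%N ->
  (forall x b, x \in I -> b \in U -> F x b = false) ->
  exists y' eta z, sym_config U (U :\: I) I F y' eta z /\ tot y' U = tot y U.
Proof.
move=> tw IU i0 FI; have [Fs Fi ys y0 yt] := tw.
pose i : R := #|I|%:R.
have iP : 0 < i by rewrite ltr0n.
pose s b := (\sum_(x in I) y x b) / i.
pose z := tot y I / (i * (i - 1)).
pose y' a b := if a \in I then if b \in I then if a == b then 0 else z else s b
               else if b \in I then s a else y a b.
have inU := subsetP IU.
have avg (f : T -> R) : (forall x, x \in I -> 0 <= f x) -> 0 <= (\sum_(x in I) f x) / i.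
  by move=> h; rewrite divr_ge0 ?(ltW iP) // sumr_ge0.
have nI x b : x \in I -> b \notin I -> x != b.
  by move=> xI; apply: contraNneq => <-.
have triIWW b c : b \in U -> c \in U -> b \notin I -> c \notin I -> b != c -> ~~ F b c ->
    0 <= s b + s c + y b c.
  move=> bU cU bI cI bc Fbc.
  have := avg (fun x => y x b + y x c + y b c) _.
  rewrite !big_split /= sumr_const -[_ *+ _]mulr_natl -/i => h.
  have -> : s b + s c + y b c =
    (\sum_(x in I) y x b + \sum_(x in I) y x c + i * y b c) / i.
    by rewrite !mulrDl [i * _]mulrC mulfK ?lt0r_neq0.
  by apply: h => x xI; apply: yt; rewrite ?(nI x) ?(FI x) ?(inU x).
have i2 a b : a \in I -> b \in I -> a != b -> 1 < i.
  move=> aI bI ab; rewrite ltr1n (cardsD1 a) aI (cardsD1 b) !inE eq_sym ab bI; lia.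
have triIIW a b c : a \in I -> b \in I -> a != b -> c \in U -> c \notin I ->
    0 <= z + s c + s c.
  move=> aI bI ab cU cI; have i1 := i2 _ _ aI bI ab.
  have : 0 <= \sum_(x in I) \sum_(x' in I :\ x) (y x x' + y x c + y x' c).
    apply: sumr_ge0 => x xI; apply: sumr_ge0 => x' /setD1P[x'x x'I].
    have xx' : x != x' by rewrite eq_sym.
    by apply: yt; rewrite ?(nI x c) ?(nI x' c) ?(FI x) ?(FI x') ?(inU x) ?(inU x').
  under eq_bigr => x xI.
    rewrite !big_split /= sumr_const -[_ *+ _]mulr_natl.
    have -> : #|I :\ x|%:R = i - 1 :> R.
      by rewrite /i (cardsD1 x I) xI natrD addrAC subrr add0r.
    have -> : \sum_(x' in I :\ x) y x x' = \sum_(x' in I) y x x'.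
      by rewrite [RHS](big_setD1 x) //= (y0 x x) ?eqxx ?inU // add0r.
    have -> : \sum_(x' in I :\ x) y x' c = \sum_(x' in I) y x' c - y x c.
      by rewrite [in RHS](big_setD1 x) //= addrAC subrr add0r.
    over.
  rewrite !big_split /= -mulr_sumr sumr_const -[_ *+ _]mulr_natl sumrN -/i.
  rewrite -[X in X + _ + _]/(tot y I).
  have -> : \sum_(x in I) y x c = i * s c by rewrite /s mulrC divfK ?lt0r_neq0.
  have -> : tot y I = i * (i - 1) * z.
    by rewrite /z mulrC divfK // mulf_neq0 ?lt0r_neq0 // subr_gt0.
  have -> : i * (i - 1) * z + (i - 1) * (i * s c) + (i * (i * s c) - i * s c) =
    i * (i - 1) * (z + s c + s c) by ring.
  by rewrite pmulr_rge0 // mulr_gt0 // subr_gt0.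
have triIII a b c : a \in I -> b \in I -> c \in I -> a != b -> a != c -> b != c -> 0 <= z.
  move=> aI bI cI ab ac bc; apply: divr_ge0.
    apply: (tot_complete (F := F)) => [|x x' xI x'I|].
    - exact: tri_weightS IU tw.
    - by rewrite FI ?inU.
    - by apply/card_gt2P; exists a, b, c; split; split=> //; rewrite eq_sym.
  by have := i2 _ _ aI bI ab; move=> h; rewrite mulr_ge0 ?subr_ge0 ?ltW.
have dWI : [disjoint U :\: I & I].
  by rewrite disjoints_subset; apply/subsetP => b; rewrite !inE => /andP[].
have eU : U = (U :\: I) :|: I.
  by apply/setP => b; rewrite !inE; case: (boolP (b \in I)) => [/inU->|]; rewrite ?orbF.
have ys' a b : y' a b = y' b a.
  by rewrite /y' (eq_sym b) ys; case: (a \in I); case: (b \in I).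
exists y', (fun b => - s b), z; split; first split=> //.
- split=> // [a b aU bU | a b c aU bU cU ab ac bc Fab Fac Fbc].
    case/orP=> [/eqP <- | Fab]; rewrite /y'.
      by case: (a \in I); rewrite ?eqxx // y0 ?eqxx.
    case: (boolP (a \in I)) => [aI | _]; first by rewrite FI in Fab.
    case: (boolP (b \in I)) => [bI | _]; first by rewrite Fs FI in Fab.
    by rewrite y0 ?Fab ?orbT.
  rewrite /y' (negPf ab) (negPf ac) (negPf bc).
  case: (boolP (a \in I)) => aI; case: (boolP (b \in I)) => bI;
  case: (boolP (c \in I)) => cI.
  + by have := triIII a b c aI bI cI ab ac bc; move: (z) => r; clear; lra.
  + by have := triIIW a b c aI bI ab cU cI.
  + have := triIIW a c b aI cI ac bU bI; clear; lra.
  + have := triIWW b c bU cU bI cI bc Fbc; clear; lra.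
  + have := triIIW b c a bI cI bc aU aI; clear; lra.
  + have := triIWW a c aU cU aI cI ac Fac; clear; lra.
  + have := triIWW a b aU bU aI bI ab Fab; clear; lra.
  + exact: yt.
- split=> [x b xI | x x' xI x'I /negPf xx']; last by rewrite /y' xI x'I xx'.
  by rewrite inE => /andP[/negPf bI _]; rewrite /y' xI bI opprK.
rewrite eU !tot_setU //; congr (_ + _ + _).
- apply: eq_bigr => a /setDP[_ /negPf aI]; apply: eq_bigr => b /setDP[_ /negPf bI].
  by rewrite /y' aI bI.
- have -> : tot y' I = i * ((i - 1) * z).
    rewrite /tot (eq_bigr (fun _ => (i - 1) * z)).
      by rewrite sumr_const -[_ *+ _]mulr_natl.
    move=> a aI; rewrite (big_setD1 a) //= {1}/y' aI eqxx add0r (eq_bigr (fun _ => z)).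
      rewrite sumr_const -[_ *+ _]mulr_natl; congr (_ * _).
      by rewrite /i (cardsD1 a I) aI natrD addrAC subrr add0r.
    by move=> b /setD1P[ba bI]; rewrite /y' aI bI eq_sym (negPf ba).
  have [i1|i1] := eqVneq #|I| 1%N.
    rewrite /i i1 subrr mul0r mulr0.
    have /cards1P[x eI] : #|I| == 1%N by rewrite i1.
    by rewrite /tot eI !big_set1 y0 ?eqxx // inU // eI inE.
  have i1' : i - 1 != 0 by rewrite subr_eq0 /i pnatr_eq1.
  by rewrite /z mulrA mulrC divfK // mulf_neq0 // lt0r_neq0.
congr (_ *+ 2); apply: eq_bigr => a /setDP[_ /negPf aI].
rewrite (eq_bigr (fun _ => s a)); last by move=> b bI; rewrite /y' aI bI.
rewrite sumr_const -[_ *+ _]mulr_natl -/i /s mulrC divfK ?lt0r_neq0 //.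
by apply: eq_bigr => b _; rewrite ys.
Qed.

(** * Combining the deletion inequalities *)

(** The next three lemmas and [deletion_system_nonneg] are about real numbers.
    They are applied with [S] half of [tot y U], [A u] the total weight at [u],
    [Yx] the total weight at a vertex of [I], [H] the sum of the [eta u], and
    [c u] the degree of [u] in [F] minus [1].  The sixth hypothesis is the lower
    bound for the total that results from [eta u + eta v <= y u v].

    For each [u], the deletions of [u] with [0] and with [m u] vertices of [I]
    are mixed such that [k c(u)] vertices of [I] are deleted on average, with
    [k = i / (3 i - 6)].  The sum over [u] contains [eta] only through the sum
    of the [c(u) eta(u)], which the sixth hypothesis bounds, and this [k] is the
    value for which [H] cancels.  What is left is a multiple of [S], and a
    multiple of [z] that the bound on the sum of the [c(u) (m(u) - 1)] makes
    harmless. *)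
Lemma mix_deletions (R : realFieldType) (T : finType) (W : {set T}) (w i : nat)
    (S z H Yx : R) (A eta : T -> R) (c m : T -> nat) :
  #|W| = w -> (3 <= i)%N -> 0 <= z -> Yx = (i%:R - 1) * z - H ->
  \sum_(u in W) A u = 2 * S - i%:R * Yx ->
  (w%:R - i%:R - 2) * H + i%:R * (i%:R - 1) / 2 * z - S
    <= \sum_(u in W) (c u)%:R * eta u ->
  \sum_(u in W) ((c u)%:R : R) = w%:R + 2 * i%:R - 8 ->
  (forall u, u \in W -> A u <= S) ->
  (forall u, u \in W -> (0 < c u)%N ->
    A u + (m u)%:R * (Yx + eta u) - (m u)%:R * ((m u)%:R - 1) / 2 * z <= S) ->
  (forall u, u \in W -> (0 < c u)%N -> (i * c u <= (3 * i - 6) * m u)%N) ->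
  \sum_(u in W) ((c u)%:R : R) * ((m u)%:R - 1) <= (i%:R - 1) * (2 * w%:R - i%:R - 4) ->
  (2 <= w)%N -> 0 <= S.
Proof.
move=> cW i3 z0 eYx sA sc sC dA dX hm hs w2.
set k : R := i%:R / (3 * i%:R - 6).
have i3R : 3 <= i%:R :> R by rewrite ler_nat.
have k0 : 0 < k by apply: divr_gt0; lra.
have ek : k * (3 * i%:R - 6) = i%:R.
  have p : 0 < 3 * i%:R - 6 :> R by lra.
  by rewrite /k divfK ?gt_eqF.
have perU u : u \in W ->
  A u + k * ((c u)%:R * (Yx + eta u)) - k / 2 * z * ((c u)%:R * ((m u)%:R - 1)) <= S.
  move=> uW; case: (posnP (c u)) => [-> | c0].
    by rewrite !mul0r !mulr0 addr0 subr0 dA.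
  have := dX _ uW c0; have := hm _ uW c0; have := dA _ uW.
  move=> h0 h1 h2.
  have m0 : (0 < m u)%N by case: (m u) h1 => //; nia.
  set M : R := (m u)%:R in h2 *; set Cu : R := (c u)%:R.
  have M0 : 0 < M by rewrite ltr0n.
  pose t := k * Cu / M.
  have eI : (3 * i - 6)%N%:R = 3 * i%:R - 6 :> R.
    by rewrite natrB ?natrM //; lia.
  have kC : k * Cu <= M.
    move: h1; rewrite -(ler_nat R) !natrM eI => h1.
    by rewrite /k mulrAC ler_pdivrMr; [rewrite mulrC (mulrC M) in h1 *; lra | lra].
  have t0 : 0 <= t.
    by rewrite /t; apply: divr_ge0; [apply: mulr_ge0; [exact: ltW | exact: ler0n] | exact: ltW].
  have t1 : t <= 1 by rewrite /t ler_pdivrMr // mul1r.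
  have tM : t * M = k * Cu by rewrite /t divfK ?gt_eqF.
  have -> : A u + k * (Cu * (Yx + eta u)) - k / 2 * z * (Cu * (M - 1)) =
    (1 - t) * A u + t * (A u + M * (Yx + eta u) - M * (M - 1) / 2 * z).
    have -> : k * (Cu * (Yx + eta u)) = t * M * (Yx + eta u) by rewrite tM; ring.
    have -> : k / 2 * z * (Cu * (M - 1)) = t * M * (M-1) / 2 * z by rewrite tM; ring.
    ring.
  have hA : 0 <= (1 - t) * (S - A u) by apply: mulr_ge0; lra.
  have hB : 0 <= t * (S - (A u + M * (Yx + eta u) - M * (M - 1) / 2 * z)) by apply: mulr_ge0; lra.
  lra.
have : \sum_(u in W) (A u + k * ((c u)%:R * (Yx + eta u))
        - k / 2 * z * ((c u)%:R * ((m u)%:R - 1))) <= \sum_(u in W) S.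
  exact: ler_sum.
rewrite sumrB big_split /= -!mulr_sumr sA sumr_const cW.
under [X in k * X]eq_bigr => u _ do rewrite mulrDr.
rewrite big_split /= -mulr_suml sC -[S *+ w]mulr_natr.
set E := \sum_(u in W) _ * eta u in sc *.
set Q := \sum_(u in W) _ in hs *.
move=> hsum.
have w2R : 2 <= w%:R :> R by rewrite ler_nat.
have h1 : 0 <= k * (E - ((w%:R - i%:R - 2) * H + i%:R * (i%:R - 1) / 2 * z - S)).
  by apply: mulr_ge0; lra.
have h2 : 0 <= k / 2 * z * ((i%:R - 1) * (2 * w%:R - i%:R - 4) - Q).
  by apply: mulr_ge0; [apply: mulr_ge0; lra | lra].
have key : 0 <= (w%:R - 2 + k) * S.
  suff: (w%:R - 2 + k) * S =
    (S * w%:R - (2 * S - i%:R * Yx + k * ((w%:R + 2 * i%:R - 8) * Yx + E) - k / 2 * z * Q))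
     + k * (E - ((w%:R - i%:R - 2) * H + i%:R * (i%:R - 1) / 2 * z - S))
     + k / 2 * z * ((i%:R - 1) * (2 * w%:R - i%:R - 4) - Q) by lra.
  have -> : i%:R * Yx = k * (3 * i%:R - 6) * Yx by rewrite ek.
  by rewrite eYx; field.
by move: key; rewrite pmulr_rge0 //; lra.
Qed.

(** If some [c u] is large, [k c(u)] as above would exceed [m u].  Now the sum
    over [u] of the shares [j u] is [2 i], so that [H] cancels for
    [k = i / (w - i - 2)].  The remainder, the sum of the
    [(j(u) - k c(u)) eta(u)], may be negative, but it is at least
    [- h (2 i - k c(W))], where [c(W)] is the sum of the [c(u)], and [- h] bounds
    the [eta u] from below.  To make up
    for it, each [u] other than the vertex [us] that attains the minimum spends
    what [j u] leaves of its capacity [m u] on edges from [us] to [I], and gains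
    [h] from each of them. *)
Lemma mix_deletions_transfer_shares (R : realFieldType) (T : finType) (W : {set T}) (w i : nat)
    (S z H Yx h : R) (A eta j : T -> R) (c m : T -> nat) (us : T) :
  #|W| = w -> (3 <= i)%N -> (4 * i <= w + 4)%N -> 0 <= z -> 0 <= h ->
  Yx = (i%:R - 1) * z - H ->
  \sum_(u in W) A u = 2 * S - i%:R * Yx ->
  (w%:R - i%:R - 2) * H + i%:R * (i%:R - 1) / 2 * z - S
    <= \sum_(u in W) (c u)%:R * eta u ->
  \sum_(u in W) ((c u)%:R : R) = w%:R + 2 * i%:R - 8 ->
  us \in W -> (0 < c us)%N ->
  (forall u, u \in W -> A u <= S) ->
  (forall u, u \in W -> (0 < c u)%N ->
    A u + (m u)%:R * (Yx + eta u) - (m u)%:R * ((m u)%:R - 1) / 2 * z <= S) ->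
  (forall u, u \in W -> u != us -> (0 < c u)%N -> A u + (m u)%:R * h <= S) ->
  (forall u, u \in W -> (0 < c u)%N -> - h <= eta u) ->
  (forall u, u \in W -> (m u <= i)%N /\ (0 < m u)%N = (0 < c u)%N) ->
  (forall u, u \in W -> i%:R / (w%:R - i%:R - 2) * (c u)%:R <= j u <= (m u)%:R) ->
  \sum_(u in W) j u = 2 * i%:R ->
  4 * i%:R - i%:R / (w%:R - i%:R - 2) * (w%:R + 2 * i%:R - 8) <=
    \sum_(u in W) ((m u)%:R : R) - (m us)%:R + j us ->
  0 <= S.
Proof.
move=> cW i3 wi z0 h0 eYx sA sc sC usW cus dA dX dR dh hm hj sj hM.
set k : R := i%:R / (w%:R - i%:R - 2) in hj hM.
have i3R : 3 <= i%:R :> R by rewrite ler_nat.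
have wiR : 4 * i%:R <= w%:R + 4 :> R.
  by have := wi; rewrite -(ler_nat R) natrM natrD.
have p : 0 < w%:R - i%:R - 2 :> R by lra.
have k0 : 0 < k by apply: divr_gt0; lra.
have ek : k * (w%:R - i%:R - 2) = i%:R by rewrite /k divfK ?gt_eqF.
have perU u : u \in W ->
  A u + j u * (Yx + eta u) - (i%:R - 1) / 2 * z * j u
   + (if u == us then 0 else (m u)%:R - j u) * h <= S.
  move=> uW; have [mi mc] := hm _ uW; have /andP[j1 j2] := hj _ uW.
  case: (posnP (c u)) => [c0 | c0].
    have m0 : m u = 0%N by apply/eqP; rewrite -leqn0 leqNgt mc c0.
    have ju : j u = 0.
      by apply: le_anti; move: j1 j2; rewrite c0 m0 mulr0 => -> ->.
    by rewrite ju m0 subr0 if_same !mul0r !mulr0 !addr0 subr0 dA.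
  have h2 := dX _ uW c0; have h0' := dA _ uW.
  have m0 : (0 < m u)%N by rewrite mc.
  set M : R := (m u)%:R in j2 h2 *.
  have M0 : 0 < M by rewrite ltr0n.
  have Mi : M <= i%:R by rewrite ler_nat.
  have j0 : 0 <= j u by apply: le_trans j1; apply: mulr_ge0; [exact: ltW | exact: ler0n].
  pose t := j u / M.
  have t0 : 0 <= t by apply: divr_ge0 => //; exact: ltW.
  have t1 : t <= 1 by rewrite /t ler_pdivrMr // mul1r.
  have tM : t * M = j u by rewrite /t divfK ?gt_eqF.
  have hB : 0 <= t * (S - (A u + M * (Yx + eta u) - M * (M - 1) / 2 * z)).
    by apply: mulr_ge0; lra.
  have hz : 0 <= j u / 2 * z * (i%:R - M).
    by apply: mulr_ge0; [apply: mulr_ge0 => //; lra | lra].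
  have eB : t * (S - (A u + M * (Yx + eta u) - M * (M - 1) / 2 * z)) =
     t * (S - A u) - j u * (Yx + eta u) + j u * (M - 1) / 2 * z.
    by rewrite -tM; ring.
  case: eqP => [_ | /eqP us_u].
    have hA : 0 <= (1 - t) * (S - A u) by apply: mulr_ge0; lra.
    lra.
  have hr := dR _ uW us_u c0; rewrite -/M in hr.
  have hA : 0 <= (1 - t) * (S - (A u + M * h)) by apply: mulr_ge0; lra.
  have eA : (1 - t) * (S - (A u + M * h)) = (1 - t) * (S - A u) - (M - j u) * h.
    by rewrite -tM; ring.
  lra.
have hsum : \sum_(u in W) (A u + j u * (Yx + eta u) - (i%:R - 1) / 2 * z * j u
   + (if u == us then 0 else (m u)%:R - j u) * h) <= \sum_(u in W) S.
  exact: ler_sum.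
move: hsum; rewrite big_split /= sumrB big_split /= -mulr_sumr sA sumr_const cW sj.
under eq_bigr => u _ do rewrite mulrDr.
rewrite big_split /= -mulr_suml sj -[S *+ w]mulr_natr -mulr_suml.
have -> : \sum_(u in W) (if u == us then 0 else (m u)%:R - j u) =
   \sum_(u in W) ((m u)%:R : R) - 2 * i%:R - (m us)%:R + j us.
  rewrite (bigD1 us) //= eqxx add0r -sj -sumrB.
  rewrite [X in _ = X - _ + _](bigD1 us) //=.
  under eq_bigr => u /andP[_ /negPf ->] do [].
  lra.
set M := \sum_(u in W) _ in hM *.
move=> hsum.
have hE : - h * (2 * i%:R - k * (w%:R + 2 * i%:R - 8)) <=
   \sum_(u in W) j u * eta u - k * \sum_(u in W) (c u)%:R * eta u.
  rewrite -sC -sj !mulr_sumr -!sumrB mulr_sumr; apply: ler_sum => u uW.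
  have /andP[j1 j2] := hj _ uW; have [mi mc] := hm _ uW.
  case: (posnP (c u)) => [c0 | c0].
    have m0 : m u = 0%N by apply/eqP; rewrite -leqn0 leqNgt mc c0.
    have ju : j u = 0.
      by apply: le_anti; move: j1 j2; rewrite c0 m0 mulr0 => -> ->.
    by rewrite ju c0 !mul0r !mulr0 !subr0 mulr0.
  have := dh _ uW c0.
  have : 0 <= j u - k * (c u)%:R by lra.
  nra.
set E := \sum_(u in W) j u * eta u in hE hsum.
set E' := \sum_(u in W) _ * eta u in hE sc.
have h1 : 0 <= k * (E' - ((w%:R - i%:R - 2) * H + i%:R * (i%:R - 1) / 2 * z - S)).
  by apply: mulr_ge0; lra.
have h2 : 0 <= (M - (m us)%:R + j us - 4 * i%:R + k * (w%:R + 2 * i%:R - 8)) * h.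
  by apply: mulr_ge0 => //; lra.
have h3 : 0 <= k * (i%:R * (i%:R - 1) / 2 * z).
  by apply: mulr_ge0; [exact: ltW | apply: mulr_ge0 => //; apply: divr_ge0; nra].
have e1 : k * ((w%:R - i%:R - 2) * H) = i%:R * H by rewrite mulrA ek.
have key : 0 <= (w%:R - 2 + k) * S by move: hsum; rewrite eYx; lra.
by move: key; rewrite pmulr_rge0 //; lra.
Qed.

(** Existence of the shares: start from [k c(u)] and distribute the remaining
    [2 i - k c(W)].  The vertex [us], which does not pay for the transfer, is
    filled up first. *)
Lemma mix_deletions_transfer (R : realFieldType) (T : finType) (W : {set T}) (w i : nat)
    (S z H Yx h : R) (A eta : T -> R) (c m : T -> nat) (us : T) :
  #|W| = w -> (3 <= i)%N -> (4 * i <= w + 4)%N -> 0 <= z -> 0 <= h ->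
  Yx = (i%:R - 1) * z - H ->
  \sum_(u in W) A u = 2 * S - i%:R * Yx ->
  (w%:R - i%:R - 2) * H + i%:R * (i%:R - 1) / 2 * z - S
    <= \sum_(u in W) (c u)%:R * eta u ->
  \sum_(u in W) ((c u)%:R : R) = w%:R + 2 * i%:R - 8 ->
  us \in W -> (0 < c us)%N ->
  (forall u, u \in W -> A u <= S) ->
  (forall u, u \in W -> (0 < c u)%N ->
    A u + (m u)%:R * (Yx + eta u) - (m u)%:R * ((m u)%:R - 1) / 2 * z <= S) ->
  (forall u, u \in W -> u != us -> (0 < c u)%N -> A u + (m u)%:R * h <= S) ->
  (forall u, u \in W -> (0 < c u)%N -> - h <= eta u) ->
  (forall u, u \in W -> (m u <= i)%N /\ (0 < m u)%N = (0 < c u)%N) ->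
  (forall u, u \in W -> i%:R / (w%:R - i%:R - 2) * (c u)%:R <= (m u)%:R :> R) ->
  4 * i%:R - i%:R / (w%:R - i%:R - 2) * (w%:R + 2 * i%:R - 8) <=
    \sum_(u in W) ((m u)%:R : R) ->
  2 * i%:R <= \sum_(u in W) ((m u)%:R : R) - (m us)%:R
     + i%:R / (w%:R - i%:R - 2) * (c us)%:R ->
  0 <= S.
Proof.
move=> cW i3 wi z0 h0 eYx sA sc sC usW cus dA dX dR dh hm hkm B1 B2.
set k : R := i%:R / (w%:R - i%:R - 2) in hkm B1 B2.
have i3R : 3 <= i%:R :> R by rewrite ler_nat.
have wiR : 4 * i%:R <= w%:R + 4 :> R.
  by have := wi; rewrite -(ler_nat R) natrM natrD.
have p : 0 < w%:R - i%:R - 2 :> R by lra.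
have k0 : 0 < k by apply: divr_gt0; lra.
have ek : k * (w%:R - i%:R - 2) = i%:R by rewrite /k divfK ?gt_eqF.
set C : R := w%:R + 2 * i%:R - 8 in sC B1.
have kC : k * C <= 2 * i%:R.
  have : 0 <= k * ((w%:R - i%:R - 2) - (3 * i%:R - 6)) by apply: mulr_ge0; lra.
  rewrite /C; lra.
set M := \sum_(u in W) _ in B1 B2.
have main (j : T -> R) : (forall u, u \in W -> k * (c u)%:R <= j u <= (m u)%:R) ->
  \sum_(u in W) j u = 2 * i%:R -> 4 * i%:R - k * C <= M - (m us)%:R + j us -> 0 <= S.
  move=> j1 j2 j3.
  exact: (mix_deletions_transfer_shares (c := c) (m := m) (j := j) (us := us)
    cW i3 wi z0 h0 eYx sA sc sC).
have sC' : \sum_(u in W | u != us) ((c u)%:R : R) = C - (c us)%:R.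
  by move: sC; rewrite (bigD1 us) //=; lra.
have sM' : \sum_(u in W | u != us) ((m u)%:R : R) = M - (m us)%:R.
  have -> : M = (m us)%:R + \sum_(u in W | u != us) ((m u)%:R : R).
    by rewrite /M (bigD1 us).
  lra.
have hkus := hkm _ usW.
case: (leP (k * (c us)%:R + (2 * i%:R - k * C)) (m us)%:R) => hc.
  apply: (main (fun u => if u == us then k * (c us)%:R + (2 * i%:R - k * C)
                         else k * (c u)%:R)).
  - move=> u uW; case: eqP => [-> | _]; first by rewrite hc; lra.
    by rewrite lexx hkm.
  - rewrite (bigD1 us) //= eqxx.
    under eq_bigr => u /andP[_ /negPf ->] do [].
    rewrite -mulr_sumr sC'; lra.
  - rewrite eqxx; lra.
set D := M - (m us)%:R - k * (C - (c us)%:R).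
set N := 2 * i%:R - (m us)%:R - k * (C - (c us)%:R).
have ND : N <= D by rewrite /N /D; lra.
have N0 : 0 < N by rewrite /N; lra.
have D0 : 0 < D by lra.
pose th := N / D.
have th0 : 0 <= th by apply: divr_ge0; exact: ltW.
have th1 : th <= 1 by rewrite /th ler_pdivrMr // mul1r.
have thD : th * D = N by rewrite /th divfK ?gt_eqF.
apply: (main (fun u => if u == us then (m us)%:R
                       else k * (c u)%:R + th * ((m u)%:R - k * (c u)%:R))).
- move=> u uW; case: eqP => [-> | _]; first by rewrite hkus lexx.
  have := hkm _ uW => hu.
  have q0 : 0 <= th * ((m u)%:R - k * (c u)%:R) by apply: mulr_ge0; lra.
  have q1 : 0 <= (1 - th) * ((m u)%:R - k * (c u)%:R) by apply: mulr_ge0; lra.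
  by apply/andP; split; lra.
- rewrite (bigD1 us) //= eqxx.
  under eq_bigr => u /andP[_ /negPf ->] do [].
  rewrite big_split /= -!mulr_sumr sumrB -mulr_sumr sC' sM' -/D thD /N; lra.
- rewrite eqxx; lra.
Qed.

(** Truncating the values [c u <= b] at [i] loses at most [b - i] for each [u]
    with [i <= c u].  With at least three such [u] the claim holds anyway; with
    at most two of them the loss is at most [2 (b - i)]. *)
Lemma sum_minn_ge (T : finType) (W : {set T}) (c : T -> nat) (i b e : nat) :
  (forall u, u \in W -> (c u <= b)%N) -> (i <= b)%N ->
  (2 * b + i <= \sum_(u in W) c u + e)%N ->
  (3 * i <= \sum_(u in W) minn (c u) i + e)%N.
Proof.
move=> cb ib hC.
pose B := [set u in W | (i <= c u)%N].
have sBW (f : T -> nat) :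
  (\sum_(u in W) f u = \sum_(u in B) f u + \sum_(u in W :\: B) f u)%N.
  rewrite (big_setID B) /=; congr (_ + _)%N; apply: eq_bigl => u.
  by rewrite !inE; case: (u \in W).
have eB : (\sum_(u in B) minn (c u) i = #|B| * i)%N.
  rewrite -sum_nat_const; apply: eq_bigr => u; rewrite inE => /andP[_ h].
  exact/minn_idPr.
have eD : (\sum_(u in W :\: B) minn (c u) i = \sum_(u in W :\: B) c u)%N.
  apply: eq_bigr => u; rewrite !inE => /andP[h uW].
  by apply/minn_idPl; move: h; rewrite uW /= -ltnNge => /ltnW.
have lB : (\sum_(u in B) c u <= #|B| * b)%N.
  rewrite -sum_nat_const; apply: leq_sum => u; rewrite inE => /andP[uW _].
  exact: cb.
move: hC; rewrite !sBW eB eD.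
by case: #|B| lB => [|[|[|k]]]; nia.
Qed.

Lemma sum_minn_exception (i w b s cu : nat) : (3 <= i)%N -> (3 * i - 6 < cu)%N ->
  (cu <= b)%N -> (3 * b + 3 <= w + i)%N -> (w + i <= 3 * b + 5)%N ->
  (s + 8 = w + 2 * i)%N -> (s < 2 * b + i)%N -> i = 3 /\ w = 12%N.
Proof.
move=> i3 h1 h2 h3 h4 h5 h6.
have h7 : (w + i <= 2 * b + 7)%N by lia.
have h8 : (b <= 4)%N by lia.
have h9 : i = 3%N by lia.
split=> //; lia.
Qed.

Lemma pred_div3_bounds n : (3 <= n)%N ->
  (3 * (n %/ 3).-1 + 3 <= n)%N /\ (n <= 3 * (n %/ 3).-1 + 5)%N.
Proof. lia. Qed.

(** The choice of [m u] depends on the ratio of [w] and [i].  For [w] below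
    [3 i - 4], half of the affordable deletions (or all of them if [i <= 5], when
    every [c u] is at most [2]) are enough for [mix_deletions].  For larger [w],
    all affordable deletions are used, in [mix_deletions] as long as
    [c u <= 3 i - 6] for all [u], and otherwise in [mix_deletions_transfer]. *)
Lemma deletion_system_nonneg (R : realFieldType) (T : finType) (W : {set T}) (w i : nat)
    (S z H Yx : R) (A eta : T -> R) (c : T -> nat) :
  #|W| = w -> (3 <= i)%N -> (i + 3 <= w)%N -> 0 <= z ->
  Yx = (i%:R - 1) * z - H ->
  \sum_(u in W) A u = 2 * S - i%:R * Yx ->
  (w%:R - i%:R - 2) * H + i%:R * (i%:R - 1) / 2 * z - S
    <= \sum_(u in W) (c u)%:R * eta u ->
  (\sum_(u in W) c u + 8 = w + 2 * i)%N ->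
  (forall u, u \in W -> (c u + i + 3 <= w)%N) ->
  (forall u, u \in W -> (3 * (c u).+1 <= w + i)%N) ->
  (forall u, u \in W -> A u <= S) ->
  (forall u j, u \in W -> (j <= minn (c u) i)%N ->
    A u + j%:R * (Yx + eta u) - j%:R * (j%:R - 1) / 2 * z <= S) ->
  (forall u v, u \in W -> v \in W -> u != v ->
    A u + (minn (c u) i)%:R * (- eta v) <= S) ->
  0 <= S.
Proof.
move=> cW i3 iw z0 eYx sA sc sC cq c3 dA dX dR.
have sCR : \sum_(u in W) ((c u)%:R : R) = w%:R + 2 * i%:R - 8.
  by move: (congr1 (fun k => k%:R : R) sC); rewrite natrD natr_sum natrD natrM; lra.
have iw4 : (i + 4 <= w)%N.
  rewrite leqNgt; apply/negP => wlt.
  have : (\sum_(u in W) c u = 0)%N.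
    by apply: big1 => u /cq; lia.
  lia.
have w2 : (2 <= w)%N by lia.
have i3R : 3 <= i%:R :> R by rewrite ler_nat.
have iw4R : i%:R + 4 <= w%:R :> R by rewrite -natrD ler_nat.
have bound (B : R) (m : T -> nat) :
   (forall u, u \in W -> (0 < c u)%N -> (m u)%:R - 1 <= B) ->
   B * (w%:R + 2 * i%:R - 8) <= (i%:R - 1) * (2 * w%:R - i%:R - 4) ->
   \sum_(u in W) ((c u)%:R : R) * ((m u)%:R - 1) <=
      (i%:R - 1) * (2 * w%:R - i%:R - 4).
  move=> hB; apply: le_trans; rewrite -sCR mulr_sumr; apply: ler_sum => u uW.
  case: (posnP (c u)) => [-> | c0]; first by rewrite !(mul0r, mulr0).
  by rewrite mulrC ler_wpM2r ?ler0n // hB.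
have useA (m : T -> nat) : (forall u, u \in W -> (m u <= minn (c u) i)%N) ->
  (forall u, u \in W -> (0 < c u)%N -> (i * c u <= (3 * i - 6) * m u)%N) ->
  \sum_(u in W) ((c u)%:R : R) * ((m u)%:R - 1) <=
      (i%:R - 1) * (2 * w%:R - i%:R - 4) -> 0 <= S.
  move=> m1 m2 m3.
  apply: (mix_deletions (c := c) (m := m) cW i3 z0 eYx sA sc sCR dA _ m2 m3 w2).
  by move=> u uW _; apply: dX => //; apply: m1.
(* if w < 3 i - 4, each c u is small *)
case: (leqP (3 * i) (w + 4)) => [A1 | A2]; last first.
  have A2R : w%:R + 5 <= 3 * i%:R :> R by rewrite -natrD -natrM ler_nat; lia.
  case: (leqP 6 i) => i6.
    apply: (useA (fun u => uphalf (c u))).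
    - move=> u uW; have := cq _ uW; rewrite leq_min uphalf_half; lia.
    - move=> u uW _; rewrite uphalf_half.
      have := odd_double_half (c u); rewrite -muln2; nia.
    - apply: (bound ((w%:R - i%:R - 4) / 2)).
        move=> u uW c0.
        have : (uphalf (c u))%:R * 2 + i%:R + 2 <= w%:R :> R.
          rewrite -natrM -!natrD ler_nat; have := cq _ uW.
          rewrite uphalf_half; have := odd_double_half (c u); rewrite -muln2; lia.
        lra.
      rewrite mulrAC ler_pdivrMr //.
      have i6R : 6 <= i%:R :> R by rewrite ler_nat.
      nra.
  have i5 : i = 5%N.
    have : (i = 3 \/ i = 4 \/ i = 5)%N by lia.
    by case=> [|[]] h; lia.
  apply: (useA c).
  - by move=> u uW; have := cq _ uW; rewrite leq_min leqnn; lia.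
  - by move=> u uW _; rewrite i5; lia.
  - apply: (bound 1).
      by move=> u uW c0; rewrite lerBlDr -(natrD _ 1 1) ler_nat; have := cq _ uW; lia.
    have w10 : w%:R <= 10 :> R by rewrite ler_nat; lia.
    rewrite i5 in iw4R *; lra.
have A1R : 3 * i%:R <= w%:R + 4 :> R by rewrite -natrM -natrD ler_nat.
pose m u := minn (c u) i.
case: (boolP [forall (u | u \in W), c u <= 3 * i - 6]%N) => [/forall_inP c6 | ].
  apply: (useA m) => //.
  - by move=> u uW c0; have := c6 _ uW; rewrite /m; case: (leqP (c u) i); nia.
  - apply: (bound (i%:R - 1)); last by nra.
    by move=> u uW _; rewrite lerD2r ler_nat /m geq_minr.
rewrite negb_forall => /existsP[u0]; rewrite negb_imply -ltnNge => /andP[u0W cu0].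
have wi4 : (4 * i <= w + 4)%N by have := cq _ u0W; lia.
have wi4R : 4 * i%:R <= w%:R + 4 :> R by rewrite -natrM -natrD ler_nat.
have c0 : (0 < c u0)%N by lia.
have P0 : (u0 \in W) && (0 < c u0)%N by rewrite u0W.
(* the edges from I to us have the largest weight, among vertices with c > 0 *)
case: (@arg_minP _ R T u0 (fun u => (u \in W) && (0 < c u)%N) eta P0) => us.
move=> /andP[usW cus] hmin.
pose h := Num.max 0 (- eta us).
have pk : 0 < w%:R - i%:R - 2 :> R by lra.
pose k : R := i%:R / (w%:R - i%:R - 2).
have k0 : 0 < k by apply: divr_gt0; lra.
have ek : k * (w%:R - i%:R - 2) = i%:R by rewrite /k divfK ?gt_eqF.
have hkm u : u \in W -> k * (c u)%:R <= (m u)%:R :> R.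
  move=> uW; rewrite /m; case: (leqP (c u) i) => h'.
    rewrite -[X in _ <= X]mul1r ler_wpM2r ?ler0n // /k ler_pdivrMr // mul1r; lra.
  rewrite -[X in _ <= X]ek ler_wpM2l ?(ltW k0) //.
  have : ((c u)%:R + i%:R + 3 <= w%:R :> R) by rewrite -!natrD ler_nat; apply: cq.
  lra.
set M := \sum_(u in W) ((m u)%:R : R).
have eM : M = (\sum_(u in W) m u)%N%:R by rewrite natr_sum.
have musi : (m us)%:R <= i%:R :> R by rewrite ler_nat geq_minr.
have kc0 : 0 <= k * (c us)%:R by apply: mulr_ge0; [exact: ltW | exact: ler0n].
(* the degree bound limits every c u to about (w + i) / 3, and their sum is so
   large that sum_minn_ge gives M >= 3 i *)
have [B1 B2] : 4 * i%:R - k * (w%:R + 2 * i%:R - 8) <= M /\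
   2 * i%:R <= M - (m us)%:R + k * (c us)%:R.
  have [b [b3 b5]] : exists b, (3 * b + 3 <= w + i)%N /\ (w + i <= 3 * b + 5)%N.
    exists ((w + i) %/ 3).-1.
    by apply: pred_div3_bounds; rewrite (leq_trans i3) ?leq_addl.
  have cb u : u \in W -> (c u <= b)%N.
    by move=> uW; have h3 := c3 _ uW; clear -h3 b5; lia.
  have ib : (i <= b)%N by have hb := cb _ u0W; clear -i3 cu0 hb; lia.
  have kC : i%:R <= k * (w%:R + 2 * i%:R - 8).
    rewrite -[X in X <= _]ek ler_wpM2l ?(ltW k0) //; lra.
  case: (leqP (2 * b + i) (\sum_(u in W) c u)%N) => hb.
    have M3 : 3 * i%:R <= M.
      rewrite eM -natrM ler_nat; have := sum_minn_ge (e := 0) cb ib.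
      by rewrite !addn0; apply.
    split; lra.
  (* the count fails only for w = 12 and i = 3, where k = 3 / 7 decides *)
  have [ei ew] : (i = 3 /\ w = 12)%N.
    exact: (sum_minn_exception i3 cu0 (cb _ u0W) b3 b5 sC hb).
  have b4 : b = 4%N by rewrite ei ew in b3 b5; clear -b3 b5; lia.
  have M8 : 8 <= M.
    have h8 : (3 * i <= \sum_(u in W) m u + 1)%N.
      apply: (sum_minn_ge cb ib); clear -sC ei ew b4; lia.
    by rewrite eM ler_nat; clear -h8 ei; lia.
  have ek' : k = 3 / 7 by rewrite /k ei ew; congr (_ / _); ring.
  rewrite ek' ei ew; split; first lra.
  have : (m us = minn (c us) 3)%N by rewrite /m ei.
  case: (leqP (c us) 2) => h2 em.
    have : (m us)%:R <= 2 :> R by rewrite ler_nat em (leq_trans (geq_minl _ _) h2).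
    have : 0 <= (c us)%:R :> R by exact: ler0n.
    lra.
  have -> : (m us)%:R = 3 :> R by congr (_%:R); rewrite em; apply/minn_idPr.
  have : 3 <= (c us)%:R :> R by rewrite ler_nat.
  lra.
apply: (mix_deletions_transfer (h := h) (c := c) (m := m) (us := us)
          cW i3 wi4 z0 _ eYx sA sc sCR usW cus dA) => //.
- by rewrite /h le_max lexx.
- by move=> u uW _; apply: dX.
- move=> u uW uus cu; rewrite /h; case: (leP 0 (- eta us)) => _.
    by apply: dR.
  by rewrite mulr0 addr0 dA.
- move=> u uW cu; have hu := hmin u; rewrite uW cu /= in hu.
  have := hu isT; rewrite /h; case: (leP 0 (- eta us)) => ?; lra.
- by move=> u uW; rewrite /m geq_minr; rewrite leq_min (leq_trans _ i3) // andbT.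
Qed.

(** * The configurations with a general argument *)

(** The coefficient of [z / 2] in [small_support_nonneg], with [2 * (w + i)] for
    [miss F U + 8], is at least [0]. *)
Lemma small_support_arith (w i : nat) : (3 <= i)%N -> (w <= i + 2)%N ->
  (7 <= w + i)%N -> (2 * (w + i) + w + w * i + i <= w * w + i * i + 8)%N.
Proof.
move=> i3 wi n7.
have [s es] : exists s, (i + 2 = w + s)%N by exists (i + 2 - w)%N; lia.
have [q eq] : exists q, (i = q + 3)%N by exists (i - 3)%N; lia.
case: s es => [|[|[|[|s]]]] es;
  try (have ew : (w = i + 2 \/ w = i + 1 \/ w = i \/ w + 1 = i)%N by lia); nia.
Qed.

Section SymmetricWeights.
Variables (R : realFieldType) (T : finType) (U W I : {set T}) (F : rel T).
Variables (y : T -> T -> R) (eta : T -> R) (z : R).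
Hypothesis cfg : sym_config U W I F y eta z.
Local Notation H := (\sum_(v in W) eta v).
Local Notation i := #|I|.
Local Notation w := #|W|.
Local Notation d := (deg F W).

Lemma card_cfg : #|U| = (w + i)%N.
Proof.
by have [eU dWI _ _ _] := cfg; rewrite eU cardsU (disjoint_setI0 dWI) cards0 subn0.
Qed.

Lemma miss_cfg : miss F U = (\sum_(u in W) d u)%N.
Proof.
have [eU _ _ _ _] := cfg; rewrite eU (miss_sub cfg) //.
Qed.

Lemma eta_le u : u \in W -> (2 <= i)%N -> 2 * eta u <= z.
Proof.
have [eU dWI [_ _ ys _ yt] FI [yW yI]] := cfg.
move=> uW /card_gt1P[x [x' [xI x'I xx']]].
have inU a : a \in I -> a \in U by rewrite eU inE orbC => ->.
have uU : u \in U by rewrite eU inE uW.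
have nu a : a \in I -> a != u.
  by move=> aI; apply/eqP => e; rewrite e (disjointFr dWI uW) in aI.
have := yt x x' u (inU _ xI) (inU _ x'I) uU xx' (nu _ xI) (nu _ x'I).
rewrite !FI ?uU ?inU // => /(_ isT isT isT).
by rewrite yI // !yW //; lra.
Qed.

Lemma z_ge0 : (3 <= i)%N -> 0 <= z.
Proof.
have [eU dWI [_ _ ys _ yt] FI [yW yI]] := cfg.
case/card_gt2P => [x [x' [x'' [[xI x'I x''I] [h1 h2 h3]]]]].
have inU a : a \in I -> a \in U by rewrite eU inE orbC => ->.
have := yt x x' x'' (inU _ xI) (inU _ x'I) (inU _ x''I) h1 _ h2.
rewrite eq_sym in h3; rewrite !FI ?inU // => /(_ h3 isT isT isT).
by rewrite !yI //; lra.
Qed.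

Lemma eta_edge u v : u \in W -> v \in W -> (0 < i)%N -> u != v -> ~~ F u v ->
  eta u + eta v <= y u v.
Proof.
have [eU dWI [Fs _ ys _ yt] FI [yW yI]] := cfg.
move=> uW vW /card_gt0P[x xI] uv Fuv.
have xU : x \in U by rewrite eU inE xI orbT.
have uU : u \in U by rewrite eU inE uW.
have vU : v \in U by rewrite eU inE vW.
have nu a : a \in W -> x != a.
  by move=> aW; apply/eqP => e; rewrite -e in aW; rewrite (disjointFr dWI aW) in xI.
have := yt x u v xU uU vU (nu _ uW) (nu _ vW) uv.
rewrite !(FI x) // => /(_ isT isT Fuv).
by rewrite !(yW x) //; lra.
Qed.

Lemma ydeg_ge u : u \in W -> (0 < i)%N ->
  (w%:R - 1 - (d u)%:R) * eta u + H - eta u - \sum_(v in W) (F u v)%:R * eta v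
    <= ydeg y W u.
Proof.
move=> uW i0; have [eU dWI [Fs Fi ys y0 yt] FI [yW yI]] := cfg.
have inU a : a \in W -> a \in U by rewrite eU inE => ->.
have -> : (w%:R - 1 - (d u)%:R) * eta u + H - eta u - \sum_(v in W) (F u v)%:R * eta v
  = \sum_(v in W) (1 - (v == u)%:R - (F u v)%:R) * (eta u + eta v).
  transitivity (\sum_(v in W) (1 - (v == u)%:R - (F u v)%:R) * eta u +
     \sum_(v in W) (eta v - (v == u)%:R * eta v - (F u v)%:R * eta v)); last first.
    by rewrite -big_split /=; apply: eq_bigr => v _; ring.
  rewrite -mulr_suml !sumrB sumr_const /deg natr_sum.
  have e (g : T -> R) : \sum_(v in W) (v == u)%:R * g v = g u.
    rewrite (big_setD1 u) //= eqxx mul1r big1 ?addr0 // => v.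
    by rewrite !inE => /andP[/negPf-> _]; rewrite mul0r.
  have -> : \sum_(v in W) ((v == u)%:R : R) = 1.
    by rewrite -[RHS](e (fun _ => 1)); apply: eq_bigr => v _; rewrite mulr1.
  rewrite e; ring.
apply: ler_sum => v vW; have [-> | vu] := eqVneq v u.
  by rewrite Fi y0 ?eqxx ?inU //= subrr subr0 mul0r.
have [Fuv | Fuv] := boolP (F u v).
  by rewrite subr0 subrr mul0r y0 ?Fuv ?orbT ?inU.
by rewrite !subr0 mul1r; apply: eta_edge; rewrite // eq_sym.
Qed.

(** Summation of [ydeg_ge] over [W]: [eta u] occurs once for each non-neighbour
    of [u] in each of the two orders. *)
Lemma totW_ge : (0 < i)%N ->
  2 * \sum_(u in W) (w%:R - 1 - (d u)%:R) * eta u <= tot y W.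
Proof.
move=> i0; have [_ _ [Fs _ _ _ _] _ _] := cfg.
have : \sum_(u in W) ((w%:R - 1 - (d u)%:R) * eta u + H - eta u
          - \sum_(v in W) (F u v)%:R * eta v) <= tot y W.
  by apply: ler_sum => u uW; apply: ydeg_ge.
rewrite !sumrB big_split /= sumr_const exchange_big /=.
under [X in _ - X <= _]eq_bigr => v _.
  rewrite -mulr_suml.
  rewrite (_ : \sum_(u in W) ((F u v)%:R : R) = (d v)%:R); last first.
    by rewrite /deg natr_sum; apply: eq_bigr => u _; rewrite Fs.
  over.
have -> : \sum_(u in W) (w%:R - 1 - (d u)%:R) * eta u =
   (w%:R - 1) * H - \sum_(u in W) (d u)%:R * eta u.
  by rewrite mulr_sumr -sumrB; apply: eq_bigr => u _; rewrite mulrBl.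
rewrite -[_ *+ w]mulr_natl; lra.
Qed.

Hypothesis deg_gt0 : forall u, u \in W -> (0 < d u)%N.
Hypothesis few_missing : (miss F U + 8 <= 2 * #|U|)%N.

(** Only triangles that meet [I] are used.  They bound the weight of each pair
    inside [W] from below by [eta u + eta v]; then [eta u] occurs in the total with the
    coefficient [w - 1 - d u - i], which is at most [0] here, so that [eta u] can
    be replaced by its upper bound [z / 2]. *)
Lemma small_support_nonneg : (3 <= i)%N -> (w <= i + 2)%N -> (7 <= #|U|)%N -> 0 <= tot y U.
Proof.
move=> i3 wi n7; have z0 := z_ge0 i3.
have i0 : (0 < i)%N by apply: leq_trans i3.
have i2 : (2 <= i)%N by apply: leq_trans i3.
rewrite (totU cfg); have := totW_ge i0.
have wiR : w%:R <= i%:R + 2 :> R by rewrite -natrD ler_nat.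
have h : \sum_(u in W) (w%:R - 1 - (d u)%:R - i%:R) * (z / 2) <=
   \sum_(u in W) (w%:R - 1 - (d u)%:R - i%:R) * eta u.
  apply: ler_sum => u uW; rewrite ler_wnM2l //; last by have := eta_le uW i2; lra.
  have : 1 <= (d u)%:R :> R by rewrite ler1n deg_gt0.
  lra.
have e : \sum_(u in W) (w%:R - 1 - (d u)%:R - i%:R) * eta u =
   \sum_(u in W) (w%:R - 1 - (d u)%:R) * eta u - i%:R * H.
  by rewrite mulr_sumr -sumrB; apply: eq_bigr => u _; rewrite mulrBl.
have e' : \sum_(u in W) (w%:R - 1 - (d u)%:R - i%:R) * (z / 2) =
   (w%:R * (w%:R - 1 - i%:R) - (miss F U)%:R) * (z / 2).
  rewrite -mulr_suml; congr (_ * _); rewrite !sumrB !sumr_const miss_cfg natr_sum.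
  rewrite -[w%:R *+ _]mulr_natl -[i%:R *+ _]mulr_natl -[1 *+ _]mulr_natl; ring.
have key : 0 <= w%:R * (w%:R - 1 - i%:R) - (miss F U)%:R + i%:R * (i%:R - 1) :> R.
  have : (miss F U)%:R + 8 <= 2 * (w%:R + i%:R) :> R.
    by rewrite !(=^~ natrD, =^~ natrM) ler_nat -card_cfg.
  have : 2 * (w%:R + i%:R) + w%:R + w%:R * i%:R + i%:R <= w%:R * w%:R + i%:R * i%:R + 8 :> R.
    rewrite !(=^~ natrD, =^~ natrM) ler_nat.
    by apply: small_support_arith; rewrite -?card_cfg.
  lra.
have : 0 <= (w%:R * (w%:R - 1 - i%:R) - (miss F U)%:R + i%:R * (i%:R - 1)) * (z / 2).
  by apply: mulr_ge0 => //; lra.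
lra.
Qed.

Variable n : nat.
Hypothesis cU : #|U| = n.
Hypothesis IH : forall m, (7 <= m)%N -> (m < n)%N -> tot_nonneg m.

Lemma del_bound u j (r : T -> nat) : u \in W -> (j <= i)%N -> (7 + j + 1 <= n)%N ->
  (forall v, v \in W :\ u -> (r v + j <= i)%N) ->
  (\sum_(v in W :\ u) r v + j + 1 <= d u)%N ->
  ydeg y U u + j%:R * ((i%:R - 1) * z - H + eta u) - j%:R * (j%:R - 1) / 2 * z
    + \sum_(v in W :\ u) (r v)%:R * - eta v <= tot y U / 2.
Proof.
move=> uW ji nj hr hd; apply: (deletion_bound cfg (n := (n - (j + 1))%N)) => //.
  by rewrite cU; clear -nj; lia.
by apply: IH; clear -nj; lia.
Qed.

Lemma del_bound0 u j : u \in W -> (j <= i)%N -> (7 + j + 1 <= n)%N -> (j < d u)%N ->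
  ydeg y U u + j%:R * ((i%:R - 1) * z - H + eta u) - j%:R * (j%:R - 1) / 2 * z
     <= tot y U / 2.
Proof.
move=> uW ji nj jd.
have := del_bound (r := fun _ => 0%N) uW ji nj.
rewrite [X in (X + j + 1 <= _)%N]big1 // [X in _ + X <= _]big1 ?addr0; last first.
  by move=> v _; rewrite mul0r.
by rewrite add0n addn1; apply.
Qed.

Lemma del_bound1 u v j m : u \in W -> v \in W -> u != v -> (m + j <= i)%N ->
  (7 + j + 1 <= n)%N -> (m + j < d u)%N ->
  ydeg y U u + j%:R * ((i%:R - 1) * z - H + eta u) - j%:R * (j%:R - 1) / 2 * z
     + m%:R * - eta v <= tot y U / 2.
Proof.
move=> uW vW uv mi nj md.
have vWu : v \in W :\ u by rewrite !inE eq_sym uv.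
pose r x := if x == v then m else 0%N.
have r0 x : x \in (W :\ u) :\ v -> r x = 0%N.
  by rewrite !inE /r => /andP[/negPf -> _].
have rv : r v = m by rewrite /r eqxx.
have e1 : (\sum_(x in W :\ u) r x = m)%N.
  by rewrite (big_setD1 v) //= big1 ?addn0.
have e2 : \sum_(x in W :\ u) (r x)%:R * - eta x = m%:R * - eta v.
  by rewrite (big_setD1 v) //= rv big1 ?addr0 // => x /r0 ->; rewrite mul0r.
rewrite -e2; apply: del_bound => //.
- by apply: leq_trans mi; apply: leq_addl.
- move=> x _; rewrite /r; case: ifP => // _; rewrite add0n.
  by apply: leq_trans mi; apply: leq_addl.
- by rewrite e1 addn1.
Qed.

End SymmetricWeights.

Section TightSymmetricWeights.
Variables (R : realFieldType) (T : finType) (U W I : {set T}) (F : rel T).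
Variables (y : T -> T -> R) (eta : T -> R) (z : R) (n : nat).
Hypothesis cfg : sym_config U W I F y eta z.
Local Notation H := (\sum_(v in W) eta v).
Local Notation i := #|I|.
Local Notation w := #|W|.
Local Notation d := (deg F W).
Hypothesis deg_gt0 : forall u, u \in W -> (0 < d u)%N.
Hypothesis missU : (miss F U + 8 = 2 * #|U|)%N.
Hypothesis cU : #|U| = n.
Hypothesis IH : forall m, (7 <= m)%N -> (m < n)%N -> tot_nonneg m.
Hypothesis deg_small : forall u, u \in W -> (3 * d u <= n)%N.

Let few : (miss F U + 8 <= 2 * #|U|)%N. Proof. by rewrite missU. Qed.
Let nwi : n = (w + i)%N. Proof. by rewrite -cU (card_cfg cfg). Qed.

Lemma sum_ydeg : \sum_(u in W) ydeg y U u =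
  2 * (tot y U / 2) - i%:R * ((i%:R - 1) * z - H).
Proof.
rewrite (eq_bigr _ (ydeg_W cfg)) sumrB -mulr_sumr (totU cfg).
by rewrite -[X in X - _]/(tot y W); field.
Qed.

Lemma sum_deg1 : (\sum_(u in W) (d u).-1 + 8 = w + 2 * i)%N.
Proof.
have : (\sum_(u in W) d u = \sum_(u in W) (d u).-1 + w)%N.
  rewrite -sum1_card -big_split /=; apply: eq_bigr => u uW.
  by rewrite addn1 prednK ?deg_gt0.
by move: missU; rewrite (miss_cfg cfg) (card_cfg cfg); clear; lia.
Qed.

(** Deletion of [u] and one isolated vertex.  As [w <= d u + i + 1], the
    resulting bound does not increase with any [eta], and the upper
    bounds [eta <= z / 2] leave a nonnegative multiple of [z]. *)
Lemma large_degree_nonneg u : (3 <= i)%N -> (9 <= n)%N -> u \in W -> (1 < d u)%N ->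
  (w <= d u + i + 1)%N -> 0 <= tot y U.
Proof.
move=> i3 n9 uW du hub; have z0 := z_ge0 cfg i3.
have i0 : (0 < i)%N by apply: leq_trans i3.
have i2 : (2 <= i)%N by apply: leq_trans i3.
have h := del_bound0 cfg few cU IH uW i0 n9 du.
have h' := ydeg_ge cfg uW i0.
rewrite (ydeg_W cfg) // mul1r subrr mulr0 !mul0r subr0 in h.
have hN : \sum_(v in W) (F u v)%:R * eta v <= (d u)%:R * (z / 2).
  rewrite /deg natr_sum mulr_suml; apply: ler_sum => v vW.
  by case: (F u v); rewrite ?mul0r // !mul1r; have := eta_le cfg vW i2; lra.
have hu : ((d u)%:R + 1 + i%:R - w%:R) * eta u <= ((d u)%:R + 1 + i%:R - w%:R) * (z / 2).
  apply: ler_wpM2l; last by have := eta_le cfg uW i2; lra.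
  by have : w%:R <= (d u)%:R + i%:R + 1%:R :> R; [rewrite -!natrD ler_nat | lra].
have c3 : 3 * (d u)%:R <= w%:R + i%:R :> R.
  by rewrite !(=^~ natrD, =^~ natrM) ler_nat -nwi deg_small.
have c9 : 9 <= w%:R + i%:R :> R by rewrite -natrD ler_nat -nwi.
have : 0 <= (2 * i%:R + 2 * w%:R - 6 * (d u)%:R + (w%:R + i%:R - 9)) * z.
  by apply: mulr_ge0 => //; lra.
lra.
Qed.

Lemma many_isolated_nonneg : (3 <= i)%N -> (9 <= n)%N -> 0 <= tot y U.
Proof.
move=> i3 n9.
have i0 : (0 < i)%N by apply: leq_trans i3.
have i2 : (2 <= i)%N by apply: leq_trans i3.
case: (leqP w (i + 2)) => wi.
  apply: (small_support_nonneg cfg) => //; rewrite cU.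
  by apply: leq_trans n9.
case: (boolP [exists u in W, (1 < d u) && (w <= d u + i + 1)]%N).
  by case/exists_inP => u uW /andP[]; apply: large_degree_nonneg.
rewrite negb_exists_in => /forall_inP nohub.
have cq u : u \in W -> ((d u).-1 + i + 3 <= w)%N.
  move=> uW; have := nohub _ uW; have := deg_gt0 uW.
  by move: wi; clear; case: (d u) => [|[|k]]; lia.
have z0 := z_ge0 cfg i3.
suff : 0 <= tot y U / 2 by rewrite pmulr_lge0 ?invr_gt0.
apply: (deletion_system_nonneg (W := W) (c := fun u => (d u).-1) (eta := eta)
   (A := ydeg y U) (z := z) (H := H) erefl i3 _ z0 erefl sum_ydeg) => //.
- by rewrite addn3 -addn2.
- have := totW_ge cfg i0; rewrite (totU cfg).
  have -> : \sum_(u in W) ((d u).-1)%:R * eta u = \sum_(u in W) ((d u)%:R - 1) * eta u.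
    by apply: eq_bigr => u uW; rewrite -subn1 natrB // deg_gt0.
  have -> : \sum_(u in W) (w%:R - 1 - (d u)%:R) * eta u =
     (w%:R - 2) * H - \sum_(u in W) ((d u)%:R - 1) * eta u.
    by rewrite mulr_sumr -sumrB; apply: eq_bigr => u _; ring.
  lra.
- exact: sum_deg1.
- by move=> u uW; rewrite -nwi prednK ?deg_gt0 // deg_small.
- move=> u uW; have := del_bound0 (j := 0) cfg few cU IH uW (leq0n _).
  rewrite !mul0r subr0 addr0; apply; last exact: deg_gt0.
  by apply: leq_trans n9.
- move=> u j uW; rewrite leq_min => /andP[j1 j2].
  apply: (del_bound0 cfg few cU IH uW j2).
    have := cq _ uW; rewrite nwi; move: j1 i3; clear; lia.
  by rewrite -(prednK (deg_gt0 uW)) ltnS.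
- move=> u v uW vW uv.
  have := del_bound1 (j := 0) (m := minn (d u).-1 i) cfg few cU IH uW vW uv.
  rewrite !mul0r subr0 addr0 !addn0 geq_minr; apply => //.
    by apply: leq_trans n9.
  by rewrite -[X in (_ < X)%N](prednK (deg_gt0 uW)) ltnS geq_minl.
Qed.

(** Let [x] be the isolated vertex.  The deletion of [u1] and [x] gains the total
    weight at [x] and [eta u1] over the deletion of [u1] alone; the deletion of
    [u2] with the spare edge [x u1] returns [eta u1].  So the
    inequalities for all deletions, with [S] half of the total, add up to
    [2 S <= w S]. *)
Lemma one_isolated_nonneg u1 u2 : i = 1%N -> (9 <= n)%N ->
  u1 \in W -> u2 \in W -> u1 != u2 -> (1 < d u1)%N -> (1 < d u2)%N -> 0 <= tot y U.
Proof.
move=> i1 n9 u1W u2W u12 du1 du2.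
have n8 : (7 + 0 + 1 <= n)%N by apply: leq_trans n9.
have h0 u : u \in W -> ydeg y U u <= tot y U / 2.
  move=> uW; have := del_bound0 (j := 0) cfg few cU IH uW (leq0n _) n8 (deg_gt0 uW).
  by rewrite !mul0r subr0 addr0.
have h1 : ydeg y U u1 + (- H + eta u1) <= tot y U / 2.
  have := del_bound0 (j := 1) cfg few cU IH u1W; rewrite i1 => /(_ isT n9 du1).
  by rewrite !subrr !mul0r mulr0 !mul0r subr0 mul1r sub0r.
have h2 : ydeg y U u2 - eta u1 <= tot y U / 2.
  have := del_bound1 (j := 0) (m := 1) cfg few cU IH u2W u1W.
  rewrite eq_sym i1 => /(_ u12 isT n8 du2).
  by rewrite !mul0r subr0 addr0 mul1r.
have hs := sum_ydeg; rewrite i1 subrr !mul0r sub0r mul1r opprK in hs.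
have u2W1 : u2 \in W :\ u1 by rewrite !inE eq_sym u12.
move: hs; rewrite (big_setD1 u1) //= (big_setD1 u2) //=.
have eW : w%:R = #|(W :\ u1) :\ u2|%:R + 2 :> R.
  by rewrite (cardsD1 u1 W) u1W (cardsD1 u2 (W :\ u1)) u2W1 !natrD /=; ring.
have : \sum_(u in (W :\ u1) :\ u2) ydeg y U u <= (w%:R - 2) * (tot y U / 2).
  have : \sum_(u in (W :\ u1) :\ u2) ydeg y U u <= \sum_(u in (W :\ u1) :\ u2) tot y U / 2.
    by apply: ler_sum => u; rewrite !inE => /andP[_ /andP[_ uW]]; apply: h0.
  by move/le_trans; apply; rewrite sumr_const -[_ *+ _]mulr_natl eW addrK; apply: lexx.
have w3 : 3 <= w%:R :> R by rewrite ler_nat; move: n9; rewrite nwi i1; clear; lia.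
set S := tot y U / 2 in h1 h2 *; set E := \sum_(u in _) ydeg y U u.
move=> h3 h4; have : 0 <= (w%:R - 2) * S by lra.
rewrite pmulr_rge0; last by lra.
by rewrite /S pmulr_lge0 ?invr_gt0.
Qed.

(** If the deletion of [u] leaves a gain [g u], and these gains cover the total
    weights at all isolated vertices, then the inequalities, with [S] half of the
    total, add up to [2 S <= w S]. *)
Lemma sum_pay (g : T -> R) : (2 < w)%N ->
  (forall u, u \in W -> ydeg y U u + g u <= tot y U / 2) ->
  i%:R * ((i%:R - 1) * z - H) <= \sum_(u in W) g u -> 0 <= tot y U.
Proof.
move=> w2 hg hs; have : \sum_(u in W) (ydeg y U u + g u) <= \sum_(u in W) tot y U / 2.
  exact: ler_sum.
rewrite big_split /= sum_ydeg sumr_const -[(tot y U / 2) *+ _]mulr_natl => h.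
have : 0 <= (w%:R - 2) * (tot y U / 2) by lra.
rewrite pmulr_rge0 ?subr_gt0 ?ltr_nat //.
by rewrite pmulr_lge0 ?invr_gt0.
Qed.

(** Two gains are needed that contain the total weight [Yx] at an isolated
    vertex.  They come from deleting two vertices of degree at least [2], each
    with one isolated vertex, and contain [eta] of the deleted vertex besides.
    This is paid back by spare edges: those of the two vertices themselves if
    both have degree at least [3], and otherwise those of a third vertex of
    degree at least [3], or of a third and a fourth vertex.  As [n >= 10], the
    bound [3 d(u) <= n] excludes everything else. *)
Lemma two_isolated_nonneg : i = 2%N -> (10 <= n)%N -> 0 <= tot y U.
Proof.
move=> i2 n10.
have n8 : (7 + 0 + 1 <= n)%N by apply: leq_trans n10.
have n9 : (7 + 1 + 1 <= n)%N by apply: leq_trans n10.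
have w8 : (8 <= w)%N by move: n10; rewrite nwi i2; clear; lia.
have w2 : (2 < w)%N by apply: leq_trans w8.
pose Yx := z - H.
have eYx : (i%:R - 1) * z - H = Yx by rewrite i2 /Yx; ring.
have h0 u : u \in W -> ydeg y U u <= tot y U / 2.
  move=> uW; have := del_bound0 (j := 0) cfg few cU IH uW (leq0n _) n8 (deg_gt0 uW).
  by rewrite !mul0r subr0 addr0.
have h1 u : u \in W -> (1 < d u)%N -> ydeg y U u + (Yx + eta u) <= tot y U / 2.
  move=> uW du; have := del_bound0 (j := 1) cfg few cU IH uW; rewrite i2 => /(_ isT n9 du).
  by rewrite -eYx i2 mul1r subrr mulr0 !mul0r subr0.
have h01 u v : u \in W -> v \in W -> u != v -> (1 < d u)%N ->
    ydeg y U u - eta v <= tot y U / 2.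
  move=> uW vW uv du.
  have := del_bound1 (j := 0) (m := 1) cfg few cU IH uW vW uv.
  by rewrite i2 => /(_ isT n8 du); rewrite !mul0r subr0 addr0 mul1r.
have h11 u v : u \in W -> v \in W -> u != v -> (2 < d u)%N ->
    ydeg y U u + (Yx + eta u - eta v) <= tot y U / 2.
  move=> uW vW uv du.
  have := del_bound1 (j := 1) (m := 1) cfg few cU IH uW vW uv.
  rewrite eYx i2 => /(_ isT n9 du).
  by rewrite subrr mulr0 !mul0r !mul1r; lra.
have h02 u v v' : u \in W -> v \in W -> v' \in W -> u != v -> u != v' -> v != v' ->
   (2 < d u)%N -> ydeg y U u + (- eta v - eta v') <= tot y U / 2.
  move=> uW vW v'W uv uv' vv' du.
  have vWu : v \in W :\ u by rewrite !inE eq_sym uv.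
  have v'Wu : v' \in (W :\ u) :\ v by rewrite !inE v'W (eq_sym v' v) (eq_sym v' u) vv' uv'.
  pose r x : nat := ((x == v) || (x == v')).
  have r0 x : x \in ((W :\ u) :\ v) :\ v' -> r x = 0%N.
    by rewrite !inE /r => /and3P[/negPf-> /negPf->].
  have rv : r v = 1%N by rewrite /r eqxx.
  have rv' : r v' = 1%N by rewrite /r eqxx orbT.
  have e1 : (\sum_(x in W :\ u) r x = 2)%N.
    by rewrite (big_setD1 v) //= (big_setD1 v') //= rv rv' big1.
  have e2 : \sum_(x in W :\ u) (r x)%:R * - eta x = - eta v - eta v'.
    rewrite (big_setD1 v) //= (big_setD1 v') //= rv rv' big1 ?addr0 ?mul1r //.
    by move=> x /r0 ->; rewrite mul0r.
  have := del_bound (j := 0) (r := r) cfg few cU IH uW (leq0n _) n8.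
  rewrite e1 e2 !mul0r subr0 addr0; apply => //.
  by move=> x _; rewrite /r i2; case: (_ || _).
pose Tb := [set u in W | (1 < d u)%N].
have sTb : (\sum_(u <- enum Tb) (d u).-1 + 8 = w + 4)%N.
  have := sum_deg1; rewrite i2 => <-; congr (_ + _)%N.
  rewrite big_enum /= [in RHS](big_setID Tb) /=.
  rewrite [X in (_ + X)%N]big1 ?addn0.
    by apply: eq_bigl => u; rewrite !inE; case: (u \in W).
  move=> u; rewrite !inE => /andP[h uW]; move: h; rewrite uW /= -leqNgt.
  by case: (d u) => [|[]].
have inTb u : u \in enum Tb -> u \in W /\ (1 < d u)%N.
  by rewrite mem_enum inE => /andP.
have d3 u : u \in W -> (3 * d u <= w + 2)%N by move=> /deg_small; rewrite nwi i2.
have zig (g : T -> R) (s : seq T) : uniq s -> {subset s <= W} ->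
   \sum_(u in W) (if u \in s then g u else 0) = \sum_(u <- s) g u.
  move=> us sW; rewrite -big_mkcondr /= [RHS]big_uniq //=; apply: eq_bigl => u.
  by case: (boolP (u \in s)) => [/sW -> | _]; rewrite ?andbF.
have pay3 u1 u2 u3 : u1 \in W -> u2 \in W -> u3 \in W -> u1 != u2 -> u1 != u3 -> u2 != u3 ->
  (1 < d u1)%N -> (1 < d u2)%N -> (2 < d u3)%N -> 0 <= tot y U.
  move=> u1W u2W u3W u12 u13 u23 du1 du2 du3.
  apply: (sum_pay (g := fun u => if u \in [:: u1; u2; u3] then
            (if u == u1 then Yx + eta u1 else if u == u2 then Yx + eta u2 else
             - eta u1 - eta u2) else 0)) => //.
    move=> u uW; rewrite !inE; case: eqP => [-> | _] /=; first exact: h1.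
    case: eqP => [-> | _] /=; first exact: h1.
    case: eqP => [-> | _]; last by rewrite addr0 h0.
    by apply: h02; rewrite // eq_sym.
  rewrite zig; last by move=> u; rewrite !inE => /or3P[] /eqP->.
    rewrite !big_cons big_nil !eqxx (eq_sym u2) (eq_sym u3) (negPf u12) (negPf u13).
    by rewrite (eq_sym u3) (negPf u23) eYx i2; lra.
  by rewrite /= !inE negb_or u12 u13 u23.
have uT := enum_uniq (mem Tb).
move: uT sTb inTb.
case: (enum Tb) => [|u1 [|u2 [|u3 [|u4 s]]]].
- by rewrite big_nil => _ h _; exfalso; move: w8 h; clear; lia.
- move=> _; rewrite big_seq1 => h /(_ u1); rewrite inE eqxx => /(_ isT)[/d3 h3 _]; exfalso.
  by move: w8 h h3; clear; case: (d u1) => //= [|k]; lia.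
- move=> /=; rewrite inE andbT => u12; rewrite !big_cons big_nil addn0 => h inT.
  have [u1W du1] := inT u1 (mem_head _ _).
  have [u2W du2] : u2 \in W /\ (1 < d u2)%N by apply: inT; rewrite !inE eqxx orbT.
  have := d3 _ u1W; have := d3 _ u2W => e2 e1.
  have d2 : (2 < d u2)%N by move: w8 h e1 e2 du1; clear; case: (d u1) (d u2) => [|a] [|b] //=; lia.
  have d1 : (2 < d u1)%N by move: w8 h e1 e2 du2; clear; case: (d u1) (d u2) => [|a] [|b] //=; lia.
  apply: (sum_pay (g := fun u => if u \in [:: u1; u2] then
            (if u == u1 then Yx + eta u1 - eta u2 else Yx + eta u2 - eta u1) else 0)) => //.
    move=> u uW; rewrite !inE; case: eqP => [-> | _] /=; first exact: h11.
    case: eqP => [-> | _]; last by rewrite addr0 h0.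
    by apply: h11; rewrite // eq_sym.
  rewrite zig /= ?inE ?u12 //; last by move=> u; rewrite !inE => /orP[] /eqP->.
  rewrite !big_cons big_nil eqxx eq_sym (negPf u12) eYx i2; lra.
- move=> uu h inT.
  have [u1W du1] := inT u1 (mem_head _ _).
  have [u2W du2] : u2 \in W /\ (1 < d u2)%N by apply: inT; rewrite !inE eqxx orbT.
  have [u3W du3] : u3 \in W /\ (1 < d u3)%N by apply: inT; rewrite !inE eqxx !orbT.
  move: uu; rewrite /= !inE negb_or andbT => /andP[/andP[u12 u13] u23].
  have [|[]] : (2 < d u3)%N \/ (2 < d u1)%N \/ (2 < d u2)%N.
  - move: h w8 du1 du2 du3; rewrite !big_cons big_nil; clear.
    by case: (d u1) (d u2) (d u3) => [|a] [|b] [|c] //=; lia.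
  - exact: (pay3 u1 u2 u3).
  - by apply: (pay3 u2 u3 u1); rewrite // eq_sym.
  - by apply: (pay3 u1 u3 u2); rewrite // eq_sym.
- move=> uu h inT.
  have [u1W du1] := inT u1 (mem_head _ _).
  have [u2W du2] : u2 \in W /\ (1 < d u2)%N by apply: inT; rewrite !inE eqxx orbT.
  have [u3W du3] : u3 \in W /\ (1 < d u3)%N by apply: inT; rewrite !inE eqxx !orbT.
  have [u4W du4] : u4 \in W /\ (1 < d u4)%N by apply: inT; rewrite !inE eqxx !orbT.
  have uu' : uniq [:: u1; u2; u3; u4].
    by have := take_uniq 4 uu; rewrite /= take0.
  move: (uu'); rewrite /= !inE !negb_or andbT => /and3P[/and3P[u12 u13 u14] /andP[u23 u24] u34].
  apply: (sum_pay (g := fun u => if u \in [:: u1; u2; u3; u4] then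
            (if u == u1 then Yx + eta u1 else if u == u2 then Yx + eta u2 else
             if u == u3 then - eta u1 else - eta u2) else 0)) => //.
    move=> u uW; rewrite !inE; case: eqP => [-> | _] /=; first exact: h1.
    case: eqP => [-> | _] /=; first exact: h1.
    case: eqP => [-> | _] /=; first by apply: h01; rewrite // eq_sym.
    case: eqP => [-> | _]; last by rewrite addr0 h0.
    by apply: h01; rewrite // eq_sym.
  rewrite zig //; last by move=> u; rewrite !inE => /or4P[] /eqP->.
  rewrite !big_cons big_nil !eqxx (eq_sym u2) (eq_sym u3) (eq_sym u4) (negPf u12) (negPf u13).
  rewrite (negPf u14) (eq_sym u3) (eq_sym u4) (negPf u23) (negPf u24) (eq_sym u4) (negPf u34).
  rewrite eYx i2; lra.
Qed.

End TightSymmetricWeights.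

(** * Explicit fractional triangle decompositions *)

Lemma miss_ge_edges (T : finType) (F : rel T) (U : {set T}) (s : seq (T * T)) :
  symmetric F -> uniq s -> all (fun p => [&& p.1 \in U, p.2 \in U & F p.1 p.2]) s ->
  (forall p, p \in s -> (p.2, p.1) \notin s) ->
  (2 * size s <= miss F U)%N.
Proof.
move=> Fs us /allP sU anti.
pose sw (p : T * T) := (p.2, p.1).
have swK : involutive sw by case.
pose P := [pred p : T * T | [&& p.1 \in U, p.2 \in U & F p.1 p.2]].
have -> : miss F U = #|P|.
  rewrite -sum1_card /miss pair_big_dep /= big_mkcond /= [RHS]big_mkcond.
  apply: eq_bigr => -[a b] _ /=; rewrite inE /=.
  by case: (a \in U); case: (b \in U); case: (F a b).
rewrite mul2n -addnn -[X in (_ + X)%N](size_map sw) -size_cat cardE.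
apply: uniq_leq_size.
  rewrite cat_uniq us (map_inj_uniq (inv_inj swK)) us andbT /=.
  apply/hasPn => _ /mapP[p ps ->]; exact: anti.
move=> p; rewrite mem_cat mem_enum inE => /orP[/sU // | /mapP[[a b] /sU /= /and3P[aU bU Fab] ->]].
by rewrite /= aU bU Fs.
Qed.

(** For [a != b] this is the total weight of the triangles that contain the
    edge [a b]. *)
Definition cover (C : seq (seq nat * nat)) (a b : nat) : nat :=
  sumn [seq (((a \in c.1) && (b \in c.1)) * c.2)%N | c <- C].

(** The vertices are [0, ..., n - 1], [E] lists the pairs of [F], and [C] is a
    list of weighted triangles avoiding [E] that cover each other pair with total
    weight exactly [D]: up to the factor [D], a fractional triangle
    decomposition. *)
Definition decomposition (n : nat) (E : seq (nat * nat)) (C : seq (seq nat * nat))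
    (D : nat) : bool :=
  [&& all (fun c => [&& size c.1 == 3, sorted ltn c.1, all (ltn^~ n) c.1 &
             all (fun e => ~~ ((e.1 \in c.1) && (e.2 \in c.1))) E]) C,
      all (fun e => e.1 < e.2 < n) E, uniq E, 0 < D &
      all (fun b => all (fun a => ((a, b) \in E) || (cover C a b == D)) (iota 0 b)) (iota 0 n)]%N.

(** The total is a combination of triangle sums.  It is enough to find the pairs
    [E] inside [F]: by the bound on [miss F U], there are no others.  The list [s]
    need not name the isolated vertices. *)
Lemma decomposition_nonneg n E C D (R : realFieldType) (T : finType) (U : {set T})
    (F : rel T) (y : T -> T -> R) (s : seq T) x0 :
  decomposition n E C D -> tri_weight U F y -> #|U| = n -> uniq s -> {subset s <= U} ->
  all (fun e => (maxn e.1 e.2 < size s)%N && F (nth x0 s e.1) (nth x0 s e.2)) E ->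
  (miss F U <= 2 * size E)%N ->
  0 <= tot y U.
Proof.
move=> /and5P[/allP hC /allP hE uE D0 /allP hD] tw cU us0 s0U /allP sE hm.
have [Fs Fi ys y0 yt] := tw.
(* the vertices that the list does not name complete the enumeration of [U] *)
pose s' := s ++ enum (U :\: [set x in s]).
have us : uniq s'.
  rewrite cat_uniq us0 enum_uniq andbT; apply/hasPn => x.
  by rewrite mem_enum !inE => /andP[].
have mem_s x : (x \in s') = (x \in U).
  rewrite mem_cat mem_enum !inE.
  by have [/s0U ->|] := boolP (x \in s).
have sz : size s' = n.
  rewrite -cU cardE; apply/perm_size/uniq_perm; rewrite ?enum_uniq // => x.
  by rewrite mem_s mem_enum.
pose g a := nth x0 s' a.
have gU a : (a < n)%N -> g a \in U by move=> an; rewrite -mem_s mem_nth ?sz.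
have gI a b : (a < n)%N -> (b < n)%N -> (g a == g b) = (a == b).
  by move=> an bn; rewrite nth_uniq ?sz.
have gE e : e \in E -> F (g e.1) (g e.2).
  move=> /sE; rewrite gtn_max => /andP[/andP[h1 h2]].
  by rewrite /g !nth_cat h1 h2.
have noF a b : (a < b < n)%N -> (a, b) \notin E -> ~~ F (g a) (g b).
  move=> /andP[ab bn] abE; apply/negP => Fab.
  have an : (a < n)%N by apply: ltn_trans bn.
  have lt e : e \in (a, b) :: E -> (e.1 < e.2 < n)%N.
    by rewrite inE => /orP[/eqP->|/hE //]; rewrite ab.
  have : (2 * size [seq (g e.1, g e.2) | e <- (a, b) :: E] <= miss F U)%N.
    apply: miss_ge_edges => //.
    - rewrite map_inj_in_uniq /= ?abE // => -[a1 b1] [a2 b2].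
      move=> /lt /= /andP[l1 l1'] /lt /= /andP[l2 l2'].
      case=> /eqP e1 /eqP e2.
      rewrite gI ?(ltn_trans l1) ?(ltn_trans l2) // in e1.
      by rewrite gI // in e2; rewrite (eqP e1) (eqP e2).
    - apply/allP => _ /mapP[e eE ->] /=; have /andP[l1 l2] := lt _ eE.
      rewrite !gU ?(ltn_trans l1) //=.
      by move: eE; rewrite inE => /orP[/eqP->|/gE].
    - move=> _ /mapP[e1 /lt /andP[l1 l1'] ->]; apply/negP => /mapP[e2 /lt /andP[l2 l2']].
      move=> /= []  /eqP h1 /eqP h2; rewrite gI ?(ltn_trans l2) // in h1.
      rewrite gI ?(ltn_trans l1) // in h2.
      by move: l1 l2; rewrite (eqP h1) (eqP h2) => h h'; have := ltn_trans h h'; rewrite ltnn.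
  by rewrite size_map /=; move: hm; clear; lia.
have sumU (h : T -> R) : \sum_(a in U) h a = \sum_(a <- iota 0 n) h (g a).
  rewrite -(big_map g predT h) -big_enum; apply: perm_big; apply: uniq_perm.
  - exact: enum_uniq.
  - by rewrite -{1}sz -/(mkseq g _) mkseq_nth.
  - by move=> x; rewrite -{1}sz -/(mkseq g _) mkseq_nth mem_s mem_enum.
pose z a b := y (g a) (g b).
have eD : D%:R * tot y U = \sum_(c <- C) c.2%:R * \sum_(a <- c.1) \sum_(b <- c.1) z a b.
  rewrite /tot sumU (eq_bigr _ (fun a _ => sumU _)).
  transitivity (\sum_(a <- iota 0 n) \sum_(b <- iota 0 n) (cover C a b)%:R * z a b).
    rewrite mulr_sumr; apply: eq_big_seq => a; rewrite mem_iota add0n /= => an.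
    rewrite mulr_sumr; apply: eq_big_seq => b; rewrite mem_iota add0n /= => bn.
    have coverC : cover C a b = cover C b a.
      by congr sumn; apply: eq_map => c; rewrite andbC.
    have key a1 b1 : (a1 < b1 < n)%N -> z a1 b1 = 0 \/ D = cover C a1 b1.
      move=> /andP[l1 l1']; have := hD b1; rewrite mem_iota => /(_ l1') /allP /(_ a1).
      rewrite mem_iota => /(_ l1) /orP[abE|/eqP]; [left | by right].
      rewrite /z y0 ?gU ?(ltn_trans l1) //.
      by rewrite (gE _ abE) orbT.
    case: (ltngtP a b) => ab.
    - have h : (a < b < n)%N by rewrite ab bn.
      by rewrite -/(z a b); case: (key a b h) => [-> | <-]; rewrite ?mulr0.
    - have h : (b < a < n)%N by rewrite ab an.
      have zC : z a b = z b a by rewrite /z ys.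
      by rewrite -/(z a b) coverC zC; case: (key b a h) => [-> | <-]; rewrite ?mulr0.
    - by rewrite ab /z y0 ?gU ?eqxx // !mulr0.
  rewrite (eq_bigr (fun a => \sum_(c <- C) \sum_(b <- iota 0 n)
     c.2%:R * (((a \in c.1) && (b \in c.1))%:R * z a b))); last first.
    move=> a _; rewrite exchange_big; apply: eq_bigr => b _.
    rewrite /cover sumnE big_map natr_sum mulr_suml; apply: eq_bigr => c _.
    by rewrite natrM mulrAC mulrC mulrA.
  rewrite exchange_big; apply: eq_big_seq => c /hC /and4P[_ srt /allP lt _].
  have uc : uniq c.1 by apply: sorted_uniq srt; [apply: ltn_trans | apply: ltnn].
  have pick (h : nat -> R) : \sum_(a <- c.1) h a = \sum_(a <- iota 0 n) (a \in c.1)%:R * h a.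
    transitivity (\sum_(a <- iota 0 n | a \in c.1) h a); last first.
      by rewrite big_mkcond; apply: eq_bigr => a _; case: ifP => _; rewrite ?mul1r ?mul0r.
    rewrite -[RHS]big_filter; apply: perm_big; apply: uniq_perm; rewrite ?filter_uniq ?iota_uniq //.
    move=> a; rewrite mem_filter mem_iota /= add0n.
    by have [/lt /= ->|] := boolP (a \in c.1).
  rewrite pick mulr_sumr; apply: eq_bigr => a _.
  rewrite pick mulr_sumr [RHS]mulr_sumr; apply: eq_bigr => b _.
  by rewrite -mulnb natrM; ring.
have : 0 <= D%:R * tot y U.
  rewrite eD big_seq; apply: sumr_ge0 => -[c m] /hC /= /and4P[/eqP c3 srt /allP lt /allP av].
  apply: mulr_ge0 => //; case: c c3 srt lt av => [|i [|j [|k []]]] //= _.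
  rewrite andbT => /andP[ij jk] lt av.
  have [ni nj nk] : [/\ i < n, j < n & k < n]%N.
    by split; apply: lt; rewrite !inE eqxx ?orbT.
  have ik := ltn_trans ij jk.
  have nE a b : a \in [:: i; j; k] -> b \in [:: i; j; k] -> (a, b) \notin E.
    by move=> ha hb; apply/negP => /av /=; rewrite ha hb.
  have := yt (g i) (g j) (g k) (gU _ ni) (gU _ nj) (gU _ nk).
  rewrite !gI // !ltn_eqF // !noF ?ij ?ik ?jk ?nj ?nk ?nE ?inE ?eqxx ?orbT //.
  move=> /(_ isT isT isT isT isT isT).
  have yd a : (a < n)%N -> y (g a) (g a) = 0 by move=> an; rewrite y0 ?gU ?eqxx.
  rewrite !big_cons !big_nil /z !yd // (ys (g j) (g i)) (ys (g k) (g i)) (ys (g k) (g j)).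
  lra.
by rewrite pmulr_rge0 ?ltr0n.
Qed.

(** * The exceptional graphs *)

(** The graphs [F] for which the deletion inequalities do not suffice, as
    disjoint unions of paths, stars and cycles; the fork is the tree with
    degrees [3, 2, 1, 1, 1].  Vertices of degree at least [2] come first, then
    the leaves next to them, then the components [K2], then the isolated
    vertices: this is the order in which [branching_components] and [next_K2]
    find them.  The weights solve the linear equations that define a
    decomposition. *)
Definition P3_K2 : seq (nat * nat) := [:: (0, 1); (0, 2); (3, 4)].
Definition P3_K2_weights : seq (seq nat * nat) := [::
    ([:: 0; 3; 5], 2); ([:: 0; 4; 6], 2); ([:: 1; 2; 3], 1); ([:: 1; 2; 4], 1);
    ([:: 1; 3; 6], 1); ([:: 1; 4; 5], 1); ([:: 1; 5; 6], 1); ([:: 2; 3; 6], 1);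
    ([:: 2; 4; 5], 1); ([:: 2; 5; 6], 1)].
Lemma P3_K2_decomposition : decomposition 7 P3_K2 P3_K2_weights 2.
Proof. by []. Qed.

Definition three_K2 : seq (nat * nat) := [:: (0, 1); (2, 3); (4, 5)].
Definition three_K2_weights : seq (seq nat * nat) := [::
    ([:: 0; 2; 5], 2); ([:: 0; 3; 4], 1); ([:: 0; 3; 6], 1); ([:: 0; 4; 6], 1);
    ([:: 1; 2; 4], 1); ([:: 1; 2; 6], 1); ([:: 1; 3; 4], 1); ([:: 1; 3; 5], 1);
    ([:: 1; 5; 6], 1); ([:: 2; 4; 6], 1); ([:: 3; 5; 6], 1)].
Lemma three_K2_decomposition : decomposition 7 three_K2 three_K2_weights 2.
Proof. by []. Qed.

Definition two_P3 : seq (nat * nat) := [:: (0, 2); (0, 3); (1, 4); (1, 5)].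
Definition two_P3_weights : seq (seq nat * nat) := [::
    ([:: 0; 1; 6], 1); ([:: 0; 1; 7], 1); ([:: 0; 4; 5], 2); ([:: 0; 6; 7], 1);
    ([:: 1; 2; 3], 1); ([:: 1; 2; 7], 1); ([:: 1; 3; 6], 1); ([:: 2; 3; 4], 1);
    ([:: 2; 4; 7], 1); ([:: 2; 5; 6], 2); ([:: 3; 4; 6], 1); ([:: 3; 5; 7], 2);
    ([:: 4; 6; 7], 1)].
Lemma two_P3_decomposition : decomposition 8 two_P3 two_P3_weights 2.
Proof. by []. Qed.

Definition P4_K2 : seq (nat * nat) := [:: (0, 1); (0, 2); (1, 3); (4, 5)].
Definition P4_K2_weights : seq (seq nat * nat) := [::
    ([:: 0; 3; 5], 1); ([:: 0; 3; 7], 1); ([:: 0; 4; 6], 2); ([:: 0; 5; 7], 1);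
    ([:: 1; 2; 5], 1); ([:: 1; 2; 6], 1); ([:: 1; 4; 7], 2); ([:: 1; 5; 6], 1);
    ([:: 2; 3; 4], 2); ([:: 2; 5; 7], 1); ([:: 2; 6; 7], 1); ([:: 3; 5; 6], 1);
    ([:: 3; 6; 7], 1)].
Lemma P4_K2_decomposition : decomposition 8 P4_K2 P4_K2_weights 2.
Proof. by []. Qed.

Definition P3_two_K2 : seq (nat * nat) := [:: (0, 1); (0, 2); (3, 4); (5, 6)].
Definition P3_two_K2_weights : seq (seq nat * nat) := [::
    ([:: 0; 3; 5], 1); ([:: 0; 3; 6], 1); ([:: 0; 4; 6], 1); ([:: 0; 4; 7], 1);
    ([:: 0; 5; 7], 1); ([:: 1; 2; 3], 1); ([:: 1; 2; 6], 1); ([:: 1; 3; 5], 1);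
    ([:: 1; 4; 5], 1); ([:: 1; 4; 7], 1); ([:: 1; 6; 7], 1); ([:: 2; 3; 7], 1);
    ([:: 2; 4; 5], 1); ([:: 2; 4; 6], 1); ([:: 2; 5; 7], 1); ([:: 3; 6; 7], 1)].
Lemma P3_two_K2_decomposition : decomposition 8 P3_two_K2 P3_two_K2_weights 2.
Proof. by []. Qed.

Definition K13_two_K2 : seq (nat * nat) := [:: (0, 1); (0, 2); (0, 3); (4, 5); (6, 7)].
Definition K13_two_K2_weights : seq (seq nat * nat) := [::
    ([:: 0; 4; 6], 3); ([:: 0; 4; 8], 3); ([:: 0; 5; 7], 6); ([:: 0; 6; 8], 3);
    ([:: 1; 2; 4], 2); ([:: 1; 2; 5], 2); ([:: 1; 2; 8], 2); ([:: 1; 3; 5], 1);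
    ([:: 1; 3; 6], 4); ([:: 1; 3; 7], 1); ([:: 1; 4; 7], 3); ([:: 1; 4; 8], 1);
    ([:: 1; 5; 6], 2); ([:: 1; 5; 8], 1); ([:: 1; 7; 8], 2); ([:: 2; 3; 4], 3);
    ([:: 2; 3; 6], 1); ([:: 2; 3; 7], 2); ([:: 2; 4; 6], 1); ([:: 2; 5; 6], 4);
    ([:: 2; 7; 8], 4); ([:: 3; 4; 7], 3); ([:: 3; 5; 8], 5); ([:: 3; 6; 8], 1);
    ([:: 4; 6; 8], 2)].
Lemma K13_two_K2_decomposition : decomposition 9 K13_two_K2 K13_two_K2_weights 6.
Proof. by []. Qed.

Definition fork_K2 : seq (nat * nat) := [:: (0, 1); (0, 2); (0, 3); (1, 4); (5, 6)].
Definition fork_K2_weights : seq (seq nat * nat) := [::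
    ([:: 0; 4; 5], 1); ([:: 0; 4; 6], 3); ([:: 0; 4; 8], 2); ([:: 0; 5; 7], 5);
    ([:: 0; 6; 8], 3); ([:: 0; 7; 8], 1); ([:: 1; 2; 5], 1); ([:: 1; 2; 6], 2);
    ([:: 1; 2; 7], 2); ([:: 1; 2; 8], 1); ([:: 1; 3; 5], 3); ([:: 1; 3; 8], 3);
    ([:: 1; 5; 8], 2); ([:: 1; 6; 7], 4); ([:: 2; 3; 4], 2); ([:: 2; 3; 6], 4);
    ([:: 2; 4; 5], 4); ([:: 2; 5; 8], 1); ([:: 2; 7; 8], 4); ([:: 3; 4; 7], 4);
    ([:: 3; 5; 8], 3); ([:: 3; 6; 7], 2); ([:: 4; 5; 7], 1); ([:: 4; 6; 8], 3);
    ([:: 4; 7; 8], 1)].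
Lemma fork_K2_decomposition : decomposition 9 fork_K2 fork_K2_weights 6.
Proof. by []. Qed.

Definition K13_P3 : seq (nat * nat) := [:: (0, 2); (0, 3); (0, 4); (1, 5); (1, 6)].
Definition K13_P3_weights : seq (seq nat * nat) := [::
    ([:: 0; 1; 7], 3); ([:: 0; 1; 8], 3); ([:: 0; 5; 6], 6); ([:: 0; 7; 8], 3);
    ([:: 1; 2; 4], 1); ([:: 1; 2; 7], 2); ([:: 1; 2; 8], 3); ([:: 1; 3; 4], 5);
    ([:: 1; 3; 7], 1); ([:: 2; 3; 6], 5); ([:: 2; 3; 7], 1); ([:: 2; 4; 5], 3);
    ([:: 2; 4; 8], 2); ([:: 2; 5; 7], 3); ([:: 2; 6; 8], 1); ([:: 3; 4; 7], 1);
    ([:: 3; 5; 7], 2); ([:: 3; 5; 8], 4); ([:: 3; 6; 8], 1); ([:: 3; 7; 8], 1);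
    ([:: 4; 5; 7], 1); ([:: 4; 5; 8], 2); ([:: 4; 6; 7], 4); ([:: 4; 6; 8], 2);
    ([:: 6; 7; 8], 2)].
Lemma K13_P3_decomposition : decomposition 9 K13_P3 K13_P3_weights 6.
Proof. by []. Qed.

Definition C3_two_K2 : seq (nat * nat) := [:: (0, 1); (0, 2); (1, 2); (3, 4); (5, 6)].
Definition C3_two_K2_weights : seq (seq nat * nat) := [::
    ([:: 0; 3; 6], 2); ([:: 0; 3; 7], 4); ([:: 0; 4; 6], 4); ([:: 0; 4; 8], 2);
    ([:: 0; 5; 7], 2); ([:: 0; 5; 8], 4); ([:: 1; 3; 6], 3); ([:: 1; 3; 8], 3);
    ([:: 1; 4; 5], 3); ([:: 1; 4; 8], 3); ([:: 1; 5; 7], 3); ([:: 1; 6; 7], 3);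
    ([:: 2; 3; 5], 5); ([:: 2; 3; 6], 1); ([:: 2; 4; 5], 1); ([:: 2; 4; 6], 1);
    ([:: 2; 4; 7], 4); ([:: 2; 6; 8], 4); ([:: 2; 7; 8], 2); ([:: 3; 5; 8], 1);
    ([:: 3; 7; 8], 2); ([:: 4; 5; 7], 1); ([:: 4; 5; 8], 1); ([:: 4; 6; 7], 1);
    ([:: 6; 7; 8], 2)].
Lemma C3_two_K2_decomposition : decomposition 9 C3_two_K2 C3_two_K2_weights 6.
Proof. by []. Qed.

Definition P5_K2 : seq (nat * nat) := [:: (0, 1); (0, 2); (1, 3); (2, 4); (5, 6)].
Definition P5_K2_weights : seq (seq nat * nat) := [::
    ([:: 0; 3; 5], 1); ([:: 0; 3; 7], 4); ([:: 0; 3; 8], 1); ([:: 0; 4; 6], 5);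
    ([:: 0; 4; 8], 1); ([:: 0; 5; 7], 1); ([:: 0; 5; 8], 4); ([:: 0; 6; 7], 1);
    ([:: 1; 2; 5], 6); ([:: 1; 4; 7], 3); ([:: 1; 4; 8], 3); ([:: 1; 6; 7], 3);
    ([:: 1; 6; 8], 3); ([:: 2; 3; 6], 4); ([:: 2; 3; 8], 2); ([:: 2; 6; 7], 2);
    ([:: 2; 7; 8], 4); ([:: 3; 4; 5], 4); ([:: 3; 4; 7], 1); ([:: 3; 4; 8], 1);
    ([:: 3; 5; 7], 1); ([:: 3; 6; 8], 2); ([:: 4; 5; 7], 2); ([:: 4; 6; 8], 1);
    ([:: 5; 7; 8], 2)].
Lemma P5_K2_decomposition : decomposition 9 P5_K2 P5_K2_weights 6.
Proof. by []. Qed.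

Definition P4_P3 : seq (nat * nat) := [:: (0, 1); (0, 3); (1, 4); (2, 5); (2, 6)].
Definition P4_P3_weights : seq (seq nat * nat) := [::
    ([:: 0; 2; 4], 3); ([:: 0; 2; 8], 3); ([:: 0; 4; 5], 3); ([:: 0; 5; 6], 3);
    ([:: 0; 6; 7], 3); ([:: 0; 7; 8], 3); ([:: 1; 2; 7], 3); ([:: 1; 2; 8], 3);
    ([:: 1; 3; 6], 4); ([:: 1; 3; 8], 2); ([:: 1; 5; 6], 2); ([:: 1; 5; 7], 3);
    ([:: 1; 5; 8], 1); ([:: 2; 3; 4], 3); ([:: 2; 3; 7], 3); ([:: 3; 4; 6], 1);
    ([:: 3; 4; 7], 2); ([:: 3; 5; 6], 1); ([:: 3; 5; 7], 1); ([:: 3; 5; 8], 4);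
    ([:: 4; 5; 7], 2); ([:: 4; 5; 8], 1); ([:: 4; 6; 7], 1); ([:: 4; 6; 8], 4);
    ([:: 4; 7; 8], 1); ([:: 6; 7; 8], 2)].
Lemma P4_P3_decomposition : decomposition 9 P4_P3 P4_P3_weights 6.
Proof. by []. Qed.

Section Components.
Variables (T : finType) (U : {set T}) (F : rel T).
Hypotheses (Fs : symmetric F) (Fi : irreflexive F).
Local Notation d := (deg F U).
Local Notation W := [set u in U | (0 < d u)%N].

Lemma degE u : d u = #|[set b in U | F u b]|.
Proof.
rewrite /deg -sum1_card [RHS]big_mkcond [LHS]big_mkcond; apply: eq_bigr => b _.
by rewrite inE; case: (b \in U); case: (F u b).
Qed.

Lemma deg_le1 x a b : (d x <= 1)%N -> a \in U -> b \in U -> F x a -> F x b -> a = b.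
Proof.
rewrite degE => /card_le1_eqP h aU bU Fa Fb.
by apply: h; rewrite inE ?aU ?bU.
Qed.

(** The list [s] enumerates a union of connected components of [F] on [U]. *)
Definition components (s : seq T) : Prop :=
  [/\ uniq s, {subset s <= U} & forall a b, a \in s -> b \in U -> F a b -> b \in s].

(** Outside [s] there is a vertex that meets [F]; both it and its neighbour have
    degree [1], so they form a component. *)
Lemma next_K2 s : components s -> (forall x, x \in U -> x \notin s -> (d x <= 1)%N) ->
  (size s < #|W|)%N -> exists a b, F a b /\ components (s ++ [:: a; b]).
Proof.
case=> us sU cl out lt.
have [a aW as'] : exists2 a, a \in W & a \notin s.
  apply/exists_inP; apply: contraLR lt; rewrite negb_exists_in -leqNgt => /forall_inP h.
  apply: leq_trans (card_size s); apply/subset_leq_card/subsetP => x xW.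
  by have := h x xW; rewrite negbK.
move: aW; rewrite inE => /andP[aU]; rewrite degE => /card_gt0P[b]; rewrite inE => /andP[bU Fab].
have bs' : b \notin s by apply: contra as' => bs; apply: (cl b); rewrite // Fs.
have ab : a != b by apply: contraTneq Fab => ->; rewrite Fi.
exists a, b; split=> //; split.
- rewrite cat_uniq us /= !inE ab orbF /= andbT.
  by rewrite negb_or as' bs'.
- by move=> x; rewrite mem_cat !inE => /or3P[/sU|/eqP->|/eqP->].
- move=> x x' + x'U Fxx'; rewrite !mem_cat !inE => /or3P[xs|/eqP xa|/eqP xb].
  + by rewrite (cl _ _ xs).
  + rewrite xa in Fxx'; rewrite (deg_le1 (out a aU as') x'U bU Fxx' Fab).
    by rewrite eqxx !orbT.
  + rewrite xb in Fxx'; rewrite (deg_le1 (out b bU bs') x'U aU Fxx' _) ?(Fs b) //.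
    by rewrite eqxx orbT.
Qed.

Variable t : seq T.
Hypotheses (ut : uniq t) (tU : {subset t <= U}).
Hypothesis out : forall x, x \in U -> x \notin t -> (d x <= 1)%N.

Definition leaves u := enum [set b in U | F u b && (b \notin t)].

Lemma mem_leaves u b : b \in leaves u -> [/\ b \in U, F u b & b \notin t].
Proof. by rewrite mem_enum inE => /and3P. Qed.

Lemma size_leaves u : (size (leaves u) + count (F u) t = d u)%N.
Proof.
rewrite degE -(cardID (mem t) [set b in U | F u b]) [RHS]addnC.
rewrite /leaves -cardE; congr (_ + _)%N.
- by apply: eq_card => b; rewrite !inE; case: (b \in t); rewrite ?andbT ?andbF.
- rewrite -size_filter -(card_uniqP (filter_uniq _ ut)); apply: eq_card => b.
rewrite !inE mem_filter andbC.
by have [/tU -> | ] := boolP (b \in t); rewrite ?andbT ?andbF.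
Qed.

(** If [t] contains all vertices of degree at least [2], the other neighbours of
    its members are leaves; a leaf has one neighbour only, so that the lists of
    leaves are disjoint. *)
Lemma leaves_components : components (t ++ flatten [seq leaves u | u <- t]).
Proof.
have memL x : x \in flatten [seq leaves u | u <- t] -> exists2 u, u \in t & x \in leaves u.
  by move=> /flattenP[_ /mapP[u ut' ->] xu]; exists u.
split.
- rewrite cat_uniq ut /=; apply/andP; split.
    by apply/hasPn => x /memL[u _ /mem_leaves[_ _]].
  suff H t' : uniq t' -> {subset t' <= t} -> uniq (flatten [seq leaves u | u <- t']).
    exact: H.
  elim: t' => // u t' IH /= /andP[ut' uniq_t'] sub.
  rewrite cat_uniq enum_uniq IH ?andbT //; last first.
    by move=> x xt'; apply: sub; rewrite inE xt' orbT.
  apply/hasPn => x /flattenP[_ /mapP[u' u't' ->] /mem_leaves[xU Fu'x xt]].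
  apply/negP => /mem_leaves[_ Fux _].
  have uU : u \in U by apply/tU/sub/mem_head.
  have u'U : u' \in U by apply/tU/sub; rewrite inE u't' orbT.
  move: ut'; rewrite (deg_le1 (out xU xt) uU u'U) ?u't' //; by rewrite Fs.
- by move=> x; rewrite mem_cat => /orP[/tU //|/memL[u _ /mem_leaves[]]].
- move=> a b + bU Fab; rewrite !mem_cat => /orP[at'|/memL[u ut' /mem_leaves[aU Fua at']]].
    have [//|bt] := boolP (b \in t); apply/flattenP.
    exists (leaves a); first exact: map_f.
    by rewrite mem_enum inE bU Fab.
  by rewrite (deg_le1 (out aU at') bU (tU ut') Fab) ?ut' // Fs.
Qed.
End Components.

Section Exceptions.
Variables (R : realFieldType) (T : finType) (U : {set T}) (F : rel T) (y : T -> T -> R).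
Hypothesis tw : tri_weight U F y.
Hypothesis missU : (miss F U + 8 = 2 * #|U|)%N.
Local Notation d := (deg F U).
Local Notation W := [set u in U | (0 < d u)%N].
Hypothesis deg_small : forall u, u \in U -> (3 * d u <= #|U|)%N.

Let Fs : symmetric F. Proof. by case: tw. Qed.
Let Fi : irreflexive F. Proof. by case: tw. Qed.

(** Stated up to permutation, because the order of [t] decides the numbering of
    the vertices in a decomposition. *)
Definition branching (t : seq T) := perm_eq t (enum [set u in U | (1 < d u)%N]).

Lemma branchingP t : branching t ->
  [/\ uniq t, {subset t <= U}, forall x, x \in U -> x \notin t -> (d x <= 1)%N &
   forall x, x \in t -> (1 < d x)%N].
Proof.
move=> pt; have mt x : (x \in t) = (x \in U) && (1 < d x)%N.
  by rewrite (perm_mem pt) mem_enum inE.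
split=> [||x xU|x]; rewrite ?mt.
- by rewrite (perm_uniq pt) enum_uniq.
- by move=> x; rewrite mt => /andP[].
- by rewrite xU /= -leqNgt.
- by case/andP.
Qed.

Lemma sum_branching t : branching t ->
  (\sum_(u <- t) (d u).-1 + #|W| + 8 = 2 * #|U|)%N.
Proof.
move=> pt; rewrite -missU; congr (_ + _)%N; rewrite (perm_big _ pt) big_enum /=.
rewrite -sum1_card /miss big_mkcond [X in (_ + X)%N]big_mkcond [RHS]big_mkcond -big_split /=.
apply: eq_bigr => u _.
rewrite !inE; case: (u \in U) => //=; rewrite -[X in _ = X]/(d u).
by case: (d u) => [|[]] //= k; rewrite addn1.
Qed.

Lemma branching_components t : branching t ->
  components U F (t ++ flatten [seq leaves U F t u | u <- t]).
Proof. by case/branchingP => *; apply: leaves_components. Qed.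

Lemma branching_leaves t u : branching t -> u \in t ->
  (size (leaves U F t u) + count (F u) t = d u)%N /\ all (F u) (leaves U F t u).
Proof.
case/branchingP => ut tU _ _ uti; split; first exact: size_leaves.
by apply/allP => b /mem_leaves[].
Qed.

Lemma branching_next t s : branching t -> {subset t <= s} -> components U F s ->
  (size s < #|W|)%N -> exists a b, F a b /\ components U F (s ++ [:: a; b]).
Proof.
case/branchingP => _ _ out _ ts cs; apply: next_K2 => // x xU xs; apply: out => //.
by apply: contra xs; apply: ts.
Qed.

Lemma components_decomposition n E C D s x0 :
  decomposition n E C D -> #|U| = n -> components U F s ->
  all (fun e => (maxn e.1 e.2 < size s)%N && F (nth x0 s e.1) (nth x0 s e.2)) E ->
  (n <= size E + 4)%N -> 0 <= tot y U.
Proof.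
move=> dec cU [us sU _] sE nE; apply: (decomposition_nonneg dec tw cU us sU sE).
by move: missU; rewrite cU; clear -nE; lia.
Qed.

(** By [sum_branching] the sum of the [d u - 1] is [#|U| - 7].  With at most one
    vertex of degree at least [2], [F] is a star, possibly a single edge, and two
    more edges. *)
Lemma one_isolated_exceptions_nonneg : (7 <= #|U| <= 9)%N -> #|U| = #|W|.+1 ->
  (forall u v, u \in U -> v \in U -> (1 < d u)%N -> (1 < d v)%N -> u = v) -> 0 <= tot y U.
Proof.
move=> n79 UW one.
have bt : branching (enum [set u in U | (1 < d u)%N]) by apply: perm_refl.
have := sum_branching bt; have := bt; case: (enum _) => [|u [|v t]].
- move=> b0; rewrite big_nil => sm.
  have cU : #|U| = 7%N by move: sm UW; clear -n79; lia.
  have cW : #|W| = 6%N by move: cU UW; clear; lia.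
  have := branching_components b0; rewrite /= => c0.
  have [//||a1 [b1 [F1 /= c1]]] := branching_next b0 _ c0; first by rewrite cW.
  have [//||a2 [b2 [F2 /= c2]]] := branching_next b0 _ c1; first by rewrite cW.
  have [//||a3 [b3 [F3 /= c3]]] := branching_next b0 _ c2; first by rewrite cW.
  apply: (components_decomposition (x0 := a1) three_K2_decomposition cU c3) => //=.
  by rewrite F1 F2 F3.
- move=> b1; rewrite big_seq1 => sm.
  have [ut tU out big] := branchingP b1.
  have uU : u \in U by apply: tU; rewrite mem_head.
  have d2 : (1 < d u)%N by apply: big; rewrite mem_head.
  have cW : #|W| = (d u + 5)%N by move: sm UW d2; clear; lia.
  have [sL FL] := branching_leaves b1 (mem_head u _).
  rewrite /= Fi !addn0 in sL.
  have := branching_components b1; rewrite /= cats0 => c0.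
  have sub s : {subset [:: u] <= u :: s} by move=> x; rewrite !inE => ->.
  have [|a1 [b1' [F1 c1]]] := branching_next b1 (sub _) c0.
    by rewrite cW /= sL; clear; lia.
  have [|a2 [b2 [F2 c2]]] := branching_next b1 (sub _) c1.
    by rewrite cW /= size_cat sL /=; clear; lia.
  have cU : #|U| = (d u + 6)%N by move: UW cW; clear; lia.
  have du23 : (d u == 2) || (d u == 3) by move: cU n79 d2; clear; lia.
  move: FL sL c2; case/orP: du23 => /eqP du; rewrite du in cU *.
    case: (leaves _ _ _ _) => [|a [|b []]] //= /and3P[Fa Fb _] _ c2.
    apply: (components_decomposition (x0 := u) P3_two_K2_decomposition cU c2) => //=.
    by rewrite Fa Fb F1 F2.
  case: (leaves _ _ _ _) => [|a [|b [|c []]]] //= /and4P[Fa Fb Fc _] _ c2.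
  apply: (components_decomposition (x0 := u) K13_two_K2_decomposition cU c2) => //=.
  by rewrite Fa Fb Fc F1 F2.
- move=> b2 _; have [/= ut tU _ big] := branchingP b2.
  have uv : u = v by apply: one; rewrite ?tU ?big // !inE eqxx ?orbT.
  by move: ut; rewrite uv inE eqxx.
Qed.

Lemma leavesE t u k : branching t -> u \in t -> d u = (count (F u) t + k)%N ->
  size (leaves U F t u) = k /\ all (F u) (leaves U F t u).
Proof.
move=> bt ut du; have [sz FL] := branching_leaves bt ut; split=> //.
by move: sz; rewrite du; clear; lia.
Qed.

Lemma leaves0 t u : branching t -> u \in t -> d u = count (F u) t -> leaves U F t u = [::].
Proof.
move=> bt ut du; have [|/size0nil //] := leavesE (k := 0) bt ut.
by rewrite addn0.
Qed.

Lemma leaves1 t u : branching t -> u \in t -> d u = (count (F u) t).+1 ->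
  exists a, leaves U F t u = [:: a] /\ F u a.
Proof.
move=> bt ut du; have := leavesE (k := 1) bt ut.
case: (leaves U F t u) => [|a [|? ?]]; rewrite addn1 => /(_ du) [] //= _ /andP[Fa _].
by exists a.
Qed.

Lemma leaves2 t u : branching t -> u \in t -> d u = (count (F u) t).+2 ->
  exists a b, [/\ leaves U F t u = [:: a; b], F u a & F u b].
Proof.
move=> bt ut du; have := leavesE (k := 2) bt ut.
case: (leaves U F t u) => [|a [|b [|? ?]]]; rewrite addn2 => /(_ du) [] //= _ /and3P[Fa Fb _].
by exists a, b.
Qed.

Lemma leaves3 t u : branching t -> u \in t -> d u = (count (F u) t).+3 ->
  exists a b c, [/\ leaves U F t u = [:: a; b; c], F u a, F u b & F u c].
Proof.
move=> bt ut du; have := leavesE (k := 3) bt ut.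
case: (leaves U F t u) => [|a [|b [|c [|? ?]]]]; rewrite addn3 => /(_ du) [] //= _.
by move=> /and4P[Fa Fb Fc _]; exists a, b, c.
Qed.

(** By [sum_branching] the sum of the [d u - 1] is [#|U| - 6], at most [3].  The
    adjacencies among the at most three vertices of degree at least [2]
    determine [F]. *)
Lemma two_isolated_exceptions_nonneg : (7 <= #|U| <= 9)%N -> #|U| = (#|W| + 2)%N -> 0 <= tot y U.
Proof.
move=> n79 UW.
have bt : branching (enum [set u in U | (1 < d u)%N]) by apply: perm_refl.
have subl (t s : seq T) : {subset t <= t ++ s} by move=> x xt; rewrite mem_cat xt.
have in1 (u : T) s : u \in u :: s by rewrite mem_head.
have in2 (u v : T) s : v \in [:: u, v & s] by rewrite !inE eqxx orbT.
have in3 (u v w : T) s : w \in [:: u, v, w & s] by rewrite !inE eqxx !orbT.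
have one u : branching [:: u] -> #|U| = 7%N -> d u = 2%N -> 0 <= tot y U.
  move=> b1 cU du.
  have cW : #|W| = 5%N by move: UW; rewrite cU; clear; lia.
  have [||a [b [eL Fa Fb]]] := leaves2 (u := u) b1; rewrite //= ?Fi //.
  have := branching_components b1; rewrite /= eL /= => c0.
  have [|a1 [b1' [F1 /= c1]]] := branching_next b1 (subl _ _) c0; rewrite ?cW //.
  apply: (components_decomposition (x0 := u) P3_K2_decomposition cU c1) => //=.
  by rewrite Fa Fb F1.
have two u v : branching [:: u; v] -> #|U| = 8%N -> d u = 2%N -> d v = 2%N -> 0 <= tot y U.
  move=> b2 cU du dv.
  have cW : #|W| = 6%N by move: UW; rewrite cU; clear; lia.
  have := branching_components b2; rewrite /=.
  case: (boolP (F u v)) => [Fuv | /negPf Fuv].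
    have [||a [-> Fa]] := leaves1 (u := u) b2; rewrite //= ?Fi ?Fuv //.
    have [||b [-> Fb]] := leaves1 (u := v) b2; rewrite //= ?Fi ?(Fs v) ?Fuv //= => c0.
    have [|a1 [b1 [F1 /= c1]]] := branching_next b2 (subl _ _) c0; rewrite ?cW //.
    apply: (components_decomposition (x0 := u) P4_K2_decomposition cU c1) => //=.
    by rewrite Fuv Fa Fb F1.
  have [||a [b [-> Fa Fb]]] := leaves2 (u := u) b2; rewrite //= ?Fi ?Fuv //.
  have [||a' [b' [-> Fa' Fb']]] := leaves2 (u := v) b2; rewrite //= ?Fi ?(Fs v) ?Fuv //= => c0.
  apply: (components_decomposition (x0 := u) two_P3_decomposition cU c0) => //=.
  by rewrite Fa Fb Fa' Fb'.
have two' u v : branching [:: u; v] -> #|U| = 9%N -> d u = 3%N -> d v = 2%N -> 0 <= tot y U.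
  move=> b2 cU du dv.
  have cW : #|W| = 7%N by move: UW; rewrite cU; clear; lia.
  have := branching_components b2; rewrite /=.
  case: (boolP (F u v)) => [Fuv | /negPf Fuv].
    have [||a [a' [-> Fa Fa']]] := leaves2 (u := u) b2; rewrite //= ?Fi ?Fuv //.
    have [||b [-> Fb]] := leaves1 (u := v) b2; rewrite //= ?Fi ?(Fs v) ?Fuv //= => c0.
    have [|a1 [b1 [F1 /= c1]]] := branching_next b2 (subl _ _) c0; rewrite ?cW //.
    apply: (components_decomposition (x0 := u) fork_K2_decomposition cU c1) => //=.
    by rewrite Fuv Fa Fa' Fb F1.
  have [||a [b [c [-> Fa Fb Fc]]]] := leaves3 (u := u) b2; rewrite //= ?Fi ?Fuv //.
  have [||a' [b' [-> Fa' Fb']]] := leaves2 (u := v) b2; rewrite //= ?Fi ?(Fs v) ?Fuv //= => c0.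
  apply: (components_decomposition (x0 := u) K13_P3_decomposition cU c0) => //=.
  by rewrite Fa Fb Fc Fa' Fb'.
have triangle u v w : branching [:: u; v; w] -> #|U| = 9%N ->
    d u = 2%N -> d v = 2%N -> d w = 2%N -> F u v -> F u w -> F v w -> 0 <= tot y U.
  move=> b3 cU du dv dw Fuv Fuw Fvw.
  have cW : #|W| = 7%N by move: UW; rewrite cU; clear; lia.
  have := branching_components b3; rewrite /= cats0.
  rewrite (leaves0 (u := u) b3) ?(leaves0 (u := v) b3) ?(leaves0 (u := w) b3) //=;
    rewrite ?Fi ?(Fs w) ?(Fs v u) ?Fuv ?Fuw ?Fvw // => c0.
  have [|a1 [b1 [F1 /= c1]]] := branching_next b3 (subl _ _) c0; rewrite ?cW //.
  have [|a2 [b2 [F2 /= c2]]] := branching_next b3 (subl [:: u; v; w] _) c1; rewrite ?cW //.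
  apply: (components_decomposition (x0 := u) C3_two_K2_decomposition cU c2) => //=.
  by rewrite Fuv Fuw Fvw F1 F2.
have path5 u v w : branching [:: u; v; w] -> #|U| = 9%N ->
    d u = 2%N -> d v = 2%N -> d w = 2%N -> F u v -> F u w -> F v w = false -> 0 <= tot y U.
  move=> b3 cU du dv dw Fuv Fuw Fvw.
  have cW : #|W| = 7%N by move: UW; rewrite cU; clear; lia.
  have := branching_components b3; rewrite /= cats0.
  rewrite (leaves0 (u := u) b3) //=; last by rewrite Fi Fuv Fuw.
  have [||a [-> Fa]] := leaves1 (u := v) b3; rewrite //= ?Fi ?(Fs v u) ?Fuv ?Fvw //.
  have [||b [-> Fb]] := leaves1 (u := w) b3; rewrite //= ?Fi ?(Fs w) ?Fuw ?Fvw //= => c0.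
  have [|a1 [b1 [F1 /= c1]]] := branching_next b3 (subl [:: u; v; w] _) c0; rewrite ?cW //.
  apply: (components_decomposition (x0 := u) P5_K2_decomposition cU c1) => //=.
  by rewrite Fuv Fuw Fa Fb F1.
have edge u v w : branching [:: u; v; w] -> #|U| = 9%N ->
    d u = 2%N -> d v = 2%N -> d w = 2%N -> F u v -> F u w = false -> F v w = false ->
    0 <= tot y U.
  move=> b3 cU du dv dw Fuv Fuw Fvw.
  have cW : #|W| = 7%N by move: UW; rewrite cU; clear; lia.
  have := branching_components b3; rewrite /= cats0.
  have [||a [-> Fa]] := leaves1 (u := u) b3; rewrite //= ?Fi ?Fuv ?Fuw //.
  have [||b [-> Fb]] := leaves1 (u := v) b3; rewrite //= ?Fi ?(Fs v u) ?Fuv ?Fvw //.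
  have [||c [c' [-> Fc Fc']]] := leaves2 (u := w) b3; rewrite //= ?Fi ?(Fs w) ?Fuw ?Fvw //= => c0.
  apply: (components_decomposition (x0 := u) P4_P3_decomposition cU c0) => //=.
  by rewrite Fuv Fa Fb Fc Fc'.
have edgeless u v w : branching [:: u; v; w] -> #|U| = 9%N ->
    d u = 2%N -> d v = 2%N -> d w = 2%N -> F u v = false -> F u w = false -> F v w = false ->
    0 <= tot y U.
  move=> b3 cU du dv dw Fuv Fuw Fvw.
  have cW : #|W| = 7%N by move: UW; rewrite cU; clear; lia.
  have := branching_components b3; rewrite /= cats0.
  have [||a [a' [-> Fa Fa']]] := leaves2 (u := u) b3; rewrite //= ?Fi ?Fuv ?Fuw //.
  have [||b [b' [-> Fb Fb']]] := leaves2 (u := v) b3; rewrite //= ?Fi ?(Fs v u) ?Fuv ?Fvw //.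
  have [||c [c' [-> Fc Fc']]] := leaves2 (u := w) b3; rewrite //= ?Fi ?(Fs w) ?Fuw ?Fvw //=.
  case=> us sU cl; exfalso.
  suff : (9 <= #|W|)%N by rewrite cW.
  have nW p q : F p q -> p \in U -> q \in U -> p \in W.
    by move=> Fpq pU qU; rewrite inE pU degE; apply/card_gt0P; exists q; rewrite inE qU.
  have aW : all (mem W) [:: u; v; w; a; a'; b; b'; c; c'].
    move/allP: sU => /=; rewrite andbT => /and5P[uU vU wU aU /and5P[a'U bU b'U cU' c'U]].
    rewrite (nW u a) // (nW v b) // (nW w c) //.
    by rewrite (nW a u) ?(nW a' u) ?(nW b v) ?(nW b' v) ?(nW c w) ?(nW c' w) // Fs.
  rewrite -[9%N]/(size [:: u; v; w; a; a'; b; b'; c; c']) -(card_uniqP us).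
  by apply/subset_leq_card/subsetP => x /(allP aW).
have := sum_branching bt; have := bt; case: (enum _) => [|u [|v [|w [|x t]]]] bs;
  rewrite ?big_cons ?big_nil ?addn0; have [_ tU _ big] := branchingP bs.
- by clear -n79 UW; lia.
- have := big u (in1 _ _); have := deg_small (tU u (in1 _ _)) => h1 h2 sm.
  have [cU du] : #|U| = 7%N /\ d u = 2%N by move: sm h1 h2; clear -n79 UW; lia.
  exact: one bs cU du.
- have := big u (in1 _ _); have := big v (in2 _ _ _) => h1 h2 sm.
  have : (#|U| = 8 /\ d u = 2 /\ d v = 2) \/ (#|U| = 9 /\ d u = 3 /\ d v = 2) \/
     (#|U| = 9 /\ d u = 2 /\ d v = 3)%N by move: sm h1 h2; clear -n79 UW; lia.
  case=> [[cU [du dv]]|[[cU [du dv]]|[cU [du dv]]]].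
  + exact: (two u v).
  + exact: (two' u v).
  + exact: (two' v u (perm_trans (permEl (perm_catC [:: v] [:: u])) bs)).
- have := big u (in1 _ _); have := big v (in2 _ _ _); have := big w (in3 _ _ _ _) => h1 h2 h3 sm.
  have [cU [du [dv dw]]] : (#|U| = 9 /\ d u = 2 /\ d v = 2 /\ d w = 2)%N.
    by move: sm h1 h2 h3; clear -n79 UW; lia.
  have bC : branching [:: v; u; w].
    exact: perm_trans (permEl (perm_catCA [:: v] [:: u] [:: w])) bs.
  have bR : branching [:: w; u; v] := perm_trans (permEl (perm_catC [:: w] [:: u; v])) bs.
  have bR' : branching [:: v; w; u] := perm_trans (permEl (perm_catC [:: v; w] [:: u])) bs.
  case Fuv : (F u v); case Fuw : (F u w); case Fvw : (F v w).
  + exact: (triangle u v w).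
  + exact: (path5 u v w).
  + by apply: (path5 v u w); rewrite // Fs.
  + exact: (edge u v w).
  + by apply: (path5 w u v); rewrite // Fs.
  + by apply: (edge w u v) => //; rewrite Fs.
  + by apply: (edge v w u) => //; rewrite Fs.
  + exact: (edgeless u v w).
- have := big u (in1 _ _); have := big v (in2 _ _ _); have := big w (in3 _ _ _ _).
  have : (1 < d x)%N by apply: big; rewrite !inE eqxx !orbT.
  by move: (\sum_(_ <- t) _)%N => q; clear -n79 UW; lia.
Qed.
End Exceptions.

(** * The induction *)

(** By parity, a sum [miss F U] below [2 n - 8] is at most [2 n - 10], which is
    what the deletion of one vertex needs. *)
Lemma odd_miss (T : finType) (F : rel T) (U : {set T}) :
  symmetric F -> irreflexive F -> ~~ odd (miss F U).
Proof.
move=> Fs Fi; have [k] := ubnP #|U|; elim: k U => // k IH U lt.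
have [->|[u uU]] := set_0Vmem U; first by rewrite /miss big_set0.
rewrite (missD1 Fs Fi uU) oddD mul2n odd_double addbF; apply: IH.
by move: lt; rewrite (cardsD1 u U) uU.
Qed.

Lemma all_deletions n (R : realFieldType) (T : finType) (U : {set T}) (F : rel T)
    (y : T -> T -> R) :
  tot_nonneg n -> (2 <= n)%N -> #|U| = n.+1 -> tri_weight U F y ->
  (forall u, u \in U -> (miss F U + 8 <= 2 * (n + deg F U u))%N) -> 0 <= tot y U.
Proof.
move=> P n2 cU tw h; have [Fs Fi _ _ _] := tw.
apply: (tot_avg tw) => [|u uU]; first by rewrite cU.
apply: (P R T _ F) => //.
- by move: cU; rewrite (cardsD1 u U) uU => -[].
- exact: tri_weightS (subsetDl _ _) tw.
- have := h u uU; rewrite (missD1 Fs Fi uU); clear; lia.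
Qed.

Section Degrees.
Variables (T : finType) (U : {set T}) (F : rel T).
Local Notation d := (deg F U).
Local Notation W := [set u in U | (0 < d u)%N].

Lemma miss_sumW : miss F U = (\sum_(u in W) d u)%N.
Proof.
rewrite /miss big_mkcond [RHS]big_mkcond; apply: eq_bigr => u _.
by rewrite inE -[X in (if _ then X else _)]/(d u); case: (u \in U) => //=; case: (d u).
Qed.

Lemma miss_ge1 u : u \in W -> (d u + #|W| <= miss F U + 1)%N.
Proof.
move=> uW; rewrite miss_sumW (big_setD1 u) //= (cardsD1 u W) uW.
suff : (#|W :\ u| <= \sum_(v in W :\ u) d v)%N by clear; lia.
rewrite -sum1_card; apply: leq_sum => v; rewrite !inE => /and3P[_ _ //].
Qed.

Lemma miss_ge2 u v : u \in W -> v \in W -> u != v -> (d u + d v + #|W| <= miss F U + 2)%N.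
Proof.
move=> uW vW uv; have vWu : v \in W :\ u by rewrite in_setD1 eq_sym uv.
rewrite miss_sumW (big_setD1 u) //= (big_setD1 v) //= (cardsD1 u W) uW (cardsD1 v (W :\ u)) vWu.
suff : (#|(W :\ u) :\ v| <= \sum_(x in (W :\ u) :\ v) d x)%N by clear; lia.
rewrite -sum1_card; apply: leq_sum => x; rewrite !inE => /and4P[_ _ _ //].
Qed.

Lemma miss_le1 m : (1 <= m)%N ->
  (forall u v, u \in W -> v \in W -> (1 < d u)%N -> (1 < d v)%N -> u = v) ->
  (forall u, u \in W -> d u <= m)%N -> (miss F U < #|W| + m)%N.
Proof.
move=> m1 one max.
have le (A : {set T}) : (forall v, v \in A -> d v <= 1)%N -> (\sum_(v in A) d v <= #|A|)%N.
  by move=> h; rewrite -sum1_card; apply: leq_sum.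
rewrite miss_sumW; case: (pickP [pred u in W | 1 < d u]%N) => [u /andP[/= uW du]|none].
  rewrite (big_setD1 u) //= (cardsD1 u W) uW.
  have /le : (forall v, v \in W :\ u -> d v <= 1)%N.
    move=> v; rewrite in_setD1 => /andP[vu vW]; rewrite leqNgt; apply: contra vu => dv.
    by apply/eqP/one.
  by have := max u uW; clear; lia.
have /le : (forall v, v \in W -> d v <= 1)%N.
  by move=> v vW; rewrite leqNgt; have := none v; rewrite /= vW /= => ->.
by move: m1; clear; lia.
Qed.
End Degrees.

(** The case distinction of the introduction.  For [n = 7], the induction
    hypothesis is empty; if [F] has three pairs, it leaves one, two, or at least
    three vertices isolated, and if it has fewer, at least three. *)
Lemma tot_nonneg_ge7 n : (7 <= n)%N -> tot_nonneg n.
Proof.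
have [k] := ubnP n; elim: k n => // k IHk n ltn n7 R T U F y cU tw hm.
have IH m : (7 <= m)%N -> (m < n)%N -> tot_nonneg m.
  by move=> m7 mn; apply: IHk => //; apply: leq_trans mn _.
have [Fs Fi ys y0 yt] := tw.
have ev := odd_miss U Fs Fi.
pose I := [set u in U | deg F U u == 0%N].
have [eI|I0] := eqVneq #|I| 0%N.
  have dpos u : u \in U -> (0 < deg F U u)%N.
    move=> uU; rewrite lt0n; apply/negP => du.
    by move/cards0_eq/setP/(_ u): eI; rewrite !inE uU du.
  have : (n <= miss F U)%N.
    by rewrite -cU -sum1_card; apply: leq_sum => u uU; apply: dpos.
  case: n n7 cU hm IH {ltn} => // n n7 cU hm IH mn.
  have n7' : (7 <= n)%N by move: hm mn n7; clear; lia.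
  apply: (all_deletions (IH n n7' (ltnSn n)) _ cU tw).
    by apply: leq_trans n7'.
  by move=> u /dpos; move: hm; clear; lia.
have IU : I \subset U by apply/subsetP => u; rewrite inE => /andP[].
have eW : U :\: I = [set u in U | (0 < deg F U u)%N].
  by apply/setP => u; rewrite !inE lt0n; case: (u \in U); rewrite ?andbT ?andbF.
have FI x b : x \in I -> b \in U -> F x b = false.
  rewrite inE => /andP[_ /eqP dx] bU; move: dx; rewrite /deg (big_setD1 b) //=.
  by case: (F x b).
have i0 : (0 < #|I|)%N by rewrite lt0n.
have [y' [eta [z [cfg ty]]]] := symmetrise tw IU i0 FI.
have cWI := card_cfg cfg.
have dW u : u \in U :\: I -> deg F (U :\: I) u = deg F U u.
  by move=> uW; rewrite (deg_W cfg).
have deg_gt0 u : u \in U :\: I -> (0 < deg F (U :\: I) u)%N.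
  by move=> uW; rewrite dW //; move: uW; rewrite eW inE => /andP[].
have small : (3 <= #|I|)%N -> (#|U :\: I| <= #|I| + 2)%N -> 0 <= tot y U.
  move=> i3 wi; rewrite -ty; apply: (small_support_nonneg cfg) => //; rewrite cU //.
(* fewer than n - 4 missing pairs *)
have [lt8|ge8] := ltnP (miss F U + 8) (2 * n)%N.
  have [n8|n7'] := ltnP 7 n.
    case: n n7 n8 cU hm IH lt8 {ltn} => // n n7 n8 cU hm IH lt8.
    apply: (all_deletions (IH n n8 (ltnSn n)) _ cU tw).
      by move: n8; clear; lia.
    move=> u uU; move: lt8 (odd_double_half (miss F U)); rewrite (negPf ev) -mul2n; clear; lia.
  (* n = 7: two pairs meet at most four vertices *)
  have w4 : (#|U :\: I| <= miss F U)%N.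
    rewrite miss_sumW -eW -sum1_card; apply: leq_sum => u.
    by rewrite eW inE => /andP[].
  by apply: small; move: w4 lt8 cWI (odd_double_half (miss F U));
    rewrite (negPf ev) -mul2n cU; move: n7' n7; clear; lia.
have missU : (miss F U + 8 = 2 * #|U|)%N by rewrite cU; apply/eqP; rewrite eqn_leq hm ge8.
have [n8|n7'] := ltnP 7 n; last first.
  have [i3|i2] := leqP 3 #|I|.
    by apply: small; move: cWI n7' i3; rewrite cU; clear; lia.
  have deg_small u : u \in U -> (3 * deg F U u <= #|U|)%N.
    move=> uU; case: (posnP (deg F U u)) => [-> //|du].
    have uW : u \in [set u in U | (0 < deg F U u)%N] by rewrite inE uU.
    have := miss_ge1 uW; rewrite -eW; move: missU cWI; rewrite cU.
    by move: i2 n7' n7; clear; lia.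
  have [i1|i1] := eqVneq #|I| 1%N.
    apply: (one_isolated_exceptions_nonneg tw missU).
    - by rewrite cU n7 (leq_trans n7').
    - by rewrite -eW cWI i1 addn1.
    move=> u v uU vU du dv; apply/eqP; apply: contraTT isT => uv.
    have uW : u \in [set u in U | (0 < deg F U u)%N] by rewrite inE uU ltnW.
    have vW : v \in [set u in U | (0 < deg F U u)%N] by rewrite inE vU ltnW.
    have := miss_ge2 uW vW uv; rewrite -eW; move: missU cWI; rewrite cU i1.
    by move: du dv n7'; clear; lia.
  apply: (two_isolated_exceptions_nonneg tw missU deg_small).
  - by rewrite cU n7 (leq_trans n7').
  - by rewrite -eW cWI; move: i0 i1 i2; clear; lia.
have [/existsP[u /andP[uU hub]]|] := boolP [exists u, (u \in U) && (n < 3 * deg F U u)%N].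
  case: n n7 n8 cU hm IH hub {ltn ge8} => // n n7 n8 cU hm IH hub.
  exact: (hub_nonneg (IH n n8 (ltnSn n)) cU n8 tw hm uU hub).
rewrite negb_exists => /forallP nohub.
have deg_small u : u \in U -> (3 * deg F U u <= #|U|)%N.
  by move=> uU; have := nohub u; rewrite uU /= -leqNgt cU.
have deg_small' u : u \in U :\: I -> (3 * deg F (U :\: I) u <= n)%N.
  by move=> uW; rewrite dW // -cU deg_small //; move: uW; rewrite inE => /andP[].
have [i3|i2] := leqP 3 #|I|.
  have [n9|n8'] := leqP 9 n.
    by rewrite -ty; apply: (many_isolated_nonneg cfg deg_gt0 missU cU IH deg_small').
  by apply: small; move: cWI n8' i3; rewrite cU; clear; lia.
have [i1|i1] := eqVneq #|I| 1%N; last first.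
  have {i1}i2 : #|I| = 2%N by move: i0 i1 i2; clear; lia.
  have [n10|n9] := leqP 10 n.
    by rewrite -ty; apply: (two_isolated_nonneg cfg deg_gt0 missU cU IH).
  apply: (two_isolated_exceptions_nonneg tw missU deg_small); first by rewrite cU n7.
  by rewrite -eW cWI i2.
have [/exists_inP[u uW /exists_inP[v vW /and3P[uv du dv]]]|none] :=
  boolP [exists u in U :\: I, [exists v in U :\: I,
    [&& u != v, 1 < deg F U u & 1 < deg F U v]%N]].
  rewrite -ty; apply: (one_isolated_nonneg cfg deg_gt0 missU cU IH i1 _ uW vW uv).
  - have := uW; have := vW; rewrite eW => vW' uW'.
    have := miss_ge2 uW' vW' uv; rewrite -eW; move: missU cWI; rewrite cU i1.
    by move: du dv; clear; lia.
  - by rewrite dW.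
  - by rewrite dW.
have one u v : u \in U :\: I -> v \in U :\: I -> (1 < deg F U u)%N -> (1 < deg F U v)%N -> u = v.
  move=> uW vW du dv; apply/eqP; apply: contraNT none => uv.
  by apply/exists_inP; exists u => //; apply/exists_inP; exists v => //; rewrite uv du.
apply: (one_isolated_exceptions_nonneg tw missU).
(* a single vertex of degree at least 2 has degree n - 6, and this is at most
   n / 3 only if n <= 9 *)
- rewrite cU n7 /=.
  have := @miss_le1 T U F (n %/ 3); rewrite -eW => /(_ _ one) h.
  have : (miss F U < #|U :\: I| + n %/ 3)%N.
    apply: h; first by rewrite leq_divRL // (leq_trans _ n7).
    by move=> u uW; rewrite leq_divRL // mulnC -cU deg_small //; move: uW; rewrite inE => /andP[].
  have := leq_trunc_div n 3; move: missU cWI; rewrite cU i1.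
  by clear; lia.
- by rewrite -eW cWI i1 addn1.
- move=> u v uU vU du dv; apply: one => //; rewrite eW inE ?uU ?vU; exact: ltnW.
Qed.

(** * Linear programming duality *)

(** Induction on the generators.  Let [y0] separate [c] from the generators in
    [r].  If [y0] is negative on the new generator [a i], project all
    functionals along [y0] onto the hyperplane where [a i] vanishes, and apply
    the induction hypothesis again.  A representation of the projected [c]
    lifts, because the coefficient of [a i] comes out nonnegative. *)
Lemma farkas (R : realFieldType) (E : finType) (I : eqType) (r : seq I)
    (a : I -> E -> R) (c : E -> R) : uniq r ->
  (exists2 lam : I -> R, (forall i, i \in r -> 0 <= lam i) &
     forall e, c e = \sum_(i <- r) lam i * a i e) \/
  (exists2 y : E -> R, (forall i, i \in r -> 0 <= \sum_e a i e * y e) &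
     \sum_e c e * y e < 0).
Proof.
elim: r a c => [|i r IH] a c /=.
  move=> _; have [c0|] := boolP [forall e, c e == 0].
    by left; exists (fun => 0) => // e; rewrite big_nil (eqP (forallP c0 e)).
  rewrite negb_forall => /existsP[e ce]; right; exists (fun x => - c x) => //.
  rewrite (bigD1 e) //= mulrN -expr2.
  have : 0 < c e ^+ 2 by rewrite exprn_even_gt0.
  have : \sum_(x | x != e) c x * - c x <= 0.
    by apply: sumr_le0 => x _; rewrite mulrN -expr2 oppr_le0 sqr_ge0.
  lra.
move=> /andP[ir ur]; have [[lam lam0 lamE]|[y0 ay cy]] := IH a c ur.
  left; exists (fun j => if j == i then 0 else lam j) => [j|e].
    by rewrite inE; case: eqP => //= _ /lam0.
  rewrite big_cons eqxx mul0r add0r lamE; apply: eq_big_seq => j jr.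
  by rewrite ifN //; apply: contraNneq ir => <-.
pose dot (f g : E -> R) := \sum_e f e * g e.
have [ai|ai] := leP 0 (dot (a i) y0).
  by right; exists y0 => // j; rewrite inE => /orP[/eqP->|/ay].
(* project along [y0] onto the hyperplane where [a i] vanishes *)
pose k := - dot (a i) y0; have k0 : 0 < k by rewrite oppr_gt0.
pose pr f e := f e + a i e * (dot f y0 / k).
have prE f y : dot (pr f) y = dot f (fun e => y e + dot (a i) y / k * y0 e).
  rewrite /pr; set D := dot f y0 / k; transitivity (dot f y + D * dot (a i) y).
    by rewrite /dot mulr_sumr -big_split; apply: eq_bigr => e _ /=; ring.
  set D' := dot (a i) y / k.
  transitivity (dot f y + D' * dot f y0); first by rewrite /D /D'; ring.
  by rewrite /dot mulr_sumr -big_split; apply: eq_bigr => e _ /=; ring.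
have [[lam lam0 lamE]|[y ay' cy']] := IH (fun j => pr (a j)) (pr c) ur.
  left; pose li := \sum_(j <- r) lam j * (dot (a j) y0 / k) - dot c y0 / k.
  exists (fun j => if j == i then li else lam j) => [j|e].
    rewrite inE; case: eqP => /= [_ _|_ /lam0 //].
    rewrite subr_ge0; apply: (@le_trans _ _ 0).
      by rewrite pmulr_lle0 ?invr_gt0 // ltW.
    rewrite big_seq; apply: sumr_ge0 => x xr.
    by rewrite mulr_ge0 ?lam0 // divr_ge0 ?(ltW k0) // ay.
  have := lamE e; rewrite {1}/pr => h.
  rewrite big_cons eqxx.
  rewrite (eq_big_seq (fun j => lam j * a j e)); last first.
    by move=> j jr; rewrite ifN //; apply: contraNneq ir => <-.
  have e1 : \sum_(j <- r) lam j * pr (a j) e =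
     \sum_(j <- r) lam j * a j e + a i e * \sum_(j <- r) lam j * (dot (a j) y0 / k).
    by rewrite mulr_sumr -big_split; apply: eq_bigr => j _; rewrite /pr /=; ring.
  rewrite e1 in h; rewrite /li mulrBl; lra.
right; exists (fun e => y e + dot (a i) y / k * y0 e); last by rewrite -[X in X < _]prE.
move=> j; rewrite inE => /orP[/eqP->|/ay' h]; last by rewrite -[X in _ <= X]prE.
rewrite -[X in _ <= X]/(dot _ _) -prE /dot /pr big1 // => e _.
have -> : dot (a i) y0 / k = -1 by rewrite /k invrN mulrN divff // lt_eqF.
by rewrite mulrN1 subrr mul0r.
Qed.

(** A set of [k] elements of [A] where [y] is largest, with a threshold [th];
    elements with [y <= 0] are not admitted, and if that leaves fewer than
    [k] elements, the threshold is [0]. *)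
Lemma top_set (R : realFieldType) (E : finType) (A : {set E}) (y : E -> R) (k : nat) :
  exists (B : {set E}) (th : R), [/\ B \subset A, 0 <= th, (#|B| <= k)%N,
    (forall e, e \in B -> th <= y e) /\ (forall e, e \in A :\: B -> y e <= th) &
    #|B| = k \/ th = 0].
Proof.
elim: k => [|k [B [th [BA th0 Bk [yB yA] eq]]]].
  exists set0, (\sum_e `|y e|); split; rewrite ?sub0set ?cards0 //.
  - by apply: sumr_ge0.
  - split=> e; first by rewrite inE.
    move=> _; rewrite (bigD1 e) //=; apply: le_trans (ler_norm _) _.
    by rewrite lerDl sumr_ge0.
  - by left.
have [S0|[e0 e0S]] := set_0Vmem [set e in A :\: B | 0 < y e].
  exists B, 0; split=> //; first exact: leqW; last by right.
  split=> e => [/yB|eAB]; first exact: le_trans.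
  by move/setP/(_ e): S0; rewrite in_set0 inE eAB /= leNgt => ->.
case: eq => [eq|eq]; last first.
  move: e0S; rewrite inE => /andP[/yA]; rewrite eq => h h'.
  by have := le_lt_trans h h'; rewrite ltxx.
have [e eS max] := arg_maxP y e0S.
have {eS} : e \in [set e in A :\: B | 0 < y e] := eS.
rewrite inE => /andP[/[dup] eAB /setDP[eA eB] ye].
exists (e |: B), (y e); split.
- by rewrite subUset sub1set eA.
- exact: ltW.
- by rewrite cardsU1 eB eq.
- split=> x; first by rewrite !inE => /orP[/eqP->//|/yB]; apply: le_trans; apply: yA.
  rewrite !inE negb_or -andbA => /and3P[xe xB xA].
  have [|x0] := leP (y x) 0; first by move/le_trans; apply; apply: ltW.
  have xS : x \in [set e in A :\: B | 0 < y e] by rewrite !inE xB xA.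
  exact: (max x xS).
- by left; rewrite cardsU1 eB eq.
Qed.

Lemma sum_pairs (V : nmodType) (T : finType) (A : {set T}) (g : {set T} -> V) :
  \sum_(a in A) \sum_(b in A | a != b) g [set a; b] =
  (\sum_(e : {set T} | (e \subset A) && (#|e| == 2%N)) g e) *+ 2.
Proof.
rewrite pair_big_dep /=.
rewrite (partition_big (fun p : T * T => [set p.1; p.2])
   (fun e : {set T} => (e \subset A) && (#|e| == 2%N))) /=; last first.
  move=> [a b] /= /and3P[aA bA ab]; rewrite cards2 ab andbT.
  by apply/subsetP => x; rewrite !inE => /orP[] /eqP->.
rewrite -sumrMnl; apply: eq_bigr => e /andP[eA /cards2P[a [b [ab ee]]]].
have aA : a \in A by apply: (subsetP eA); rewrite ee !inE eqxx.
have bA : b \in A by apply: (subsetP eA); rewrite ee !inE eqxx orbT.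
rewrite (bigD1 (a, b)) /=; last by rewrite aA bA ab ee /=.
rewrite (bigD1 (b, a)) /=; last first.
  by rewrite aA bA eq_sym ab ee setUC eqxx /= xpair_eqE negb_and ab orbT.
rewrite big1 ?addr0 => [|[x x'] /= /andP[/andP[/andP[/and3P[_ _ xx'] /eqP e'] n1] n2]].
  by rewrite [[set b; a]]setUC -ee mulr2n.
exfalso; have : x \in e by rewrite -e' !inE eqxx.
have : x' \in e by rewrite -e' !inE eqxx orbT.
rewrite ee !inE => /orP[] /eqP ex' /orP[] /eqP ex; move: xx' n1 n2; rewrite ex ex' ?eqxx //.
Qed.

(** Let [B] and [th] be given by [top_set] for [n - 4] edges.  Replacing [phi] by
    [0] on [B] and by [1] elsewhere moves an amount of [phi] from weights at
    least [th] to weights at most [th].  If [B] has [n - 4] edges, the hypothesis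
    on the sum of [phi] says that no more is added than removed, and otherwise
    [th = 0]; so the sum of [phi e * y e] does not increase.  The claim of the
    induction then applies with [F] the relation defined by [B]. *)
Lemma dual_nonneg (R : realFieldType) (T : finType) (n : nat) (phi y : {set T} -> R) :
  #|T| = n -> (7 <= n)%N ->
  (forall e : {set T}, #|e| = 2%N -> 0 <= phi e <= 1) ->
  'C(n, 2)%:R - (n%:R - 4) <= \sum_(e : {set T} | #|e| == 2%N) phi e ->
  (forall t : {set T}, #|t| = 3%N ->
     0 <= \sum_(e : {set T} | (e \subset t) && (#|e| == 2%N)) y e) ->
  0 <= \sum_(e : {set T} | #|e| == 2%N) phi e * y e.
Proof.
move=> cT n7 phi01 sphi ytri.
pose A := [set e : {set T} | #|e| == 2%N].
have [B [th [BA th0 Bk [yB yA] eB]]] := top_set A y (n - 4).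
pose F : rel T := fun a b => (a != b) && ([set a; b] \in B).
pose y' a b := if (a == b) || F a b then 0 else y [set a; b].
have Fs : symmetric F by move=> a b; rewrite /F eq_sym setUC.
have ys a b : y' a b = y' b a by rewrite /y' (eq_sym b) (Fs b) [[set b; a]]setUC.
have totE : tot y' [set: T] = (\sum_(e in A :\: B) y e) *+ 2.
  transitivity (\sum_(a in [set: T]) \sum_(b in [set: T] | a != b)
      (fun e => if e \in B then 0 else y e) [set a; b]).
    apply: eq_bigr => a _; rewrite [RHS]big_mkcondr; apply: eq_bigr => b _.
    by rewrite /y' /F; case: eqP.
  rewrite (sum_pairs _ (fun e => if e \in B then 0 else y e)); congr (_ *+ 2).
  rewrite big_mkcond [RHS]big_mkcond.
  apply: eq_bigr => e _; rewrite !inE subsetT /=.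
  by case: (_ == _) => /=; rewrite ?andbF // andbT; case: ifP.
have missE : miss F [set: T] = (2 * #|B|)%N.
  transitivity (\sum_(a in [set: T]) \sum_(b in [set: T] | a != b)
      (fun e => nat_of_bool (e \in B)) [set a; b])%N.
    apply: eq_bigr => a _; rewrite [RHS]big_mkcondr; apply: eq_bigr => b _; rewrite /F.
    by case: eqP.
  rewrite (sum_pairs _ (fun e => nat_of_bool (e \in B))) mulr2n mul2n -addnn -sum1_card.
  suff -> : (\sum_(e : {set T} | (e \subset [set: T]) && (#|e| == 2%N)) (e \in B) =
      \sum_(e in B) 1)%N by [].
  rewrite big_mkcond [RHS]big_mkcond; apply: eq_bigr => e _; rewrite subsetT /=.
  case: (boolP (e \in B)) => [/(subsetP BA)|_]; last by case: ifP.
  by rewrite inE => ->.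
have tw : tri_weight [set: T] F y'.
  split=> // [a|a b _ _ h|a b c _ _ _ ab ac bc].
  - by rewrite /F eqxx.
  - by rewrite /y' h.
  rewrite /y' /F ab ac bc (negPf ab) (negPf ac) (negPf bc) /= => /negPf-> /negPf-> /negPf->.
  have c_ab : c \notin [set a; b].
    by rewrite !inE negb_or ![c == _]eq_sym ac bc.
  have t3 : #|c |: [set a; b]| = 3%N by rewrite cardsU1 cards2 ab c_ab.
  have := ytri _ t3; rewrite -(pmulrn_lge0 _ (isT : (0 < 2)%N)) -sum_pairs.
  have sum3 (g : T -> R) : \sum_(x in c |: [set a; b]) g x = g c + (g a + g b).
    by rewrite big_setU1 //= big_setU1 ?inE //= big_set1.
  under eq_bigr => x _ do rewrite big_mkcondr sum3.
  rewrite sum3 !eqxx ![c == _]eq_sym ![b == a]eq_sym ab ac bc /=.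
  rewrite ![[set c; _]]setUC [[set b; a]]setUC; lra.
have key : 0 <= \sum_(e in A :\: B) y e.
  have := tot_nonneg_ge7 n7 (U := [set: T]) _ tw; rewrite cardsT missE totE pmulrn_lge0 //.
  by apply => //; move: Bk n7; clear; lia.
have cA : #|A| = 'C(n, 2) by rewrite card_draws cT.
have big_A (g : {set T} -> R) : \sum_(e : {set T} | #|e| == 2%N) g e =
    \sum_(e in B) g e + \sum_(e in A :\: B) g e.
  rewrite -[in X in _ = X + _](setIidPr BA) -(big_setID B).
  by apply: eq_bigl => e; rewrite inE.
rewrite big_A; rewrite big_A in sphi.
have phiA e : e \in A -> 0 <= phi e <= 1 by rewrite inE => /eqP/phi01.
have h1 : th * \sum_(e in B) phi e <= \sum_(e in B) phi e * y e.
  rewrite mulr_sumr; apply: ler_sum => e eB'; rewrite mulrC.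
  by apply: ler_wpM2l (yB _ eB'); have /andP[] := phiA e (subsetP BA _ eB').
have h2 : \sum_(e in A :\: B) y e - th * (#|A :\: B|%:R - \sum_(e in A :\: B) phi e) <=
    \sum_(e in A :\: B) phi e * y e.
  rewrite -sum1_card natr_sum -sumrB mulr_sumr -sumrB; apply: ler_sum => e eAB.
  have [eA _] := setDP eAB; have /andP[p0 p1] := phiA e eA.
  have : 0 <= (1 - phi e) * (th - y e) by rewrite mulr_ge0 ?subr_ge0 // yA.
  lra.
have h3 : 0 <= th * (\sum_(e in B) phi e + \sum_(e in A :\: B) phi e - #|A :\: B|%:R).
  case: eB => [cB|->]; last by rewrite mul0r.
  apply: mulr_ge0 => //; rewrite subr_ge0; apply: le_trans sphi.
  rewrite cardsD (setIidPr BA) natrB ?subset_leq_card // cA cB natrB //.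
  by apply: leq_trans n7.
lra.
Qed.

Lemma complete_edges (G : sgraph) : complete G -> edges G = [set e : {set G} | #|e| == 2%N].
Proof.
move=> cG; apply/setP => e; rewrite inE; apply/imsetP/cards2P.
  case=> -[a b] /=; rewrite inE /= => ab ->; exists a, b; split=> //.
  by apply: contraTneq ab => ->; rewrite adj_irrefl.
by case=> a [b [ab ->]]; exists (a, b); rewrite ?inE //=; apply: cG.
Qed.

Lemma complete_triangles (G : sgraph) :
  complete G -> triangles G = [set t : {set G} | #|t| == 3%N].
Proof.
move=> cG; apply/setP => t; rewrite !inE.
case: (#|t| == 3%N) => //=; apply/forall_inP => x _; apply/forall_inP => y _.
by apply/implyP; apply: cG.
Qed.

(** The sum over the vertices [w] in the definition of [edge_weight] is a sum over
    the triangles containing [e]: a vertex outside [e] determines such a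
    triangle, and conversely. *)
Lemma sum_extensions (V : nmodType) (T : finType) (e : {set T}) (k : nat) (f : {set T} -> V) :
  #|e| = k ->
  \sum_(w : T) (if #|w |: e| == k.+1 then f (w |: e) else 0) =
  \sum_(t : {set T} | (#|t| == k.+1) && (e \subset t)) f t.
Proof.
move=> ek; rewrite -big_mkcond /=.
rewrite (eq_bigl (mem (~: e))); last first.
  move=> w; rewrite /= cardsU1 ek inE; case: (w \in e) => //=.
    by rewrite add0n ltn_eqF.
  by rewrite add1n eqxx.
rewrite -(big_imset (h := fun w => w |: e) f) /=; last first.
  move=> w w'; rewrite !inE => we w'e eq.
  have : w \in w' |: e by rewrite -eq !inE eqxx.
  by rewrite !inE (negPf we) orbF => /eqP.
apply: eq_bigl => t; apply/imsetP/andP => [[w]|[/eqP tk et]].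
  by rewrite inE => we ->; rewrite cardsU1 we ek add1n eqxx subsetUr.
have /card_gt0P[w] : (0 < #|t :\: e|)%N.
  by rewrite cardsD (setIidPr et) tk ek subSnn.
rewrite inE => /andP[we wt]; exists w; rewrite ?inE //; apply/eqP.
by rewrite eq_sym eqEcard subUset sub1set wt et cardsU1 we tk ek add1n leqnn.
Qed.

Theorem corollary1p2 (R : realType) (G : sgraph) (n : nat)
    (G_complete : complete G) (card_G : #|G| = n) (n_ge7 : (7 <= n)%N)
    (phi : {set G} -> R)
    (phi01 : forall e, e \in edges G -> 0 <= phi e <= 1)
    (phi_sum : \sum_(e in edges G) phi e >= 'C(n, 2)%:R - (n%:R - 4%:R)) :
  exists omega : {set G} -> R,
    fractional_triangle_packing omega /\
    (forall e, e \in edges G -> edge_weight omega e = phi e).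
Proof.
rewrite /fractional_triangle_packing.
rewrite (complete_edges G_complete) (complete_triangles G_complete) in phi01 phi_sum *.
have phi01' (e : {set G}) : #|e| = 2%N -> 0 <= phi e <= 1.
  by move=> e2; apply: phi01; rewrite inE e2.
rewrite (eq_bigl (fun e : {set G} => #|e| == 2%N)) in phi_sum; last by move=> e; rewrite inE.
pose inc (t e : {set G}) : R := ((e \subset t) && (#|e| == 2%N))%:R.
have [[lam lam0 lamE]|[y ytri yphi]] := farkas inc
    (fun e => if #|e| == 2%N then phi e else 0) (enum_uniq [set t : {set G} | #|t| == 3%N]);
  last first.
  exfalso; move: yphi; rewrite ltNge => /negP; apply.
  rewrite (eq_bigr (fun e : {set G} => if #|e| == 2%N then phi e * y e else 0)); last first.
    by move=> e _; case: ifP => // _; rewrite mul0r.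
  rewrite -big_mkcond; apply: (dual_nonneg card_G n_ge7 phi01' phi_sum) => t t3.
  rewrite big_mkcond; apply: le_trans (ytri t _) _; first by rewrite mem_enum inE t3.
  rewrite le_eqVlt; apply/orP; left; apply/eqP; apply: eq_bigr => e _; rewrite /inc.
  by case: (_ && _); rewrite ?mul1r ?mul0r.
pose omega (t : {set G}) := if #|t| == 3%N then lam t else 0.
have lam_ge0 (t : {set G}) : #|t| = 3%N -> 0 <= lam t.
  by move=> t3; apply: lam0; rewrite mem_enum inE t3.
have phiE (e : {set G}) : #|e| = 2%N ->
    phi e = \sum_(t : {set G} | (#|t| == 3%N) && (e \subset t)) lam t.
  move=> e2; have := lamE e; rewrite e2 eqxx => ->; rewrite big_enum_cond /=.
  rewrite big_mkcond [RHS]big_mkcond; apply: eq_bigr => t _; rewrite inE andbT.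
  case: (#|t| == 3%N) => //=; rewrite /inc e2 eqxx andbT.
  by case: (_ \subset _); rewrite ?mulr1 ?mulr0.
have omegaE (e : {set G}) : #|e| = 2%N -> edge_weight omega e = phi e.
  by move=> e2; rewrite phiE // -sum_extensions.
exists omega; split; last by move=> e; rewrite inE => /eqP/omegaE.
split=> [t|t|e]; rewrite ?inE.
- move=> /eqP t3; rewrite /omega t3 eqxx lam_ge0 //=.
  have /card_gt1P[a [b [at' bt ab]]] : (1 < #|t|)%N by rewrite t3.
  have e2 : #|[set a; b]| = 2%N by rewrite cards2 ab.
  have /andP[_] := phi01' _ e2; apply: le_trans; rewrite (phiE _ e2) (bigD1 t) /=; last first.
    by rewrite t3 eqxx; apply/subsetP => x; rewrite !inE => /orP[] /eqP->.
  by rewrite lerDl; apply: sumr_ge0 => t' /andP[/andP[/eqP t'3 _] _]; apply: lam_ge0.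
- by move=> /negPf t3; rewrite /omega t3.
- by move=> /eqP e2; rewrite omegaE //; have /andP[] := phi01' _ e2.
Qed.
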